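(* Let $s\ge 1$, let $a_1,\dots,a_s\in\mathbb{D}$ be pairwise distinct, let $p_1,\dots,p_s$ be real numbers with $p_k>-2$ for all $k$, and let $$h(z)=\prod_{k=1}^s\left|\frac{z-a_k}{1-\overline{a_k}z}\right|^{p_k}.$$ Let $K(z,\zeta)$ be the reproducing kernel of the weighted Bergman space $A^2_h$. Then for all $z,\zeta\in\mathbb{D}$, $$K(z,\zeta)=\frac{B(z)\overline{B(\zeta)}}{(1-\overline{\zeta}z)^2}+\sum_{k=1}^s\frac{\left(\frac{p_k}{2}+1\right)B_k(z)\overline{B_k(\zeta)}\,(\overline{\zeta}z-|a_k|^2)}{(1-\overline{\zeta}z)(1-\overline{a_k}z)(1-a_k\overline{\zeta})}+\sum_{k=1}^s\sum_{j=1}^s\frac{(1-|a_k|^2)(1-|a_j|^2)B_k(z)\overline{B_j(\zeta)}}{(1-\overline{a_k}z)(1-a_j\overline{\zeta})B_k(a_k)\overline{B_j(a_j)}}K(a_k,a_j).$$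
   Context: $\mathbb{D}=\{z\in\mathbb{C}:|z|<1\}$ and $d\sigma=\pi^{-1}dA$ is the normalized area measure on $\mathbb{D}$. For an integrable weight $h\ge 0$ on $\mathbb{D}$, $A^2_h$ is the space of functions $f$ analytic in $\mathbb{D}$ with $\int_{\mathbb{D}}|f|^2h\,d\sigma<\infty$. When point evaluations on $A^2_h$ are bounded (true for the weights considered here), the reproducing kernel of $A^2_h$ is the unique function $K(z,\zeta)$ on $\mathbb{D}\times\mathbb{D}$, analytic in $z$ and in $\overline{\zeta}$, with $f(z)=\int_{\mathbb{D}}f(\zeta)K(z,\zeta)h(\zeta)\,d\sigma(\zeta)$ for all $f\in A^2_h$, $z\in\mathbb{D}$. The Blaschke products are $$B(z)=\prod_{k=1}^s\frac{z-a_k}{1-\overline{a_k}z},\qquad B_k(z)=\prod_{1\le j\le s,\,j\ne k}\frac{z-a_j}{1-\overline{a_j}z}\quad(1\le k\le s),$$ with empty products equal to $1$. *)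

(* Defs.v *)
(* MathComp-Analysis, over an arbitrary [R : realType]; the complex field is
   [R[i]] from mathcomp-real-closed. *)
From HB Require Import structures.
From mathcomp Require Import all_boot all_order all_algebra.
From mathcomp Require Import all_classical all_reals all_analysis.
From mathcomp Require Import complex.

Set Implicit Arguments.
Unset Strict Implicit.
Unset Printing Implicit Defensive.

Import Order.TTheory GRing.Theory Num.Theory.
Import numFieldNormedType.Exports.

Local Open Scope classical_set_scope.
Local Open Scope ring_scope.
Local Open Scope complex_scope.

(* [`|z|] is an element of R[i] for [z : R[i]]; [cabs z] is the same modulus as
   an element of R. *)
Definition cabs (R : realType) (z : R[i]) : R := complex.Re `|z|.

Definition unit_disc (R : realType) : set R[i] := [set z | `|z| < 1].

(* Complex differentiability at every point of the disc. The regular-module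
   annotations [^o] select the topology and normed-module structure of R[i]
   over itself, so that increments range over complex numbers. *)
Definition analytic_in_disc (R : realType) (f : R[i] -> R[i]) : Prop :=
  forall z, unit_disc z -> derivable (f : R[i]^o -> R[i]^o) z 1.

(* Area integrals are taken over R * R, identified with R[i]. *)
Definition to_complex (R : realType) (w : R * R) : R[i] := w.1 +i* w.2.

Definition disc2 (R : realType) : set (R * R) :=
  @to_complex R @^-1` @unit_disc R.

(* Normalized area measure: pi^-1 times the planar Lebesgue measure. *)
Definition sigma_area (R : realType) :
    {measure set (measurableTypeR R * measurableTypeR R) -> \bar R} :=
  mscale ((NngNum (pi_ge0 R))%:num^-1)%:nng
         (lebesgue_measure \x lebesgue_measure)%E.

Definition disc_integrable (R : realType) (g : R[i] -> R[i]) : Prop :=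
  (@sigma_area R).-integrable (@disc2 R)
    (fun w => (complex.Re (g (to_complex w)))%:E) /\
  (@sigma_area R).-integrable (@disc2 R)
    (fun w => (complex.Im (g (to_complex w)))%:E).

Definition disc_integral (R : realType) (g : R[i] -> R[i]) : R[i] :=
  Rintegral (@sigma_area R) (@disc2 R)
    (fun w => complex.Re (g (to_complex w)))
  +i* Rintegral (@sigma_area R) (@disc2 R)
    (fun w => complex.Im (g (to_complex w))).

(* The weighted Bergman space A^2_h; only the values of [f] and [h] on the disc
   matter. *)
Definition bergman2 (R : realType) (h : R[i] -> R) (f : R[i] -> R[i]) : Prop :=
  analytic_in_disc f /\
  (\int[@sigma_area R]_(w in @disc2 R)
     (cabs (f (to_complex w)) ^+ 2 * h (to_complex w))%:E < +oo)%E.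

(* Analyticity in the conjugate of zeta is analyticity of
   zeta |-> (K z zeta)^*. The integral of a non-integrable function is a junk
   value in the library, so the convergence of the reproducing integral is
   stated explicitly. *)
Definition reproducing_kernel (R : realType) (h : R[i] -> R)
    (K : R[i] -> R[i] -> R[i]) : Prop :=
  [/\ forall zeta, unit_disc zeta -> analytic_in_disc (fun z => K z zeta),
      forall z, unit_disc z -> analytic_in_disc (fun zeta => ((K z zeta)^*)%R) &
      forall f z, bergman2 h f -> unit_disc z ->
        disc_integrable (fun zeta => f zeta * K z zeta * (h zeta)%:C) /\
        f z = disc_integral (fun zeta => f zeta * K z zeta * (h zeta)%:C)].

Definition blaschke_factor (R : realType) (a z : R[i]) : R[i] :=
  (z - a) / (1 - a^* * z).

Definition blaschke (R : realType) (s : nat) (a : 'I_s -> R[i]) (z : R[i]) :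
    R[i] :=
  \prod_(k < s) blaschke_factor (a k) z.

Definition blaschke_except (R : realType) (s : nat) (a : 'I_s -> R[i])
    (k : 'I_s) (z : R[i]) : R[i] :=
  \prod_(j < s | j != k) blaschke_factor (a j) z.

(* [0 `^ x] is 0 for x != 0, so for negative exponents the value at the points
   a_k is 0 rather than infinite; this concerns finitely many points only. *)
Definition blaschke_weight (R : realType) (s : nat) (a : 'I_s -> R[i])
    (p : 'I_s -> R) (z : R[i]) : R :=
  \prod_(k < s) cabs (blaschke_factor (a k) z) `^ p k.

(* Main.v *)
Require Import Defs.
From HB Require Import structures.
From mathcomp Require Import all_boot all_order all_algebra.
From mathcomp Require Import all_classical all_reals all_analysis.
From mathcomp Require Import measurable_realfun.
From mathcomp Require Import complex ring lra.
Set Implicit Arguments.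
Unset Strict Implicit.
Unset Printing Implicit Defensive.
Import Order.TTheory GRing.Theory Num.Theory.
Import numFieldNormedType.Exports.
Local Open Scope classical_set_scope.
Local Open Scope complex_scope.
Local Open Scope ring_scope.

(** The formula comes from one integration by parts, a residue computation and
    the symmetry of [K].

    Fix w in the disc and let g be the conjugate of [K w], a holomorphic
    function. For zeta in the disc, outside the points a_k, put
    q(z) = z / (1 - conj(zeta) z). Let dz denote the derivative with respect
    to z and phi_k the Blaschke factors. Since dz h is h times the sum of the
    (p_k / 2) phi_k' / phi_k, and the zeros of B cancel these poles, the
    function f = dz (B q h) / h is bounded and holomorphic ([wder]), hence
    belongs to the weighted Bergman space, and f(w) is the integral of
    f conj(g) h. As conj(g) is antiholomorphic, f conj(g) h is the
    z-derivative of B q h conj(g); so for a radial cutoff chi the integral of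
    chi f conj(g) h is minus the integral of (dz chi) B q h conj(g)
    ([green_pairing]). When chi tends to 1, dz chi concentrates on the unit
    circle, where |B| = h = 1 and q = 1 / conj(z - zeta): one may replace
    B q h by 1 / conj(B (z - zeta)), the error being O(1 - |z|^2)
    ([boundary_estimate], [boundary_limit]). The partial fractions of
    1 / (B (z - zeta)) have simple poles at zeta and at the a_k
    ([partial_fractions]), and minus the integral of
    (dz chi) conj(g) / conj(z - alpha) tends to conj(g(alpha))
    ([pole_value], [point_mass_limit]). The outcome, [kernel_expansion],
    writes K(w, zeta) as an explicit function plus a combination of the
    K(w, a_k) with explicit coefficients.

    In particular [K w] is bounded, so its conjugate lies in the weighted
    Bergman space; reproducing it yields K(w, zeta) = conj(K(zeta, w))
    ([kernel_hermitian]). Expanding K(w, a_k) = conj(K(a_k, w)) once more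
    gives the formula ([kernel_formula]).

    Two analytic facts underlie this. The function g is only known to be
    complex differentiable, and its orthogonality to derivatives of test
    functions ([holo_test_b]) is obtained by a Goursat bisection in which
    refinable spline bumps take the place of squares. The weight is integrable
    because p_k > -2 ([rint_weight]); the singular points are treated by
    regularizing h and passing to the limit by dominated convergence. *)

(** * Modulus and pointwise continuity on the complex plane *)

Section cabs.
Variable R : realType.
Implicit Types (x y z : R[i]) (r : R).

Lemma conjCE z : z^* = z^*%C.
Proof.
by [].
Qed.

Lemma normc_cabs z : `|z| = (cabs z)%:C.
Proof. by rewrite /cabs {1}normc_def; congr (_%:C); rewrite normc_def. Qed.

Lemma cabs_ge0 z : 0 <= cabs z.
Proof. by rewrite -lecR -normc_cabs; exact: normr_ge0. Qed.

Lemma cabsM x y : cabs (x * y) = cabs x * cabs y.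
Proof. by apply: complexI; rewrite rmorphM /= -!normc_cabs normrM. Qed.

Lemma cabsD x y : cabs (x + y) <= cabs x + cabs y.
Proof. by rewrite -lecR rmorphD /= -!normc_cabs ler_normD. Qed.

Lemma cabsN x : cabs (- x) = cabs x.
Proof. by rewrite /cabs normrN. Qed.

Lemma cabsB x y : cabs (x - y) <= cabs x + cabs y.
Proof. by rewrite -[cabs y]cabsN cabsD. Qed.

Lemma cabs_distC x y : cabs (x - y) = cabs (y - x).
Proof. by rewrite -cabsN opprB. Qed.

Lemma cabsV x : cabs x^-1 = (cabs x)^-1.
Proof. by apply: complexI; rewrite fmorphV /= -!normc_cabs normfV. Qed.

Lemma cabs0 : cabs (0 : R[i]) = 0.
Proof. by rewrite /cabs normr0. Qed.

Lemma cabs1 : cabs (1 : R[i]) = 1.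
Proof. by rewrite /cabs normr1. Qed.

Lemma cabs_eq0 x : (cabs x == 0) = (x == 0).
Proof. by rewrite -(inj_eq (@complexI _)) -normc_cabs normr_eq0. Qed.

Lemma cabs_gt0 x : (0 < cabs x) = (x != 0).
Proof. by rewrite lt_neqAle cabs_ge0 andbT eq_sym cabs_eq0. Qed.

Lemma cabsJ x : cabs x^* = cabs x.
Proof. by apply: complexI; rewrite -!normc_cabs conjCE normcJ. Qed.

Lemma cabsR r : cabs r%:C = `|r|.
Proof. by rewrite /cabs normc_def /= expr0n /= addr0 sqrtr_sqr. Qed.

Lemma cabsi : cabs ('i%C : R[i]) = 1.
Proof. by rewrite /cabs normc_def /= expr0n expr1n /= add0r sqrtr1. Qed.

Lemma cabsX x n : cabs (x ^+ n) = cabs x ^+ n.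
Proof. by elim: n => [|n IH]; rewrite ?expr0 ?cabs1 // !exprS cabsM IH. Qed.

Lemma cabs_sqr z : cabs z ^+ 2 = complex.Re z ^+ 2 + complex.Im z ^+ 2.
Proof.
rewrite /cabs normc_def /= sqr_sqrtr //.
by rewrite addr_ge0 // sqr_ge0.
Qed.

Lemma cabs_sqrC z : (cabs z ^+ 2)%:C = z * z^*.
Proof. by rewrite rmorphXn /= -normc_cabs conjCE sqr_normc. Qed.

Lemma normRe_cabs z : `|complex.Re z| <= cabs z.
Proof. by rewrite -lecR -normc_cabs normc_ge_Re. Qed.

Lemma normIm_cabs z : `|complex.Im z| <= cabs z.
Proof.
rewrite -(@ler_pXn2r _ 2) ?nnegrE ?cabs_ge0 //.
by rewrite real_normK ?num_real // cabs_sqr lerDr sqr_ge0.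
Qed.

Lemma cabs_le_ReIm z : cabs z <= `|complex.Re z| + `|complex.Im z|.
Proof.
rewrite {1}[z]complexE (le_trans (cabsD _ _)) //.
by rewrite cabsM cabsi mul1r !cabsR.
Qed.

Lemma cabs_dist x y : `|cabs x - cabs y| <= cabs (x - y).
Proof.
have := cabsD (x - y) y; have := cabsD (y - x) x.
rewrite !subrK -(cabs_distC x y) => h1 h2.
by rewrite ler_norml; apply/andP; split; lra.
Qed.

Lemma cabs_sum (I : Type) (s : seq I) (P : pred I) (F : I -> R[i]) :
  cabs (\sum_(i <- s | P i) F i) <= \sum_(i <- s | P i) cabs (F i).
Proof.
elim/big_ind2: _ => [|x a y b xa yb|//]; first by rewrite cabs0.
by rewrite (le_trans (cabsD _ _)) // lerD.
Qed.

Lemma cabs_prod (I : Type) (s : seq I) (P : pred I) (F : I -> R[i]) :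
  cabs (\prod_(i <- s | P i) F i) = \prod_(i <- s | P i) cabs (F i).
Proof.
elim/big_ind2: _ => [|x a y b <- <-|//]; first by rewrite cabs1.
by rewrite cabsM.
Qed.

Lemma unit_discE z : unit_disc z <-> cabs z < 1.
Proof. by rewrite /unit_disc /= normc_cabs -(ltcR (cabs z)). Qed.

Lemma conjR r : (r%:C : R[i])^* = r%:C.
Proof. exact: conjc_real. Qed.

Lemma conji : ('i%C : R[i])^* = - 'i%C.
Proof. by rewrite conjCE; apply/eqP; rewrite eq_complex /= oppr0 !eqxx. Qed.

Lemma ReD x y : complex.Re (x + y) = complex.Re x + complex.Re y.
Proof. by case: x; case: y. Qed.
Lemma ImD x y : complex.Im (x + y) = complex.Im x + complex.Im y.
Proof. by case: x; case: y. Qed.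
Lemma ReN x : complex.Re (- x) = - complex.Re x.
Proof. by case: x. Qed.
Lemma ImN x : complex.Im (- x) = - complex.Im x.
Proof. by case: x. Qed.
Lemma ReM x y : complex.Re (x * y) =
  complex.Re x * complex.Re y - complex.Im x * complex.Im y.
Proof. by case: x; case: y. Qed.
Lemma ImM x y : complex.Im (x * y) =
  complex.Re x * complex.Im y + complex.Im x * complex.Re y.
Proof. by case: x; case: y. Qed.

(** Continuity for the modulus [cabs], which takes values in [R]: all estimates
    below are real inequalities. *)
Definition ccont (f : R[i] -> R[i]) (z : R[i]) :=
  forall e, 0 < e -> exists2 d, 0 < d &
     forall y, cabs (y - z) < d -> cabs (f y - f z) < e.

Lemma ccont_cst k z : ccont (fun=> k) z.
Proof. by move=> e e0; exists e => // y _; rewrite subrr cabs0. Qed.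

Lemma ccont_id z : ccont id z.
Proof. by move=> e e0; exists e. Qed.

Lemma ccontD f g z : ccont f z -> ccont g z -> ccont (fun z => f z + g z) z.
Proof.
move=> hf hg e e0; have e2 : 0 < e / 2 by lra.
have [d1 d10 H1] := hf _ e2; have [d2 d20 H2] := hg _ e2.
exists (Num.min d1 d2) => [|y]; first by rewrite lt_min d10.
rewrite lt_min => /andP[/H1 h1 /H2 h2].
have -> : f y + g y - (f z + g z) = f y - f z + (g y - g z) by ring.
by apply: (le_lt_trans (cabsD _ _)); lra.
Qed.

Lemma ccont_bound f z : ccont f z -> exists2 d, 0 < d &
  forall y, cabs (y - z) < d -> cabs (f y) < cabs (f z) + 1.
Proof.
move=> /(_ 1 ltr01)[d d0 H]; exists d => // y /H h.
have := cabsD (f y - f z) (f z); rewrite subrK; lra.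
Qed.

Lemma ccontM f g z : ccont f z -> ccont g z -> ccont (fun z => f z * g z) z.
Proof.
move=> hf hg e e0.
have [d0 d00 H0] := ccont_bound hg.
pose M := cabs (f z) + cabs (g z) + 1.
have M0 : 0 < M by rewrite /M; have := cabs_ge0 (f z); have := cabs_ge0 (g z); lra.
have e2 : 0 < e / (2 * M) by rewrite divr_gt0 // mulr_gt0.
have [d1 d10 H1] := hf _ e2; have [d2 d20 H2] := hg _ e2.
exists (Num.min d0 (Num.min d1 d2)) => [|y]; first by rewrite !lt_min d00 d10.
rewrite !lt_min => /andP[/H0 h0 /andP[/H1 h1 /H2 h2]].
have -> : f y * g y - f z * g z = (f y - f z) * g y + f z * (g y - g z) by ring.
apply: (le_lt_trans (cabsD _ _)); rewrite !cabsM.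
have -> : e = e / (2 * M) * M + e / (2 * M) * M.
  by field; rewrite gt_eqF //.
have fz0 := cabs_ge0 (f z); have gz0 := cabs_ge0 (g z).
apply: ler_ltD.
  by rewrite ler_pM ?cabs_ge0 // ?(ltW h1) // /M; lra.
apply: (@le_lt_trans _ _ (M * cabs (g y - g z))).
  by rewrite ler_wpM2r ?cabs_ge0 // /M; lra.
by rewrite mulrC ltr_pM2r.
Qed.

Lemma ccontN f z : ccont f z -> ccont (fun z => - f z) z.
Proof.
move=> hf e /hf[d d0 H]; exists d => // y /H.
by rewrite -opprD cabsN.
Qed.

Lemma ccontB f g z : ccont f z -> ccont g z -> ccont (fun z => f z - g z) z.
Proof. by move=> hf /ccontN; exact: ccontD. Qed.

Lemma ccont_gt0 f z : ccont f z -> f z != 0 -> exists2 d, 0 < d &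
  forall y, cabs (y - z) < d -> cabs (f z) / 2 < cabs (f y).
Proof.
move=> hf; rewrite -cabs_gt0 => f0; have f2 : 0 < cabs (f z) / 2 by lra.
have [d d0 H] := hf _ f2; exists d => // y /H h.
by have := cabs_dist (f y) (f z); rewrite ler_norml => /andP[]; lra.
Qed.

Lemma ccontV f z : f z != 0 -> ccont f z -> ccont (fun z => (f z)^-1) z.
Proof.
move=> fz hf e e0; have [d0 d00 H0] := ccont_gt0 hf fz.
have fz0 : 0 < cabs (f z) by rewrite cabs_gt0.
have e2 : 0 < e * (cabs (f z) ^+ 2 / 2) by rewrite !mulr_gt0 ?exprn_gt0 ?invr_gt0.
have [d1 d10 H1] := hf _ e2.
exists (Num.min d0 d1) => [|y]; first by rewrite lt_min d00.
rewrite lt_min => /andP[/H0 h0 /H1 h1].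
have fy0 : 0 < cabs (f y) by lra.
have fy : f y != 0 by rewrite -cabs_gt0.
have -> : (f y)^-1 - (f z)^-1 = - (f y - f z) / (f y * f z) by field; rewrite fy fz.
rewrite cabsM cabsN cabsV cabsM ltr_pdivrMr ?mulr_gt0 //.
apply: (lt_le_trans h1); rewrite ler_pM2l // expr2; nra.
Qed.

Lemma ccontJ f z : ccont f z -> ccont (fun z => (f z)^*) z.
Proof.
move=> hf e /hf[d d0 H]; exists d => // y /H.
by rewrite -rmorphB /= cabsJ.
Qed.

Lemma ccont_sum (I : Type) (s : seq I) (P : pred I) (F : I -> R[i] -> R[i]) z :
  (forall i, P i -> ccont (F i) z) ->
  ccont (fun z => \sum_(i <- s | P i) F i z) z.
Proof.
move=> H; elim: s => [|i s IH].
  by under eq_fun do rewrite big_nil; exact: ccont_cst.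
under eq_fun do rewrite big_cons.
case: ifPn => // Pi; exact: ccontD (H _ Pi) IH.
Qed.

Lemma ccont_prod (I : Type) (s : seq I) (P : pred I) (F : I -> R[i] -> R[i]) z :
  (forall i, P i -> ccont (F i) z) ->
  ccont (fun z => \prod_(i <- s | P i) F i z) z.
Proof.
move=> H; elim: s => [|i s IH].
  by under eq_fun do rewrite big_nil; exact: ccont_cst.
under eq_fun do rewrite big_cons.
case: ifPn => // Pi; exact: ccontM (H _ Pi) IH.
Qed.

Lemma ccont_real (f : R[i] -> R[i]) (psi : R -> R) z :
  ccont f z -> {for complex.Re (f z), continuous psi} ->
  ccont (fun z => (psi (complex.Re (f z)))%:C) z.
Proof.
move=> hf /cvgrPdist_lt hpsi e e0.
have /nbhs_ballP[d /= d0 dB] := hpsi e e0.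
have [d' d'0 H] := hf d d0; exists d' => // y /H h.
rewrite -rmorphB /= cabsR distrC; apply: dB; rewrite /ball /= distrC.
by rewrite (le_lt_trans _ h) // -ReN -ReD normRe_cabs.
Qed.

Lemma ccont_locally (f g : R[i] -> R[i]) z e : 0 < e ->
  (forall y, cabs (y - z) < e -> f y = g y) -> ccont f z -> ccont g z.
Proof.
move=> e0 fg hf k /hf[d d0 H].
exists (Num.min d e); first by rewrite lt_min d0 e0.
move=> y; rewrite lt_min => /andP[yd ye].
by rewrite -!fg ?subrr ?cabs0 // H.
Qed.
End cabs.

(** * Wirtinger derivatives *)

Section wirtinger.
Variable R : realType.
Local Notation C := R[i].
Implicit Types (f g : C -> C) (z p q : C).

(** Caratheodory's form of differentiability turns derivatives into continuity
    of a difference quotient; the complex calculus below follows the same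
    pattern. *)
Lemma is_derive_car (g q : R -> R) (x : R) :
  (forall t, g t - g x = q t * (t - x)) -> {for x, continuous q} ->
  is_derive x 1 g (q x).
Proof.
move=> H hq.
suff H1 : (fun h => h^-1 *: (g (h *: 1 + x) - g x)) @ 0^' --> q x.
  by apply: DeriveDef; [apply/cvg_ex; exists (q x)|apply: cvg_lim].
apply/cvgrPdist_lt => e e0.
have /cvgrPdist_lt/(_ e e0)/nbhs_ballP[d /= d0 dB] := hq.
apply/nbhs_ballP; exists d => //= h; rewrite /ball /= sub0r normrN => hd h0.
rewrite H /GRing.scale /= mulr1 addrK mulrCA mulVf // mulr1.
by apply: dB; rewrite /ball /= opprD addrCA subrr addr0 normrN.
Qed.

Lemma derive_car (g : R -> R) (x d : R) : is_derive x 1 g d ->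
  exists q : R -> R, [/\ {for x, continuous q}, q x = d &
    forall t, g t - g x = q t * (t - x)].
Proof.
move=> [/= dg gd].
exists (fun t => if t == x then d else (g t - g x) / (t - x)); split.
- apply/cvgrPdist_lt => e e0 /=; rewrite eqxx.
  have H : (fun h => h^-1 *: (g (h *: 1 + x) - g x)) @ 0^' --> d.
    by rewrite -gd; move: dg; rewrite /derivable => /cvg_ex[l hl];
       rewrite /derive (cvg_lim _ hl).
  have /cvgrPdist_lt/(_ e e0)/nbhs_ballP[k /= k0 kB] := H.
  apply/nbhs_ballP; exists k => //= t; rewrite /ball /= => tk.
  case: ifPn => [_|tx]; first by rewrite subrr normr0.
  have := kB (t - x); rewrite /ball /= sub0r normrN distrC => /(_ tk).
  rewrite subr_eq0 => /(_ tx); rewrite /GRing.scale /= mulr1 subrK.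
  by rewrite mulrC.
- by rewrite eqxx.
- move=> t; case: eqVneq => [->|tx]; first by rewrite !subrr mulr0.
  by rewrite divfK // subr_eq0.
Qed.

(** [p] and [q] are the derivatives of [f] at [z] with respect to [z] and to
    its conjugate, in Caratheodory form. A real-differentiable function has
    such a decomposition, and complex differentiability at [z] is the case of a
    zero [q]. *)
Definition wirt f z p q := exists A B : C -> C,
  [/\ ccont A z, ccont B z, A z = p, B z = q &
      forall y, f y - f z = A y * (y - z) + B y * (y - z)^*].

(** A decomposition near [z] extends to the plane: away from [z] one may divide
    by [y - z], so the coefficient [A] absorbs the difference. *)
Lemma wirt_near f z p q (A B : C -> C) (e : R) : 0 < e ->
  ccont A z -> ccont B z -> A z = p -> B z = q ->
  (forall y, cabs (y - z) < e -> f y - f z = A y * (y - z) + B y * (y - z)^*) ->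
  wirt f z p q.
Proof.
move=> e0 cA cB Az Bz H.
exists (fun y => if y == z then p else (f y - f z - B y * (y - z)^*) / (y - z)), B.
split=> //; last 2 first.
- by rewrite eqxx.
- move=> y; case: eqVneq => [->|yz]; first by rewrite !subrr raddf0 !mulr0 addr0.
  by rewrite divfK ?subr_eq0 // subrK.
- apply: (@ccont_locally _ A _ _ e) => // y ye.
  case: eqVneq => [->//|yz].
  by rewrite H // addrK mulfK // subr_eq0.
Qed.

Lemma wirt_cont f z p q : wirt f z p q -> ccont f z.
Proof.
move=> [A [B [cA cB _ _ H]]].
have -> : f = (fun y => f z + (A y * (y - z) + B y * (y - z)^*)).
  by apply/funext => y; rewrite -H addrC subrK.
apply: ccontD; first exact: ccont_cst.
have h : ccont (fun y : C => y - z) z.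
  by apply: ccontB; [exact: ccont_id|exact: ccont_cst].
by apply: ccontD; apply: ccontM => //; exact: ccontJ.
Qed.

Lemma wirt_cst k z : wirt (fun=> k) z 0 0.
Proof.
exists (fun=> 0), (fun=> 0); split=> //; try exact: ccont_cst.
by move=> y; rewrite subrr !mul0r addr0.
Qed.

Lemma wirt_id z : wirt id z 1 0.
Proof.
exists (fun=> 1), (fun=> 0); split=> //; try exact: ccont_cst.
by move=> y; rewrite mul0r mul1r addr0.
Qed.

Lemma wirtJ f z p q : wirt f z p q -> wirt (fun z => (f z)^*) z q^* p^*.
Proof.
move=> [A [B [cA cB <- <- H]]].
exists (fun y => (B y)^*), (fun y => (A y)^*); split=> //; try exact: ccontJ.
by move=> y; rewrite -rmorphB /= H rmorphD !rmorphM /= conjCK addrC.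
Qed.

Lemma wirtD f g z p q p' q' : wirt f z p q -> wirt g z p' q' ->
  wirt (fun z => f z + g z) z (p + p') (q + q').
Proof.
move=> [A [B [cA cB <- <- H]]] [A' [B' [cA' cB' <- <- H']]].
exists (fun y => A y + A' y), (fun y => B y + B' y).
split=> //; try exact: ccontD.
move=> y; have -> : f y + g y - (f z + g z) = (f y - f z) + (g y - g z) by ring.
by rewrite H H'; ring.
Qed.

Lemma wirtM f g z p q p' q' : wirt f z p q -> wirt g z p' q' ->
  wirt (fun z => f z * g z) z (p * g z + f z * p') (q * g z + f z * q').
Proof.
move=> hf hg; have cf := wirt_cont hf; have cg := wirt_cont hg.
move: hf hg => [A [B [cA cB <- <- H]]] [A' [B' [cA' cB' <- <- H']]].
exists (fun y => A y * g y + f z * A' y), (fun y => B y * g y + f z * B' y).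
have cz : ccont (fun=> f z) z by exact: ccont_cst.
split=> //; try by apply: ccontD; apply: ccontM.
move=> y; have -> : f y * g y - f z * g z =
  (f y - f z) * g y + f z * (g y - g z) by ring.
by rewrite H H'; ring.
Qed.

Lemma wirtN f z p q : wirt f z p q -> wirt (fun z => - f z) z (- p) (- q).
Proof.
move=> [A [B [cA cB <- <- H]]].
exists (fun y => - A y), (fun y => - B y); split=> //; try exact: ccontN.
by move=> y; rewrite -opprD H; ring.
Qed.

Lemma wirtV f z p q : f z != 0 -> wirt f z p q ->
  wirt (fun z => (f z)^-1) z (- p / f z ^+ 2) (- q / f z ^+ 2).
Proof.
move=> fz hf; have cf := wirt_cont hf; have [d d0 Hd] := ccont_gt0 cf fz.
move: hf => [A [B [cA cB <- <- H]]].
have ci : ccont (fun y => (f y * f z)^-1) z.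
  by apply: ccontV; [rewrite mulf_neq0|apply: ccontM => //; exact: ccont_cst].
apply: (@wirt_near _ _ _ _ (fun y => - A y * (f y * f z)^-1)
                   (fun y => - B y * (f y * f z)^-1) d) => //.
- by apply: ccontM => //; exact: ccontN.
- by apply: ccontM => //; exact: ccontN.
- move=> y /Hd fy.
  have fy0 : f y != 0 by rewrite -cabs_gt0; have := cabs_ge0 (f z); lra.
  have -> : (f y)^-1 - (f z)^-1 = - (f y - f z) / (f y * f z).
    by field; rewrite fy0 fz.
  by rewrite H; ring.
Qed.

Lemma wirt_comp_real (r : C -> R) (psi : R -> R) d z p q :
  wirt (fun y => (r y)%:C) z p q -> is_derive (r z) 1 psi d ->
  wirt (fun y => (psi (r y))%:C) z (d%:C * p) (d%:C * q).
Proof.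
move=> hr /derive_car[k [ck <- Hk]].
have cr := wirt_cont hr; move: hr => [A [B [cA cB <- <- H]]].
have ckr : ccont (fun y => (k (r y))%:C) z.
  exact: (@ccont_real _ (fun y => (r y)%:C) k).
exists (fun y => (k (r y))%:C * A y), (fun y => (k (r y))%:C * B y).
split=> //; try exact: ccontM.
by move=> y; rewrite -rmorphB /= Hk rmorphM rmorphB /= H; ring.
Qed.

Lemma wirt_prod (I : finType) (P : pred I) (F : I -> C -> C)
    (p q : I -> C) z : (forall i, P i -> wirt (F i) z (p i) (q i)) ->
  wirt (fun z => \prod_(i | P i) F i z) z
     (\sum_(i | P i) p i * \prod_(j | P j && (j != i)) F j z)
     (\sum_(i | P i) q i * \prod_(j | P j && (j != i)) F j z).
Proof.
have [n] := ubnP #|P|; elim: n P => // n IH P /ltnSE Pn H.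
have [i Pi|P0] := pickP P; last first.
  rewrite !big_pred0 //.
  by under [fun z => _]eq_fun do rewrite big_pred0 //; exact: wirt_cst.
under [fun z => _]eq_fun do rewrite (bigD1 i) //=.
have /IH : (#|[pred j | P j && (j != i)]| < n)%N.
  move: Pn; rewrite (cardD1 i) unfold_in Pi add1n; apply: leq_trans.
  by rewrite ltnS; apply/eq_leq/eq_card => j; rewrite !inE andbC.
have Hi j : P j && (j != i) -> wirt (F j) z (p j) (q j).
  by move=> /andP[Pj _]; exact: H.
move=> /(_ Hi) h; have := wirtM (H i Pi) h.
rewrite !(bigD1 (P := P) i) //=.
suff E (u : I -> C) : F i z * (\sum_(k | P k && (k != i))
          u k * \prod_(j | (P j && (j != i)) && (j != k)) F j z) =
   \sum_(k | P k && (k != i)) u k * \prod_(j | P j && (j != k)) F j z.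
  by rewrite !E.
rewrite mulr_sumr; apply: eq_bigr => k /andP[Pk ki].
rewrite mulrCA; congr (_ * _); rewrite [RHS](bigD1 i) /=; last by rewrite Pi eq_sym.
congr (_ * _); apply: eq_bigl => j.
by rewrite -!andbA; congr (_ && _); rewrite andbC.
Qed.

Lemma derivable_wirt f z : derivable (f : C^o -> C^o) z 1 -> exists p, wirt f z p 0.
Proof.
move=> /cvg_ex[/= p H]; exists p.
exists (fun y => if y == z then p else (f y - f z) / (y - z)), (fun=> 0).
split=> //; last 2 first.
- by rewrite eqxx.
- move=> y; rewrite mul0r addr0.
  case: eqVneq => [->|yz]; first by rewrite !subrr mulr0.
  by rewrite divfK // subr_eq0.
- move=> e e0; rewrite eqxx.
  have /cvgrPdist_lt/(_ e%:C) := H; rewrite ltcR => /(_ e0).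
  move=> /nbhs_ballP[d /= d0].
  have dE : d = (complex.Re d)%:C by apply/esym/RRe_real/gtr0_real.
  move: d0; rewrite dE ltcR => d0 dB.
  exists (complex.Re d) => // y yd.
  case: eqVneq => [_|yz]; first by rewrite subrr cabs0.
  have := dB (y - z); rewrite /ball /= sub0r normrN !normc_cabs !ltcR => /(_ yd).
  rewrite subr_eq0 => /(_ yz); rewrite /GRing.scale /= mulr1 subrK.
  by rewrite cabs_distC mulrC.
- exact: ccont_cst.
Qed.

Lemma wirt_derivable f z p : wirt f z p 0 -> derivable (f : C^o -> C^o) z 1.
Proof.
move=> [A [B [cA cB Az Bz H]]]; apply/cvg_ex; exists (p : C^o).
apply/cvgrPdist_lt => e e0.
have eE : e = (complex.Re e)%:C by apply/esym/RRe_real/gtr0_real.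
move: e0; rewrite eE ltcR => e0.
have e2 : 0 < complex.Re e / 2 by lra.
have [d1 d10 H1] := cA _ e2; have [d2 d20 H2] := cB _ e2.
apply/nbhs_ballP; exists (Num.min d1 d2)%:C; first by rewrite /= ltcR lt_min d10.
move=> h; rewrite /ball /= sub0r normrN !normc_cabs !ltcR lt_min => /andP[hd1 hd2] h0.
have h1 := H1 (h + z); rewrite addrK in h1; have {}h1 := h1 hd1.
have h2 := H2 (h + z); rewrite addrK in h2; have {}h2 := h2 hd2.
rewrite /GRing.scale /= mulr1 H addrK cabs_distC.
have -> : h^-1 * (A (h + z) * h + B (h + z) * h^*) - p =
  (A (h + z) - A z) + (B (h + z) - B z) * (h^* / h).
  by rewrite Az Bz; field.
apply: (le_lt_trans (cabsD _ _)); rewrite cabsM cabsM cabsV cabsJ.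
by rewrite divff ?mulr1 ?cabs_eq0 //; lra.
Qed.

(** Derivatives along horizontal and vertical lines are what one-dimensional
    integration uses. *)
Lemma wirt_slice_x f (x y : R) p q : wirt f (x +i* y) p q ->
  is_derive x 1 (fun t => complex.Re (f (t +i* y))) (complex.Re (p + q)) /\
  is_derive x 1 (fun t => complex.Im (f (t +i* y))) (complex.Im (p + q)).
Proof.
move=> [A [B [cA cB <- <- H]]].
have E t : f (t +i* y) - f (x +i* y) = (A (t +i* y) + B (t +i* y)) * (t - x)%:C.
  have d : (t +i* y) - (x +i* y) = (t - x)%:C.
    by apply/eqP; rewrite eq_complex /= subrr !eqxx.
  by rewrite H d conjR mulrDl.
have cAB e : 0 < e -> \forall t \near x,
    cabs (A (x +i* y) + B (x +i* y) - (A (t +i* y) + B (t +i* y))) < e.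
  move=> e0; have [d d0 Hd] := ccontD cA cB e0.
  apply/nbhs_ballP; exists d => //= t; rewrite /ball /= => td.
  rewrite cabs_distC; apply: Hd; rewrite distrC in td.
  by rewrite (_ : (_ - _) = (t - x)%:C) ?cabsR //; apply/eqP;
     rewrite eq_complex /= subrr !eqxx.
split.
  apply: (@is_derive_car _ (fun t => complex.Re (A (t +i* y) + B (t +i* y)))).
    by move=> t; rewrite -ReN -ReD E ReM /= mulr0 subr0.
  apply/cvgrPdist_lt => e /cAB; apply: filterS => t.
  by apply: le_lt_trans; rewrite -ReN -ReD normRe_cabs.
apply: (@is_derive_car _ (fun t => complex.Im (A (t +i* y) + B (t +i* y)))).
  by move=> t; rewrite -ImN -ImD E ImM /= mulr0 add0r.
apply/cvgrPdist_lt => e /cAB; apply: filterS => t.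
by apply: le_lt_trans; rewrite -ImN -ImD normIm_cabs.
Qed.

Lemma wirt_slice_y f (x y : R) p q : wirt f (x +i* y) p q ->
  is_derive y 1 (fun t => complex.Re (f (x +i* t))) (complex.Re ('i%C * (p - q))) /\
  is_derive y 1 (fun t => complex.Im (f (x +i* t))) (complex.Im ('i%C * (p - q))).
Proof.
move=> [A [B [cA cB <- <- H]]].
have d t : (x +i* t) - (x +i* y) = 'i%C * (t - y)%:C.
  by apply/eqP; rewrite eq_complex /= !(subrr, mul0r, mul1r, addr0, add0r, oppr0) !eqxx.
have E t : f (x +i* t) - f (x +i* y) =
    ('i%C * (A (x +i* t) - B (x +i* t))) * (t - y)%:C.
  rewrite H d rmorphM /= conjR.
  rewrite conji; ring.
have cAB : ccont (fun z => 'i%C * (A z - B z)) (x +i* y).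
  by apply: ccontM; [exact: ccont_cst|exact: ccontB].
have {}cAB e : 0 < e -> \forall t \near y,
    cabs ('i%C * (A (x +i* y) - B (x +i* y)) - 'i%C * (A (x +i* t) - B (x +i* t))) < e.
  move=> e0; have [k k0 Hk] := cAB _ e0.
  apply/nbhs_ballP; exists k => //= t; rewrite /ball /= => tk.
  rewrite cabs_distC; apply: Hk; rewrite distrC in tk.
  by rewrite d cabsM cabsi mul1r cabsR.
split.
  apply: (@is_derive_car _ (fun t => complex.Re ('i%C * (A (x +i* t) - B (x +i* t))))).
    by move=> t; rewrite -ReN -ReD E [LHS]ReM [complex.Im _%:C]/= mulr0 subr0.
  apply/cvgrPdist_lt => e /cAB; apply: filterS => t.
  by apply: le_lt_trans; rewrite -ReN -ReD normRe_cabs.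
apply: (@is_derive_car _ (fun t => complex.Im ('i%C * (A (x +i* t) - B (x +i* t))))).
  by move=> t; rewrite -ImN -ImD E [LHS]ImM [complex.Im _%:C]/= mulr0 add0r.
apply/cvgrPdist_lt => e /cAB; apply: filterS => t.
by apply: le_lt_trans; rewrite -ImN -ImD normIm_cabs.
Qed.

End wirtinger.

(** * Measurability on the disc *)

Section area.
Variable R : realType.
Local Notation C := R[i].
Local Notation T2 := (measurableTypeR R * measurableTypeR R)%type.
Local Notation leb2 := (@lebesgue_measure R \x @lebesgue_measure R)%E.
Local Notation sigma := (@sigma_area R).
Local Notation disc := (@disc2 R : set T2).
Local Notation toC := (@to_complex R).

Lemma cabs_toC (v w : R * R) :
  cabs (toC v - toC w) <= `|v.1 - w.1| + `|v.2 - w.2|.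
Proof. exact: cabs_le_ReIm. Qed.

Lemma toC_ReIm z : toC (complex.Re z, complex.Im z) = z.
Proof. by case: z. Qed.

(** An open set for the maximum distance is a countable union of boxes with
    rational centres and radii 1 / (n + 1), and boxes are measurable for the
    product structure. *)
Lemma measurable_open2 (U : set T2) :
  (forall w, U w -> exists2 e : R, 0 < e &
     forall v : T2, `|v.1 - w.1| < e -> `|v.2 - w.2| < e -> U v) ->
  measurable U.
Proof.
move=> H.
pose box (q : rat * rat * nat) : set T2 :=
  ball (ratr q.1.1 : R) (q.2.+1%:R^-1) `*` ball (ratr q.1.2 : R) (q.2.+1%:R^-1).
have -> : U = \bigcup_(q : rat * rat * nat)
    (if `[< box q `<=` U >] then box q else set0).
  apply/seteqP; split=> w; last first.
    by move=> [q _]; case: asboolP => // bU /bU.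
  move=> Uw; have [e e0 eU] := H _ Uw.
  have [n ne] : exists n : nat, n.+1%:R^-1 < e / 2 :> R.
    have e2 : 0 < e / 2 by lra.
    have [n _ /(_ n (leqnn n)) hn] := near_infty_natSinv_lt (PosNum e2).
    by exists n.
  have [r [r0 re rn]] : exists r : R, [/\ 0 < r, r < e / 2 & r = n.+1%:R^-1].
    by exists n.+1%:R^-1; split; rewrite ?invr_gt0.
  have [q1 q1w] : exists q1 : rat, `|w.1 - ratr q1| < r.
    have : w.1 - r < w.1 + r by lra.
    move=> /rat_in_itvoo[q1]; rewrite in_itv /= => /andP[? ?].
    by exists q1; rewrite ltr_norml; apply/andP; split; lra.
  have [q2 q2w] : exists q2 : rat, `|w.2 - ratr q2| < r.
    have : w.2 - r < w.2 + r by lra.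
    move=> /rat_in_itvoo[q2]; rewrite in_itv /= => /andP[? ?].
    by exists q2; rewrite ltr_norml; apply/andP; split; lra.
  exists (q1, q2, n) => //; rewrite asboolT.
    by split; rewrite /= /ball /= distrC -rn.
  move=> v [/= b1 b2]; rewrite /ball /= -rn in b1 b2; apply: eU.
    by have := ler_distD (ratr q1) v.1 w.1; rewrite (distrC v.1 (ratr _)) (distrC (ratr q1) w.1); lra.
  by have := ler_distD (ratr q2) v.2 w.2; rewrite (distrC v.2 (ratr _)) (distrC (ratr q2) w.2); lra.
apply: countable_bigcupT_measurable => //.
move=> q; case: asboolP => // _.
by apply: measurableX; apply: open_measurable; exact: ball_open.
Qed.

Lemma measurable_disc2 : measurable disc.
Proof.
apply: measurable_open2 => w /unit_discE wD.
exists ((1 - cabs (toC w)) / 2) => [|v h1 h2]; first lra.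
apply/unit_discE; have := cabs_toC v w.
have := cabsD (toC v - toC w) (toC w); rewrite subrK; lra.
Qed.

Lemma measurable_pt (w : T2) : measurable [set w].
Proof.
have -> : [set w] = [set w.1] `*` [set w.2].
  by apply/seteqP; split=> [v ->//|[v1 v2] [/= -> ->]]; case: w.
by apply: measurableX.
Qed.

(** The weight and the poles are singular at finitely many points; these
    exceptional sets are negligible and all their subsets are measurable. *)
Definition pts (s : seq C) : set T2 := [set w | toC w \in s].

Lemma pts_cons z s :
  pts (z :: s) = [set (complex.Re z, complex.Im z)] `|` pts s.
Proof.
apply/seteqP; split=> w; rewrite /pts /= inE.
  by move=> /orP[/eqP <-|]; [left; case: w|right].
by move=> [->|->]; rewrite ?orbT // toC_ReIm eqxx.
Qed.

Lemma measurable_sub_pts s (A : set T2) : A `<=` pts s -> measurable A.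
Proof.
elim: s A => [|z s IH] A.
  move=> As; have -> : A = set0 by apply/seteqP; split=> // w /As.
  exact: measurable0.
rewrite pts_cons => As.
have -> : A = (A `&` [set (complex.Re z, complex.Im z)]) `|` (A `&` pts s).
  by rewrite -setIUr; apply/esym/setIidl.
apply: measurableU; last by apply: IH => w [].
have [Az|Az] := pselect (A (complex.Re z, complex.Im z)).
  rewrite (_ : _ `&` _ = [set (complex.Re z, complex.Im z)]); first exact: measurable_pt.
  by apply/seteqP; split=> [w []//|w ->].
rewrite (_ : _ `&` _ = set0); first exact: measurable0.
by apply/seteqP; split=> // w [Aw wz]; apply: Az; rewrite -wz.
Qed.

Lemma leb2_pt (w : T2) : leb2 [set w] = 0%E.
Proof.
have -> : [set w] = [set w.1] `*` [set w.2].
  by apply/seteqP; split=> [v ->//|[v1 v2] [/= -> ->]]; case: w.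
by rewrite product_measure1E //= lebesgue_measure_set1 mul0e.
Qed.

Lemma sigmaE (A : set T2) : sigma A = ((pi^-1)%:E * leb2 A)%E.
Proof. by []. Qed.

Lemma negligible_pts s : sigma.-negligible (pts s).
Proof.
elim: s => [|z s IH].
  by rewrite (_ : pts [::] = set0); [exact: negligible_set0|apply/seteqP; split].
rewrite pts_cons; apply: negligibleU => //.
apply/negligibleP; first exact: measurable_pt.
by have := sigmaE [set (complex.Re z, complex.Im z)]; rewrite leb2_pt mule0.
Qed.

Definition cmeas (f : C -> C) :=
  measurable_fun disc (fun w => complex.Re (f (toC w))) /\
  measurable_fun disc (fun w => complex.Im (f (toC w))).

(** Continuity off a finite set suffices: the preimage of an interval splits
    into an open set minus the exceptional points and a set of exceptional
    points. *)
Lemma measurable_real_off (s : seq C) (u : C -> R) :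
  (forall z, unit_disc z -> z \notin s -> forall e, 0 < e -> exists2 d, 0 < d &
     forall y, cabs (y - z) < d -> `|u y - u z| < e) ->
  measurable_fun disc (fun w => u (toC w)).
Proof.
move=> H; apply: (measurability _ (RGenOpens.measurableE R)).
move=> _ [_ [a [b ->] <-]].
set Y := `]a, b[%classic.
have -> : disc `&` (fun w => u (toC w)) @^-1` Y =
  (disc `&` (fun w => u (toC w)) @^-1` Y `&` pts s) `|`
  (disc `&` (fun w => u (toC w)) @^-1` Y `&` ~` pts s).
  by rewrite -setIUr setUv setIT.
apply: measurableU; first by apply: (@measurable_sub_pts s) => w [].
have -> : disc `&` (fun w => u (toC w)) @^-1` Y `&` ~` pts s =
  [set w | exists2 e : R, 0 < e & forall v : T2, `|v.1 - w.1| < e -> `|v.2 - w.2| < e ->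
     disc v /\ Y (u (toC v))] `&` ~` pts s.
  apply/seteqP; split=> w [].
    move=> [dw Yw] ws; split=> //; move/unit_discE : (dw) => wD.
    move: Yw; rewrite /preimage /Y /= in_itv /= => /andP[aw wb].
    have e0 : 0 < Num.min (u (toC w) - a) (b - u (toC w)).
      by rewrite lt_min !subr_gt0 aw.
    have [|d d0 Hd] := H (toC w) dw _ _ e0; first exact/negP.
    exists (Num.min (d / 2) ((1 - cabs (toC w)) / 2)).
      by rewrite lt_min; apply/andP; split; lra.
    move=> v; rewrite !lt_min => /andP[h1 h1'] /andP[h2 h2'].
    have vw := cabs_toC v w; split.
      apply/unit_discE.
      have := cabsD (toC v - toC w) (toC w); rewrite subrK; lra.
    have /Hd : cabs (toC v - toC w) < d by lra.
    rewrite lt_min !ltr_norml => /andP[/andP[? ?] /andP[? ?]].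
    by rewrite /= in_itv /=; apply/andP; split; lra.
  move=> [e e0 He] ws; split=> //.
  by apply: He; rewrite subrr normr0.
apply: measurableI; last by apply: measurableC; exact: (@measurable_sub_pts s).
apply: measurable_open2 => w [e e0 He].
exists (e / 2) => [|v h1 h2]; first lra.
exists (e / 2) => [|x k1 k2]; first lra.
apply: He.
  by have := ler_distD v.1 x.1 w.1; lra.
by have := ler_distD v.2 x.2 w.2; lra.
Qed.

Lemma cmeas_off (s : seq C) (f : C -> C) :
  (forall z, unit_disc z -> z \notin s -> ccont f z) -> cmeas f.
Proof.
move=> H; split; apply: (@measurable_real_off s (fun z => _ (f z))) => z zD zs e e0.
  have [d d0 Hd] := H z zD zs e e0; exists d => // y /Hd; apply: le_lt_trans.
  by rewrite -ReN -ReD normRe_cabs.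
have [d d0 Hd] := H z zD zs e e0; exists d => // y /Hd; apply: le_lt_trans.
by rewrite -ImN -ImD normIm_cabs.
Qed.

Lemma cmeas_cont (f : C -> C) : (forall z, unit_disc z -> ccont f z) -> cmeas f.
Proof. by move=> H; apply: (@cmeas_off [::]) => z zD _; exact: H. Qed.

(** The integrable real functions on the disc, used as majorants. *)
Definition rint (G : C -> R) :=
  sigma.-integrable disc (fun w => (G (toC w))%:E).

End area.
Arguments measurable_disc2 {R}.

(** * Calculus of the normalized area integral *)

(** These equalities of functions allow induction on the index list of a sum of
    integrands, where the sum sits under a binder. *)
Lemma sumfun_nil (I T : Type) (V : nmodType) (P : pred I) (F : I -> T -> V) :
  (fun z => \sum_(i <- [::] | P i) F i z) = fun=> 0.
Proof. by apply/funext => z; rewrite big_nil. Qed.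

Lemma sumfun_cons (I T : Type) (V : nmodType) (P : pred I) (F : I -> T -> V) i r :
  (fun z => \sum_(i <- i :: r | P i) F i z) =
    if P i then (fun z => F i z + \sum_(i <- r | P i) F i z)
    else (fun z => \sum_(i <- r | P i) F i z).
Proof. by case: ifPn => Pi; apply/funext => z; rewrite big_cons ?Pi // (negbTE Pi). Qed.

Section integral.
Variable R : realType.
Local Notation C := R[i].
Local Notation T2 := (measurableTypeR R * measurableTypeR R)%type.
Local Notation sigma := (@sigma_area R).
Local Notation disc := (@disc2 R : set T2).
Local Notation toC := (@to_complex R).
Implicit Types (f g : C -> C) (G : C -> R) (s : seq C).

Definition ccvg (u : nat -> C) (l : C) := forall e : R, 0 < e ->
  exists N, forall n, (N <= n)%N -> cabs (u n - l) < e.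

Lemma ccvg_unique u l l' : ccvg u l -> ccvg u l' -> l = l'.
Proof.
move=> h h'; apply/eqP; rewrite -subr_eq0 -cabs_eq0; apply/negPn/negP => H.
have e0 : 0 < cabs (l - l') / 2.
  by rewrite divr_gt0 // lt_neqAle cabs_ge0 eq_sym H.
have [N HN] := h _ e0; have [N' HN'] := h' _ e0.
have := HN (maxn N N') (leq_maxl _ _); have := HN' (maxn N N') (leq_maxr _ _).
have := cabsD (l - u (maxn N N')) (u (maxn N N') - l').
rewrite addrA subrK (cabs_distC l); lra.
Qed.

Lemma ccvg_cst l : ccvg (fun=> l) l.
Proof. by move=> e e0; exists 0%N => n _; rewrite subrr cabs0. Qed.

Lemma ccvgD u v l k : ccvg u l -> ccvg v k -> ccvg (fun n => u n + v n) (l + k).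
Proof.
move=> hu hv e e0; have e2 : 0 < e / 2 by lra.
have [N HN] := hu _ e2; have [M HM] := hv _ e2.
exists (maxn N M) => n; rewrite geq_max => /andP[/HN h1 /HM h2].
have -> : u n + v n - (l + k) = u n - l + (v n - k) by ring.
by apply: (le_lt_trans (cabsD _ _)); lra.
Qed.

Lemma ccvgZ (c : C) u l : ccvg u l -> ccvg (fun n => c * u n) (c * l).
Proof.
move=> hu e e0.
have c1 : 0 < cabs c + 1 by have := cabs_ge0 c; lra.
have e2 : 0 < e / (cabs c + 1) by rewrite divr_gt0.
have [N HN] := hu _ e2; exists N => n /HN h.
rewrite -mulrBr cabsM.
apply: (@le_lt_trans _ _ ((cabs c + 1) * cabs (u n - l))).
  by rewrite ler_wpM2r ?cabs_ge0 //; lra.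
by rewrite mulrC -ltr_pdivlMr.
Qed.

Lemma ccvgN u l : ccvg u l -> ccvg (fun n => - u n) (- l).
Proof.
by move=> h e /h[N HN]; exists N => n /HN; rewrite -opprD cabsN.
Qed.

Lemma ccvgB u v l k : ccvg u l -> ccvg v k -> ccvg (fun n => u n - v n) (l - k).
Proof. by move=> hu /ccvgN; exact: ccvgD. Qed.

Lemma ccvg_sum (I : Type) (r : seq I) (P : pred I) (u : I -> nat -> C) (l : I -> C) :
  (forall i, P i -> ccvg (u i) (l i)) ->
  ccvg (fun n => \sum_(i <- r | P i) u i n) (\sum_(i <- r | P i) l i).
Proof.
move=> H; elim: r => [|i r IH].
  by rewrite sumfun_nil big_nil; exact: ccvg_cst.
by rewrite sumfun_cons big_cons; case: ifPn => // Pi; exact: ccvgD (H _ Pi) IH.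
Qed.

Lemma ccvg_ext u v l : u =1 v -> ccvg u l -> ccvg v l.
Proof. by move=> /funext ->. Qed.

Lemma ccvg_Re u l : ccvg u l -> (fun n => complex.Re (u n)) @ \oo --> complex.Re l.
Proof.
move=> h; apply/cvgrPdist_lt => e /h[N HN]; exists N => // n /= /HN.
by apply: le_lt_trans; rewrite distrC -ReN -ReD normRe_cabs.
Qed.

Lemma ccvg_Im u l : ccvg u l -> (fun n => complex.Im (u n)) @ \oo --> complex.Im l.
Proof.
move=> h; apply/cvgrPdist_lt => e /h[N HN]; exists N => // n /= /HN.
by apply: le_lt_trans; rewrite distrC -ImN -ImD normIm_cabs.
Qed.

Lemma ccvg_ReIm u l : (fun n => complex.Re (u n)) @ \oo --> complex.Re l ->
  (fun n => complex.Im (u n)) @ \oo --> complex.Im l -> ccvg u l.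
Proof.
move=> /cvgrPdist_lt h1 /cvgrPdist_lt h2 e e0.
have e2 : 0 < e / 2 by lra.
have [N _ HN] := h1 _ e2; have [M _ HM] := h2 _ e2.
exists (maxn N M) => n; rewrite geq_max => /andP[/HN /= k1 /HM /= k2].
apply: (le_lt_trans (cabs_le_ReIm _)).
by rewrite ReD ReN ImD ImN distrC [X in _ + X]distrC; lra.
Qed.

Lemma sigma_disc_lty : (sigma disc < +oo)%E.
Proof.
apply: (@le_lt_trans _ _ (sigma (`[-1, 1]%classic `*` `[-1, 1]%classic))).
  apply: le_measure; rewrite ?inE; [exact: measurable_disc2|exact: measurableX|].
  move=> w /unit_discE h; have := normRe_cabs (toC w); have := normIm_cabs (toC w).
  by rewrite !ler_norml /= => /andP[? ?] /andP[? ?]; split; rewrite /= in_itv /=; apply/andP; split; lra.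
have E : lebesgue_measure (`[-1, 1]%classic : set R) = 2%:E.
  rewrite lebesgue_measure_itv /= lte_fin ifT; last by lra.
  by rewrite -EFinB; congr EFin; lra.
by rewrite sigmaE product_measure1E //= !E -!EFinM ltry.
Qed.

Lemma rint_cst (c : R) : @rint R (fun=> c).
Proof.
apply/integrableP; split; first exact: measurable_cst.
rewrite integral_cst ?measurable_disc2 //=; last exact: measurable_disc2.
exact: lte_mul_pinfty sigma_disc_lty.
Qed.

Lemma rintD G G' : rint G -> rint G' -> rint (fun z => G z + G' z).
Proof. by move=> h h1; exact: (integrableD measurable_disc2 h h1). Qed.

Lemma rintZ (c : R) G : rint G -> rint (fun z => c * G z).
Proof. by move=> h; exact: (integrableZl measurable_disc2 c h). Qed.

Lemma rint_sum (I : Type) (r : seq I) (P : pred I) (F : I -> C -> R) :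
  (forall i, P i -> rint (F i)) -> rint (fun z => \sum_(i <- r | P i) F i z).
Proof.
move=> H; elim: r => [|i r IH]; first by rewrite sumfun_nil; exact: rint_cst.
by rewrite sumfun_cons; case: ifPn => // Pi; exact: rintD (H _ Pi) IH.
Qed.

Lemma rint_le G G' : measurable_fun disc (fun w => G (toC w)) ->
  (forall z, unit_disc z -> `|G z| <= G' z) -> rint G' -> rint G.
Proof.
move=> mG GG' h; apply: (le_integrable measurable_disc2 _ _ h).
  exact/measurable_EFinP.
move=> w dw; rewrite !abse_EFin lee_fin.
by apply: (le_trans (GG' _ dw)); rewrite ler_norm.
Qed.

Lemma measurable_off s (u : C -> R) : measurable_fun disc (fun w => u (toC w)) ->
  measurable_fun disc (fun w => if toC w \in s then 0 else u (toC w)).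
Proof.
move=> mu.
have mp : measurable_fun disc (fun w => toC w \in s).
  apply: (@measurable_fun_bool _ _ _ _ true).
  by apply: (@measurable_sub_pts _ s) => w [].
apply: (measurable_fun_if measurable_disc2 mp); first exact: measurable_cst.
by apply: measurable_funS mu; [exact: measurable_disc2|move=> w []].
Qed.

Lemma rint_le_off s G G' : measurable_fun disc (fun w => G (toC w)) ->
  (forall z, unit_disc z -> z \notin s -> `|G z| <= G' z) -> rint G' -> rint G.
Proof.
move=> mG H hG'.
have h : rint (fun z => if z \in s then 0 else G z).
  apply: (@rint_le _ (fun z => `|G' z|)).
  - exact: measurable_off.
  - move=> z zD; case: ifPn => [|zs]; first by rewrite normr0.
    by rewrite (le_trans (H z zD zs)) // ler_norm.
  - exact: (integrable_norm hG').
apply/integrableP; split; first exact/measurable_EFinP.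
move/integrableP: h => [_]; apply: le_lt_trans.
rewrite le_eqVlt; apply/orP; left; apply/eqP.
apply: ae_eq_integral => //.
- exact: measurable_disc2.
- by apply/measurableT_comp => //; exact/measurable_EFinP.
- by apply/measurableT_comp => //; apply/measurable_EFinP; exact: measurable_off.
- apply: (negligibleS _ (negligible_pts s)) => w /=.
  apply: contra_notP => /negP ws _.
  by rewrite /pts /= in ws; rewrite (negbTE ws).
Qed.

Lemma di_dom s f G : cmeas f -> rint G ->
  (forall z, unit_disc z -> z \notin s -> cabs (f z) <= G z) -> disc_integrable f.
Proof.
move=> [m1 m2] hG H; split.
  apply: (@rint_le_off s (fun z => complex.Re (f z)) G) => // z zD zs.
  exact: le_trans (normRe_cabs _) (H _ zD zs).
apply: (@rint_le_off s (fun z => complex.Im (f z)) G) => // z zD zs.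
exact: le_trans (normIm_cabs _) (H _ zD zs).
Qed.

Lemma di_rint f : disc_integrable f ->
  rint (fun z => `|complex.Re (f z)| + `|complex.Im (f z)|).
Proof.
move=> [h1 h2]; apply: rintD; first exact: (integrable_norm h1).
exact: (integrable_norm h2).
Qed.

Lemma di_cmeas f : disc_integrable f -> cmeas f.
Proof. by move=> [/integrableP[/measurable_EFinP h1 _] /integrableP[/measurable_EFinP h2 _]]. Qed.

Lemma eq_di f g : (forall z, unit_disc z -> f z = g z) ->
  disc_integral f = disc_integral g.
Proof.
by move=> H; congr (_ +i* _); apply: eq_Rintegral => w; rewrite inE => /H ->.
Qed.

Lemma cmeasD f g : cmeas f -> cmeas g -> cmeas (fun z => f z + g z).
Proof.
move=> [h1 h2] [k1 k2]; split.
  by under eq_fun do rewrite ReD; exact: measurable_funD.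
by under eq_fun do rewrite ImD; exact: measurable_funD.
Qed.

Lemma cmeasM f g : cmeas f -> cmeas g -> cmeas (fun z => f z * g z).
Proof.
move=> [h1 h2] [k1 k2]; split.
  by under eq_fun do rewrite ReM; apply: measurable_funB; exact: measurable_funM.
by under eq_fun do rewrite ImM; apply: measurable_funD; exact: measurable_funM.
Qed.

Lemma di_integrableD f g : disc_integrable f -> disc_integrable g ->
  disc_integrable (fun z => f z + g z).
Proof.
move=> [h1 h2] [k1 k2]; split.
  under eq_fun do rewrite ReD; exact: (integrableD measurable_disc2 h1 k1).
under eq_fun do rewrite ImD; exact: (integrableD measurable_disc2 h2 k2).
Qed.

Lemma diD f g : disc_integrable f -> disc_integrable g ->
  disc_integral (fun z => f z + g z) = disc_integral f + disc_integral g.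
Proof.
move=> [h1 h2] [k1 k2]; apply/eqP; rewrite eq_complex /=; apply/andP; split.
  under eq_Rintegral do rewrite ReD.
  by rewrite (RintegralD measurable_disc2 h1 k1).
under eq_Rintegral do rewrite ImD.
by rewrite (RintegralD measurable_disc2 h2 k2).
Qed.

Lemma di_integrableZ (c : C) f : disc_integrable f ->
  disc_integrable (fun z => c * f z).
Proof.
move=> [h1 h2]; split.
  under eq_fun do rewrite ReM.
  exact: (integrableB measurable_disc2
    (integrableZl measurable_disc2 (complex.Re c) h1)
    (integrableZl measurable_disc2 (complex.Im c) h2)).
under eq_fun do rewrite ImM.
exact: (integrableD measurable_disc2
  (integrableZl measurable_disc2 (complex.Re c) h2)
  (integrableZl measurable_disc2 (complex.Im c) h1)).
Qed.

Lemma diZ (c : C) f : disc_integrable f ->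
  disc_integral (fun z => c * f z) = c * disc_integral f.
Proof.
move=> [h1 h2]; have mD := @measurable_disc2 R.
apply/eqP; rewrite eq_complex ReM ImM /=; apply/andP; split.
  under eq_Rintegral do rewrite ReM.
  rewrite RintegralB //; last 2 first.
  - exact: (integrableZl measurable_disc2 (complex.Re c) h1).
  - exact: (integrableZl measurable_disc2 (complex.Im c) h2).
  by rewrite !RintegralZl.
under eq_Rintegral do rewrite ImM.
rewrite RintegralD //; last 2 first.
- exact: (integrableZl measurable_disc2 (complex.Re c) h2).
- exact: (integrableZl measurable_disc2 (complex.Im c) h1).
by rewrite !RintegralZl.
Qed.

Lemma di_integrableN f : disc_integrable f -> disc_integrable (fun z => - f z).
Proof.
move=> /(di_integrableZ (-1)); under [X in disc_integrable X]eq_fun do rewrite mulN1r.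
by [].
Qed.

Lemma diN f : disc_integrable f ->
  disc_integral (fun z => - f z) = - disc_integral f.
Proof.
move=> /(diZ (-1)); under [X in disc_integral X]eq_fun do rewrite mulN1r.
by rewrite mulN1r.
Qed.

Lemma di_integrableB f g : disc_integrable f -> disc_integrable g ->
  disc_integrable (fun z => f z - g z).
Proof. by move=> hf /di_integrableN; exact: di_integrableD. Qed.

Lemma diB f g : disc_integrable f -> disc_integrable g ->
  disc_integral (fun z => f z - g z) = disc_integral f - disc_integral g.
Proof. by move=> hf hg; rewrite diD ?diN //; exact: di_integrableN. Qed.

Lemma di_integrable0 : disc_integrable (fun=> 0 : C).
Proof. by split; exact: integrable0. Qed.

Lemma di0 : disc_integral (fun=> 0 : C) = 0.
Proof.
have -> : (fun=> 0 : C) = (fun z : C => 0 * ((fun=> 0) z : C)).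
  by apply/funext => z; rewrite mul0r.
by rewrite (diZ 0 di_integrable0) mul0r.
Qed.

Lemma di_integrable_sum (I : Type) (r : seq I) (P : pred I) (F : I -> C -> C) :
  (forall i, P i -> disc_integrable (F i)) ->
  disc_integrable (fun z => \sum_(i <- r | P i) F i z).
Proof.
move=> H; elim: r => [|i r IH]; first by rewrite sumfun_nil; exact: di_integrable0.
by rewrite sumfun_cons; case: ifPn => // Pi; exact: di_integrableD (H _ Pi) IH.
Qed.

Lemma di_sum (I : Type) (r : seq I) (P : pred I) (F : I -> C -> C) :
  (forall i, P i -> disc_integrable (F i)) ->
  disc_integral (fun z => \sum_(i <- r | P i) F i z) =
  \sum_(i <- r | P i) disc_integral (F i).
Proof.
move=> H; elim: r => [|i r IH]; first by rewrite sumfun_nil big_nil di0.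
rewrite sumfun_cons big_cons; case: ifPn => // Pi.
by rewrite diD ?IH //; [exact: H|exact: di_integrable_sum].
Qed.

Lemma diJ f : disc_integrable f ->
  disc_integral (fun z => (f z)^*) = (disc_integral f)^*.
Proof.
move=> [h1 h2]; rewrite conjCE /disc_integral /=; congr (_ +i* _).
  by apply: eq_Rintegral => w _; rewrite conjCE; case: (f _).
rewrite -[RHS]mulN1r -RintegralZl //; last exact: measurable_disc2.
by apply: eq_Rintegral => w _; rewrite mulN1r conjCE; case: (f _).
Qed.

Lemma di_bound f G : disc_integrable f -> rint G ->
  (forall z, unit_disc z -> cabs (f z) <= G z) ->
  cabs (disc_integral f) <= 2 * Rintegral sigma disc (fun w => G (toC w)).
Proof.
move=> [h1 h2] hG H; apply: (le_trans (cabs_le_ReIm _)) => /=.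
rewrite mulr_natl mulr2n; apply: lerD.
  apply: (le_trans (le_normr_Rintegral measurable_disc2 h1)).
  apply: le_Rintegral => //; [exact: measurable_disc2|exact: integrable_norm|].
  by move=> w dw; apply: le_trans (H _ dw); exact: normRe_cabs.
apply: (le_trans (le_normr_Rintegral measurable_disc2 h2)).
apply: le_Rintegral => //; [exact: measurable_disc2|exact: integrable_norm|].
by move=> w dw; apply: le_trans (H _ dw); exact: normIm_cabs.
Qed.

Lemma Rint_dct s (F : nat -> C -> R) (u : C -> R) G :
  (forall n, measurable_fun disc (fun w => F n (toC w))) ->
  measurable_fun disc (fun w => u (toC w)) -> rint G ->
  (forall n z, unit_disc z -> z \notin s -> `|F n z| <= G z) ->
  (forall z, unit_disc z -> z \notin s -> (fun n => F n z) @ \oo --> u z) ->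
  rint u /\ (fun n => Rintegral sigma disc (fun w => F n (toC w))) @ \oo -->
            Rintegral sigma disc (fun w => u (toC w)).
Proof.
move=> mF mu hG FG Fu.
have [] := @dominated_convergence _ _ _ sigma disc measurable_disc2
  (fun n w => (F n (toC w))%:E) (fun w => (u (toC w))%:E) (fun w => (G (toC w))%:E).
- by move=> n; exact/measurable_EFinP.
- exact/measurable_EFinP.
- apply: (negligibleS _ (negligible_pts s)) => w /=.
  apply: contra_notP => /negP ws dw; apply/cvg_EFin.
    by apply: nearW.
  exact: Fu.
- exact: hG.
- apply: (negligibleS _ (negligible_pts s)) => w /=.
  apply: contra_notP => /negP ws n dw /=; rewrite lee_fin.
  exact: FG.
move=> iu _ H; split=> //.
apply: (@fine_cvg _ _ _ _ _ _).
rewrite fineK; [by []|exact: (integrable_fin_num measurable_disc2 iu)].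
Qed.

Lemma di_dct s (F : nat -> C -> C) f G :
  (forall n, cmeas (F n)) -> cmeas f -> rint G ->
  (forall n z, unit_disc z -> z \notin s -> cabs (F n z) <= G z) ->
  (forall z, unit_disc z -> z \notin s -> ccvg (fun n => F n z) (f z)) ->
  disc_integrable f /\ ccvg (fun n => disc_integral (F n)) (disc_integral f).
Proof.
move=> mF [mf1 mf2] hG FG Ff.
have [h1 k1] := @Rint_dct s (fun n z => complex.Re (F n z)) (fun z => complex.Re (f z)) G
  (fun n => (mF n).1) mf1 hG (fun n z zD zs => le_trans (normRe_cabs _) (FG n z zD zs))
  (fun z zD zs => ccvg_Re (Ff z zD zs)).
have [h2 k2] := @Rint_dct s (fun n z => complex.Im (F n z)) (fun z => complex.Im (f z)) G
  (fun n => (mF n).2) mf2 hG (fun n z zD zs => le_trans (normIm_cabs _) (FG n z zD zs))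
  (fun z zD zs => ccvg_Im (Ff z zD zs)).
by split; [split|apply: ccvg_ReIm].
Qed.

Lemma di_off s f g : disc_integrable f -> cmeas g ->
  (forall z, unit_disc z -> z \notin s -> f z = g z) ->
  disc_integrable g /\ disc_integral f = disc_integral g.
Proof.
move=> hf mg fg.
have [h1 h2] := @di_dct s (fun=> f) g _ (fun=> di_cmeas hf) mg (di_rint hf)
   (fun n z _ _ => cabs_le_ReIm _) (fun z zD zs => eq_rect _ (ccvg _) (ccvg_cst (f z)) _ (fg z zD zs)).
by split=> //; exact: ccvg_unique (ccvg_cst _) h2.
Qed.

End integral.

(** * Bisection of squares *)

Section bisection.
Variable R : realType.
Local Notation C := R[i].

Lemma nested_limit (c r : nat -> R) :
  (forall n, 0 < r n) -> (forall n, c n <= c n.+1) ->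
  (forall n, c n.+1 + 3 * r n.+1 <= c n + 3 * r n) ->
  exists x, forall n, c n <= x <= c n + 3 * r n.
Proof.
move=> r0 cn rn.
have cm m k : c m <= c (m + k)%N.
  elim: k => [|k IH]; first by rewrite addn0.
  by rewrite addnS (le_trans IH).
have dm m k : c (m + k)%N + 3 * r (m + k)%N <= c m + 3 * r m.
  elim: k => [|k IH]; first by rewrite addn0.
  by rewrite addnS (le_trans _ IH).
have ub m n : c m <= c n + 3 * r n.
  have [mn|nm] := leqP m n.
    by rewrite -(subnKC mn); apply: (le_trans (cm m (n - m)%N)); rewrite lerDl mulr_ge0 // ltW.
  apply: le_trans (dm n (m - n)%N); rewrite (subnKC (ltnW nm)).
  by rewrite lerDl mulr_ge0 // ltW.
exists (sup (range c)) => n; apply/andP; split.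
  apply: ub_le_sup; last by exists n.
  by exists (c 0%N + 3 * r 0%N) => _ [m _ <-].
apply: ge_sup; first by exists (c 0%N); exists 0%N.
by move=> _ [m _ <-].
Qed.

(** Goursat's scheme. The square with corner [(x, y)] and side [3 * r] has
    sixteen overlapping children of side [3 * (r / 2)]; if the property failed,
    some child would fail, and the nested squares would shrink to a point where
    the local hypothesis is contradicted. The overlap is the one for which the
    quadratic B-spline refines. *)
Lemma quad_bisect (P : R -> R -> R -> Prop) :
  (forall x y r, 0 < r ->
     (forall k l : 'I_4, P (x + k%:R * (r / 2)) (y + l%:R * (r / 2)) (r / 2)) ->
     P x y r) ->
  (forall x0 y0, exists2 d, 0 < d & forall x y r, 0 < r -> r < d ->
     x <= x0 <= x + 3 * r -> y <= y0 <= y + 3 * r -> P x y r) ->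
  forall x y r, 0 < r -> P x y r.
Proof.
move=> Hstep Hloc x y r r0; apply: contrapT => nP.
pose child (t : R * R * R) (kl : 'I_4 * 'I_4) : R * R * R :=
  (t.1.1 + kl.1%:R * (t.2 / 2), t.1.2 + kl.2%:R * (t.2 / 2), t.2 / 2).
pose Q (t : R * R * R) := P t.1.1 t.1.2 t.2.
have /choice[sel Hsel] : forall t, exists kl, 0 < t.2 -> ~ Q t -> ~ Q (child t kl).
  move=> t; have [H|H] := pselect (exists kl, ~ Q (child t kl)).
    by case: H => kl ?; exists kl.
  exists (ord0, ord0) => t0 nQ; exfalso; apply: nQ; apply: Hstep => // k l.
  by apply: contrapT => nQ; apply: H; exists (k, l).
pose t n := iter n (fun t => child t (sel t)) (x, y, r).
have tS n : t n.+1 = child (t n) (sel (t n)) by [].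
have t2 n : (t n).2 = r / 2 ^+ n.
  elim: n => [|n IH]; first by rewrite expr0 divr1.
  by rewrite tS /= IH exprSr invfM mulrA.
have t20 n : 0 < (t n).2 by rewrite t2 divr_gt0 // exprn_gt0.
have tQ n : ~ Q (t n) by elim: n => // n IH; rewrite tS; apply: Hsel.
have lek (k : 'I_4) : 0 <= (k%:R : R) <= 3.
  by rewrite ler0n /= (ler_nat _ k 3) -ltnS.
have [x0 hx] : exists x0, forall n, (t n).1.1 <= x0 <= (t n).1.1 + 3 * (t n).2.
  apply: (@nested_limit (fun n => (t n).1.1) (fun n => (t n).2)) => // n.
    rewrite tS /= lerDl mulr_ge0 //; last by have := t20 n; lra.
  rewrite tS /=; have := t20 n; have /andP[_ k3] := lek (sel (t n)).1; nra.
have [y0 hy] : exists y0, forall n, (t n).1.2 <= y0 <= (t n).1.2 + 3 * (t n).2.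
  apply: (@nested_limit (fun n => (t n).1.2) (fun n => (t n).2)) => // n.
    rewrite tS /= lerDl mulr_ge0 //; last by have := t20 n; lra.
  rewrite tS /=; have := t20 n; have /andP[_ k3] := lek (sel (t n)).2; nra.
have [d d0 Hd] := Hloc x0 y0.
have [n nd] : exists n, r / 2 ^+ n < d.
  have rd : 0 < d / r by rewrite divr_gt0.
  have [n _ /(_ n (leqnn n)) hn] := near_infty_natSinv_lt (PosNum rd).
  exists n; rewrite ltr_pdivrMr ?exprn_gt0 // mulrC -ltr_pdivrMr //.
  move: hn => /=; rewrite -[d / r]invrK ltf_pV2 ?posrE ?invr_gt0 // invf_div => hn.
  apply: (lt_le_trans hn); rewrite -natrX ler_nat.
  exact: ltn_expl.
by apply: (tQ n); apply: Hd => //; rewrite t2.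
Qed.

Definition in_sq (x y r : R) (z : C) :=
  x <= complex.Re z <= x + 3 * r /\ y <= complex.Im z <= y + 3 * r.

Lemma in_sq_dist x y r z w : in_sq x y r z -> in_sq x y r w ->
  cabs (z - w) <= 6 * r.
Proof.
move=> [/andP[? ?] /andP[? ?]] [/andP[? ?] /andP[? ?]].
apply: (le_trans (cabs_le_ReIm _)); rewrite ReD ReN ImD ImN.
have h1 : `|complex.Re z - complex.Re w| <= 3 * r.
  by rewrite ler_norml; apply/andP; split; lra.
have h2 : `|complex.Im z - complex.Im w| <= 3 * r.
  by rewrite ler_norml; apply/andP; split; lra.
lra.
Qed.

Lemma in_sq_children x y r z : 0 < r -> in_sq x y r z ->
  exists k l : 'I_4, in_sq (x + k%:R * (r / 2)) (y + l%:R * (r / 2)) (r / 2) z.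
Proof.
move=> r0.
have H a t : a <= t <= a + 3 * r -> exists k : 'I_4,
    a + k%:R * (r / 2) <= t <= a + k%:R * (r / 2) + 3 * (r / 2).
  move=> /andP[h1 h2]; have [h|h] := leP t (a + 3 * (r / 2)).
    by exists ord0 => /=; rewrite mul0r addr0 h1.
  by exists (inord 3); rewrite inordK //; apply/andP; split; lra.
by move=> [/H[k hk] /H[l hl]]; exists k, l.
Qed.

(** Boundedness passes from the children to the square and holds locally, so
    [quad_bisect] applies. *)
Lemma bounded_disc (f : C -> C) (rho : R) :
  (forall z, cabs z <= rho -> ccont f z) ->
  exists2 M, 0 < M & forall z, cabs z <= rho -> cabs (f z) <= M.
Proof.
move=> cf.
pose P x y r := exists2 M, 0 < M & forall z, in_sq x y r z -> cabs z <= rho -> cabs (f z) <= M.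
have PP : forall x y r, 0 < r -> P x y r.
  apply: quad_bisect.
    move=> x y r r0 H.
    have /choice[M HM] : forall kl : 'I_4 * 'I_4, exists M, 0 < M /\
       forall z, in_sq (x + kl.1%:R * (r / 2)) (y + kl.2%:R * (r / 2)) (r / 2) z ->
         cabs z <= rho -> cabs (f z) <= M.
      by move=> kl; have [M M0 HM] := H kl.1 kl.2; exists M.
    exists (\sum_kl M kl).
      rewrite (bigD1 (ord0, ord0)) //= ltr_pwDl ?(HM _).1 //.
      by apply: sumr_ge0 => kl _; exact/ltW/(HM _).1.
    move=> z /(in_sq_children r0)[k [l hz]] zr.
    apply: (le_trans ((HM (k, l)).2 z hz zr)).
    rewrite (bigD1 (k, l)) //= lerDl.
    by apply: sumr_ge0 => kl _; exact/ltW/(HM _).1.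
  move=> x0 y0; pose z0 := x0 +i* y0.
  have [h|h] := leP (cabs z0) rho.
    have [d d0 Hd] := ccont_bound (cf _ h).
    exists (d / 6) => [|x y r r0 rd hx hy]; first lra.
    exists (cabs (f z0) + 1) => [|z zs zr]; first by have := cabs_ge0 (f z0); lra.
    apply/ltW/Hd; apply: (@le_lt_trans _ _ (6 * r)); last lra.
    by apply: (in_sq_dist zs); split.
  exists ((cabs z0 - rho) / 6) => [|x y r r0 rd hx hy]; first lra.
  exists 1 => // z zs zr; exfalso.
  have := @in_sq_dist x y r z0 z (conj hx hy) zs.
  have := cabsD (z0 - z) z; rewrite subrK; lra.
have [M M0 HM] := PP (- `|rho|) (- `|rho|) (`|rho| + 1) (ltr_wpDl (normr_ge0 _) ltr01).
exists M => // z zr; apply: HM => //.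
have h : cabs z <= `|rho| by apply: (le_trans zr); exact: ler_norm.
have := le_trans (normRe_cabs z) h; have := le_trans (normIm_cabs z) h.
rewrite !ler_norml => /andP[? ?] /andP[? ?]; have := normr_ge0 rho.
by split; apply/andP; split; lra.
Qed.

End bisection.

(** * Continuously differentiable functions and Green's formula *)

Section C1.
Variable R : realType.
Local Notation C := R[i].
Implicit Types (f g th : C -> C).

(** The class of functions to which Green's formula applies. *)
Definition C1D f fz fb := forall z, unit_disc z ->
  [/\ wirt f z (fz z) (fb z), ccont fz z & ccont fb z].

(** Test functions of the disc, with compact support. *)
Definition ctest th tz tb := C1D th tz tb /\
  exists2 r : R, 0 < r < 1 & forall z, unit_disc z -> r < cabs z ->
    [/\ th z = 0, tz z = 0 & tb z = 0].

Lemma unit_disc_near (z : C) : unit_disc z -> exists2 e, 0 < e &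
  forall y, cabs (y - z) < e -> unit_disc y.
Proof.
move=> /unit_discE h; exists (1 - cabs z) => [|y hy]; first lra.
by apply/unit_discE; have := cabsD (y - z) z; rewrite subrK; lra.
Qed.

Lemma ccont_disc f g z : unit_disc z -> (forall y, unit_disc y -> f y = g y) ->
  ccont f z -> ccont g z.
Proof.
move=> /unit_disc_near[e e0 H] fg; apply: (@ccont_locally _ _ _ _ e) => // y /H.
exact: fg.
Qed.

Lemma C1D_cont f fz fb z : C1D f fz fb -> unit_disc z -> ccont f z.
Proof. by move=> H /H[/wirt_cont]. Qed.

Lemma C1D_ext f fz fb fz' fb' : (forall z, unit_disc z -> fz z = fz' z) ->
  (forall z, unit_disc z -> fb z = fb' z) -> C1D f fz fb -> C1D f fz' fb'.
Proof.
move=> h1 h2 H z zD; have [w c1 c2] := H z zD; split.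
- by rewrite -h1 // -h2.
- exact: (ccont_disc zD h1).
- exact: (ccont_disc zD h2).
Qed.

Lemma C1D_cst k : C1D (fun=> k) (fun=> 0) (fun=> 0).
Proof. by move=> z _; split; [exact: wirt_cst|exact: ccont_cst|exact: ccont_cst]. Qed.

Lemma C1D_id : C1D id (fun=> 1) (fun=> 0).
Proof. by move=> z _; split; [exact: wirt_id|exact: ccont_cst|exact: ccont_cst]. Qed.

Lemma C1DD f fz fb g gz gb : C1D f fz fb -> C1D g gz gb ->
  C1D (fun z => f z + g z) (fun z => fz z + gz z) (fun z => fb z + gb z).
Proof.
move=> H H' z zD; have [w c1 c2] := H z zD; have [w' c1' c2'] := H' z zD.
by split; [exact: wirtD|exact: ccontD|exact: ccontD].
Qed.

Lemma C1DN f fz fb : C1D f fz fb ->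
  C1D (fun z => - f z) (fun z => - fz z) (fun z => - fb z).
Proof.
move=> H z zD; have [w c1 c2] := H z zD.
by split; [exact: wirtN|exact: ccontN|exact: ccontN].
Qed.

Lemma C1DB f fz fb g gz gb : C1D f fz fb -> C1D g gz gb ->
  C1D (fun z => f z - g z) (fun z => fz z - gz z) (fun z => fb z - gb z).
Proof. by move=> H /C1DN; exact: C1DD. Qed.

Lemma C1DM f fz fb g gz gb : C1D f fz fb -> C1D g gz gb ->
  C1D (fun z => f z * g z) (fun z => fz z * g z + f z * gz z)
      (fun z => fb z * g z + f z * gb z).
Proof.
move=> H H' z zD; have [w c1 c2] := H z zD; have [w' c1' c2'] := H' z zD.
have cf := wirt_cont w; have cg := wirt_cont w'.
by split; [exact: wirtM|apply: ccontD; exact: ccontM|apply: ccontD; exact: ccontM].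
Qed.

Lemma C1DJ f fz fb : C1D f fz fb ->
  C1D (fun z => (f z)^*) (fun z => (fb z)^*) (fun z => (fz z)^*).
Proof.
move=> H z zD; have [w c1 c2] := H z zD.
by split; [exact: wirtJ|exact: ccontJ|exact: ccontJ].
Qed.

Lemma C1DV f fz fb : (forall z, unit_disc z -> f z != 0) -> C1D f fz fb ->
  C1D (fun z => (f z)^-1) (fun z => - fz z / f z ^+ 2) (fun z => - fb z / f z ^+ 2).
Proof.
move=> f0 H z zD; have [w c1 c2] := H z zD; have cf := wirt_cont w.
have ci : ccont (fun z => (f z ^+ 2)^-1) z.
  by apply: ccontV; [rewrite expf_neq0 // f0|exact: ccontM].
by split; [apply: wirtV => //; exact: f0|
  apply: ccontM => //; exact: ccontN|apply: ccontM => //; exact: ccontN].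
Qed.

Lemma C1D_real (r : C -> R) (psi dpsi : R -> R) fz fb :
  C1D (fun z => (r z)%:C) fz fb ->
  (forall z, unit_disc z -> is_derive (r z) 1 psi (dpsi (r z))) ->
  (forall z, unit_disc z -> {for r z, continuous dpsi}) ->
  C1D (fun z => (psi (r z))%:C) (fun z => (dpsi (r z))%:C * fz z)
      (fun z => (dpsi (r z))%:C * fb z).
Proof.
move=> H hp cp z zD; have [w c1 c2] := H z zD.
have cd : ccont (fun z => (dpsi (r z))%:C) z.
  apply: (@ccont_real _ (fun y => (r y)%:C) dpsi) => //=; last exact: cp.
  exact: wirt_cont w.
by split; [exact: wirt_comp_real w (hp _ zD)|exact: ccontM|exact: ccontM].
Qed.

Lemma C1D_prod (I : finType) (P : pred I) (F Fz Fb : I -> C -> C) :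
  (forall i, P i -> C1D (F i) (Fz i) (Fb i)) ->
  C1D (fun z => \prod_(i | P i) F i z)
      (fun z => \sum_(i | P i) Fz i z * \prod_(j | P j && (j != i)) F j z)
      (fun z => \sum_(i | P i) Fb i z * \prod_(j | P j && (j != i)) F j z).
Proof.
move=> H z zD; split.
- by apply: wirt_prod => i /H /(_ z zD)[].
- apply: ccont_sum => i Pi; apply: ccontM; first by have [] := H i Pi z zD.
  by apply: ccont_prod => j /andP[Pj _]; exact: C1D_cont (H j Pj) zD.
- apply: ccont_sum => i Pi; apply: ccontM; first by have [] := H i Pi z zD.
  by apply: ccont_prod => j /andP[Pj _]; exact: C1D_cont (H j Pj) zD.
Qed.

Lemma ctestM th tz tb f fz fb : ctest th tz tb -> C1D f fz fb ->
  ctest (fun z => th z * f z) (fun z => tz z * f z + th z * fz z)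
        (fun z => tb z * f z + th z * fb z).
Proof.
move=> [H [r r01 Hr]] Hf; split; first exact: C1DM.
by exists r => // z zD /(Hr z zD)[-> -> ->]; split; rewrite !mul0r ?addr0.
Qed.

Lemma ctestJ th tz tb : ctest th tz tb ->
  ctest (fun z => (th z)^*) (fun z => (tb z)^*) (fun z => (tz z)^*).
Proof.
move=> [H [r r01 Hr]]; split; first exact: C1DJ.
by exists r => // z zD /(Hr z zD)[-> -> ->]; split; rewrite rmorph0.
Qed.

(** After extension by zero a test function is differentiable on the whole
    plane, and can be integrated along entire lines. *)
Definition ext0 f : C -> C := fun z => if `[< unit_disc z >] then f z else 0.

Lemma ext0_in f z : unit_disc z -> ext0 f z = f z.
Proof. by move=> zD; rewrite /ext0 asboolT. Qed.

Lemma wirt_local f g z p q e : 0 < e -> (forall y, cabs (y - z) < e -> f y = g y) ->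
  wirt f z p q -> wirt g z p q.
Proof.
move=> e0 fg [A [B [cA cB Az Bz H]]].
apply: (@wirt_near _ _ _ _ _ A B e) => // y ye.
by rewrite -!fg ?subrr ?cabs0 // H.
Qed.

Lemma ext0_zero f (r : R) : r < 1 -> (forall z, unit_disc z -> r < cabs z -> f z = 0) ->
  forall z, r < cabs z -> ext0 f z = 0.
Proof. by move=> r1 H z rz; rewrite /ext0; case: asboolP => // zD; exact: H. Qed.

Lemma ccont_ext0 f (r : R) : r < 1 -> (forall z, unit_disc z -> ccont f z) ->
  (forall z, unit_disc z -> r < cabs z -> f z = 0) -> forall z, ccont (ext0 f) z.
Proof.
move=> r1 cf H z; have [zr|rz] := leP (cabs z) r.
  have zD : unit_disc z by apply/unit_discE; lra.
  by apply: ccont_disc (cf z zD) => // y yD; rewrite ext0_in.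
apply: (@ccont_locally _ (fun=> 0) _ _ (cabs z - r)); [lra| |exact: ccont_cst].
move=> y hy; rewrite (ext0_zero r1 H) //.
by have := cabsD (z - y) y; rewrite subrK (cabs_distC z); lra.
Qed.

Lemma ctest_ext0 th tz tb : ctest th tz tb -> forall z,
  wirt (ext0 th) z (ext0 tz z) (ext0 tb z).
Proof.
move=> [H [r /andP[r0 r1] Hr]] z; have [zr|rz] := leP (cabs z) r.
  have zD : unit_disc z by apply/unit_discE; lra.
  have [w _ _] := H z zD; have [e e0 He] := unit_disc_near zD.
  rewrite !ext0_in //; apply: (@wirt_local th _ _ _ _ e) => // y /He yD.
  by rewrite ext0_in.
have Z f : (forall z, unit_disc z -> r < cabs z -> f z = 0) -> ext0 f z = 0.
  by move=> h; exact: (ext0_zero r1 h).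
rewrite !Z; [| by move=> y yD /(Hr y yD)[]..].
apply: (@wirt_local (fun=> 0) _ _ _ _ (cabs z - r)); [lra| |exact: wirt_cst].
move=> y hy; rewrite (ext0_zero r1) //; first by move=> x xD /(Hr x xD)[].
by have := cabsD (z - y) y; rewrite subrK (cabs_distC z); lra.
Qed.

End C1.

Section green.
Variable R : realType.
Local Notation C := R[i].
Local Notation T2 := (measurableTypeR R * measurableTypeR R)%type.
Local Notation leb2 := (@lebesgue_measure R \x @lebesgue_measure R)%E.
Local Notation sigma := (@sigma_area R).
Local Notation disc := (@disc2 R : set T2).
Local Notation toC := (@to_complex R).

Lemma sigma_integral (F : T2 -> \bar R) : leb2.-integrable disc F ->
  (\int[sigma]_(w in disc) F w = (pi^-1)%:E * \int[leb2]_(w in disc) F w)%E.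
Proof.
move=> iF; have mF := measurable_int _ iF; rewrite integralE [in RHS]integralE.
rewrite muleBr //; last first.
  apply: fin_num_adde_defl; rewrite fin_numN.
  exact: (integrable_neg_fin_num measurable_disc2 iF).
congr (_ - _)%E.
  by rewrite /sigma_area ge0_integral_mscale //; [exact: measurable_disc2|exact: measurable_funepos].
by rewrite /sigma_area ge0_integral_mscale //; [exact: measurable_disc2|exact: measurable_funeneg].
Qed.

(** The endpoints -1 and 1 enclose the trace of the disc on every horizontal or
    vertical line. *)
Lemma FTC_zero (u v : R -> R) : (forall x : R, is_derive x 1 u (v x)) ->
  continuous v -> u (-1) = 0 -> u 1 = 0 -> (forall x, 1 < `|x| -> v x = 0) ->
  (\int[lebesgue_measure]_x (v x)%:E = 0)%E.
Proof.
move=> du cv u0 u1 v0.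
transitivity (\int[lebesgue_measure]_(x in `[(-1)%R, 1%R]) (v x)%:E)%E.
  rewrite [RHS]integral_mkcond; apply: eq_integral => x _.
  rewrite patchE; case: ifPn => //; rewrite notin_setE /= in_itv /= => /negP h.
  rewrite v0 //; rewrite ltNge; apply: contra h.
  by rewrite ler_norml.
have cu x : {for x, continuous u}.
  by apply/differentiable_continuous/derivable1_diffP; have [] := du x.
have -> := @continuous_FTC2 _ v u (-1) 1 _ (continuous_subspaceT cv) _ _.
- by rewrite u0 u1 -EFinB subrr.
- by lra.
- split.
  + by move=> x _; have [] := du x.
  + exact: cvg_at_right_filter (cu _).
  + exact: cvg_at_left_filter (cu _).
- by move=> x _; rewrite derive1E; apply: derive_val.
Qed.

Lemma leb2_disc_lty : (leb2 disc < +oo)%E.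
Proof.
have := sigma_disc_lty R; rewrite sigmaE => h.
have pi0 : (0 < (pi : R)^-1)%R by rewrite invr_gt0 pi_gt0.
have : (leb2 disc = (pi : R)%:E * ((pi : R)^-1%:E * leb2 disc))%E.
  by rewrite muleA -EFinM divff ?mul1e // gt_eqF // pi_gt0.
by move=> ->; apply: lte_mul_pinfty => //; rewrite lee_fin ltW // pi_gt0.
Qed.

Lemma leb2_integrable (X : C -> R) (M : R) :
  measurable_fun disc (fun w => X (toC w)) ->
  (forall z, unit_disc z -> `|X z| <= M) ->
  leb2.-integrable disc (fun w => (X (toC w))%:E).
Proof.
move=> mX XM; apply: (@le_integrable _ _ _ _ _ measurable_disc2 _ (fun=> M%:E)).
- exact/measurable_EFinP.
- move=> w dw; rewrite !abse_EFin lee_fin.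
  by apply: (le_trans (XM _ dw)); rewrite ler_norm.
- apply/integrableP; split; first exact: measurable_cst.
  rewrite integral_cst ?measurable_disc2 //=; last exact: measurable_disc2.
  exact: lte_mul_pinfty leb2_disc_lty.
Qed.

(** Fubini reduces the area integral to line integrals, each of which vanishes.
    *)
Lemma green_x (X : C -> R) : measurable_fun disc (fun w => X (toC w)) ->
  (exists M, forall z, unit_disc z -> `|X z| <= M) ->
  (forall y, \int[lebesgue_measure]_x
     ((if `[< unit_disc (x +i* y) >] then X (x +i* y) else 0)%:E) = 0)%E ->
  Rintegral sigma disc (fun w => X (toC w)) = 0.
Proof.
move=> mX [M XM] H; have iX := leb2_integrable mX XM.
rewrite /Rintegral sigma_integral //.
rewrite integral_mkcond -integral21_prod_meas1; last first.
  by apply/(integrable_mkcond _ measurable_disc2).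
rewrite /fubini_G integral0_eq ?mule0 // => y _.
rewrite -[RHS](H y); apply: eq_integral => x _; rewrite patchE.
by rewrite /in_mem /mem /= /in_set /= ; case: asboolP.
Qed.

Lemma green_y (X : C -> R) : measurable_fun disc (fun w => X (toC w)) ->
  (exists M, forall z, unit_disc z -> `|X z| <= M) ->
  (forall x, \int[lebesgue_measure]_y
     ((if `[< unit_disc (x +i* y) >] then X (x +i* y) else 0)%:E) = 0)%E ->
  Rintegral sigma disc (fun w => X (toC w)) = 0.
Proof.
move=> mX [M XM] H; have iX := leb2_integrable mX XM.
rewrite /Rintegral sigma_integral //.
rewrite integral_mkcond -integral12_prod_meas1; last first.
  by apply/(integrable_mkcond _ measurable_disc2).
rewrite /fubini_F integral0_eq ?mule0 // => x _.
rewrite -[RHS](H x); apply: eq_integral => y _; rewrite patchE.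
by rewrite /in_mem /mem /= /in_set /= ; case: asboolP.
Qed.

End green.

Section test_integrals.
Variable R : realType.
Local Notation C := R[i].
Local Notation T2 := (measurableTypeR R * measurableTypeR R)%type.
Local Notation sigma := (@sigma_area R).
Local Notation disc := (@disc2 R : set T2).
Local Notation toC := (@to_complex R).
Implicit Types (f th : C -> C).

Lemma bounded_test f (r : R) : r < 1 -> (forall z, unit_disc z -> ccont f z) ->
  (forall z, unit_disc z -> r < cabs z -> f z = 0) ->
  exists2 M, 0 < M & forall z, unit_disc z -> cabs (f z) <= M.
Proof.
move=> r1 cf H; have cf' z : cabs z <= r -> ccont f z.
  by move=> zr; apply: cf; apply/unit_discE; lra.
have [M M0 HM] := bounded_disc cf'.
exists M => // z zD; have [zr|zr] := leP (cabs z) r; first exact: HM.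
by rewrite H // cabs0 ltW.
Qed.

Lemma di_bounded f (M : R) : (forall z, unit_disc z -> ccont f z) ->
  (forall z, unit_disc z -> cabs (f z) <= M) -> disc_integrable f.
Proof.
move=> cf fM; apply: (@di_dom _ [::] _ (fun=> M)).
- exact: cmeas_cont.
- exact: rint_cst.
- by move=> z zD _; exact: fM.
Qed.

Lemma di_test f (r : R) : r < 1 -> (forall z, unit_disc z -> ccont f z) ->
  (forall z, unit_disc z -> r < cabs z -> f z = 0) -> disc_integrable f.
Proof.
move=> r1 cf H; have [M _ HM] := bounded_test r1 cf H.
exact: di_bounded cf HM.
Qed.

Lemma cabs_ge_Re (x y : R) : `|x| <= cabs (x +i* y).
Proof. exact: (normRe_cabs (x +i* y)). Qed.

Lemma cabs_ge_Im (x y : R) : `|y| <= cabs (x +i* y).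
Proof. exact: (normIm_cabs (x +i* y)). Qed.

Lemma ext0_out f z : 1 <= cabs z -> ext0 f z = 0.
Proof.
by move=> h; rewrite /ext0; case: asboolP => // /unit_discE; rewrite ltNge h.
Qed.

Lemma cont_Re_slice_x f y : (forall z, ccont f z) ->
  continuous (fun x : R => complex.Re (f (x +i* y))).
Proof.
move=> cf x; apply/cvgrPdist_lt => e e0; have [d d0 Hd] := cf (x +i* y) e e0.
apply/nbhs_ballP; exists d => //= t; rewrite /ball /= distrC => tx.
rewrite distrC -ReN -ReD; apply: (le_lt_trans (normRe_cabs _)); apply: Hd.
by apply: (le_lt_trans (cabs_le_ReIm _)); rewrite /= subrr normr0 addr0.
Qed.

Lemma cont_Re_slice_y f x : (forall z, ccont f z) ->
  continuous (fun y : R => complex.Re (f (x +i* y))).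
Proof.
move=> cf y; apply/cvgrPdist_lt => e e0; have [d d0 Hd] := cf (x +i* y) e e0.
apply/nbhs_ballP; exists d => //= t; rewrite /ball /= distrC => tx.
rewrite distrC -ReN -ReD; apply: (le_lt_trans (normRe_cabs _)); apply: Hd.
by apply: (le_lt_trans (cabs_le_ReIm _)); rewrite /= subrr normr0 add0r.
Qed.

Lemma ctest_Re_int th tz tb : ctest th tz tb ->
  Rintegral sigma disc (fun w => complex.Re (tz (toC w) + tb (toC w))) = 0 /\
  Rintegral sigma disc (fun w => complex.Re ('i%C * (tz (toC w) - tb (toC w)))) = 0.
Proof.
move=> Ht; have wt := ctest_ext0 Ht; case: Ht => [H [r /andP[r0 r1] Hr]].
have cz z : unit_disc z -> ccont tz z by move=> /H[].
have cb z : unit_disc z -> ccont tb z by move=> /H[].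
have zz z : unit_disc z -> r < cabs z -> tz z = 0 by move=> zD /(Hr z zD)[].
have zb z : unit_disc z -> r < cabs z -> tb z = 0 by move=> zD /(Hr z zD)[].
have bd f : (forall z, unit_disc z -> ccont f z) ->
    (forall z, unit_disc z -> r < cabs z -> f z = 0) ->
    exists M, forall z, unit_disc z -> `|complex.Re (f z)| <= M.
  move=> cf zf; have [M _ HM] := bounded_test r1 cf zf.
  by exists M => z zD; apply: le_trans (normRe_cabs _) (HM z zD).
split.
  apply: (@green_x _ (fun z => complex.Re (tz z + tb z))).
  - suff [] : cmeas (fun z => tz z + tb z) by [].
    by apply: cmeas_cont => z zD; apply: ccontD; [exact: cz|exact: cb].
  - apply: (bd (fun z => tz z + tb z)) => z zD.
      by apply: ccontD; [exact: cz|exact: cb].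
    by move=> rz; rewrite zz // zb // addr0.
  - move=> y; rewrite -[RHS](@FTC_zero _ (fun x => complex.Re (ext0 th (x +i* y)))
      (fun x => complex.Re (ext0 tz (x +i* y) + ext0 tb (x +i* y)))).
    + apply: eq_integral => x _; rewrite /ext0; case: asboolP => //.
      by rewrite addr0.
    + by move=> x; have [] := wirt_slice_x (wt (x +i* y)).
    + apply: (@cont_Re_slice_x (fun z => ext0 tz z + ext0 tb z)) => z.
      by apply: ccontD; exact: (ccont_ext0 r1).
    + by rewrite ext0_out // (le_trans _ (cabs_ge_Re _ _)) // normrN normr1.
    + by rewrite ext0_out // (le_trans _ (cabs_ge_Re _ _)) // normr1.
    + move=> x x1; rewrite !ext0_out ?addr0 //.
        by rewrite (le_trans _ (cabs_ge_Re _ _)) // ltW.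
      by rewrite (le_trans _ (cabs_ge_Re _ _)) // ltW.
apply: (@green_y _ (fun z => complex.Re ('i%C * (tz z - tb z)))).
- suff [] : cmeas (fun z => 'i%C * (tz z - tb z)) by [].
  apply: cmeas_cont => z zD; apply: ccontM; first exact: ccont_cst.
  by apply: ccontB; [exact: cz|exact: cb].
- apply: (bd (fun z => 'i%C * (tz z - tb z))) => z zD.
    apply: ccontM; first exact: ccont_cst.
    by apply: ccontB; [exact: cz|exact: cb].
  by move=> rz; rewrite zz // zb // subr0 mulr0.
- move=> x; rewrite -[RHS](@FTC_zero _ (fun y => complex.Re (ext0 th (x +i* y)))
    (fun y => complex.Re ('i%C * (ext0 tz (x +i* y) - ext0 tb (x +i* y))))).
  + apply: eq_integral => y _; rewrite /ext0; case: asboolP => //.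
    by rewrite subr0 mulr0.
  + by move=> y; have [] := wirt_slice_y (wt (x +i* y)).
  + apply: (@cont_Re_slice_y (fun z => 'i%C * (ext0 tz z - ext0 tb z))) => z.
    apply: ccontM; first exact: ccont_cst.
    by apply: ccontB; exact: (ccont_ext0 r1).
  + by rewrite ext0_out // (le_trans _ (cabs_ge_Im _ _)) // normrN normr1.
  + by rewrite ext0_out // (le_trans _ (cabs_ge_Im _ _)) // normr1.
  + move=> y y1; rewrite !ext0_out ?subr0 ?mulr0 //.
      by rewrite (le_trans _ (cabs_ge_Im _ _)) // ltW.
    by rewrite (le_trans _ (cabs_ge_Im _ _)) // ltW.
Qed.

Lemma ctestZ k th tz tb : ctest th tz tb ->
  ctest (fun z => th z * k) (fun z => tz z * k) (fun z => tb z * k).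
Proof.
move=> H; have := ctestM H (C1D_cst k).
have E (u : C -> C) : (fun z => u z * k + th z * 0) = (fun z => u z * k).
  by apply/funext => z; rewrite mulr0 addr0.
by rewrite !E.
Qed.

Lemma ctest_cont_z th tz tb : ctest th tz tb -> disc_integrable tz.
Proof.
move=> [H [r /andP[r0 r1] Hr]]; apply: (di_test r1).
  by move=> z /H[].
by move=> z zD /(Hr z zD)[].
Qed.

Lemma ctest_cont_b th tz tb : ctest th tz tb -> disc_integrable tb.
Proof.
move=> [H [r /andP[r0 r1] Hr]]; apply: (di_test r1).
  by move=> z /H[].
by move=> z zD /(Hr z zD)[].
Qed.

(** Green's formula without boundary term. Each of the real parts of [tz + tb]
    and of 'i (tz - tb) is a partial derivative, hence integrates to zero along
    lines; the imaginary parts follow on multiplying [th] by -'i. *)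
Lemma ctest_int th tz tb : ctest th tz tb ->
  disc_integral tz = 0 /\ disc_integral tb = 0.
Proof.
move=> Ht; have iz := ctest_cont_z Ht; have ib := ctest_cont_b Ht.
have [h1 h2] := ctest_Re_int Ht.
have [k1 k2] := ctest_Re_int (ctestZ (- 'i%C) Ht).
have Ri : complex.Re (- 'i%C : C) = 0 by rewrite /= oppr0.
have Ii : complex.Im (- 'i%C : C) = - 1 by [].
have R1 : disc_integral (fun z => tz z + tb z) = 0.
  apply/eqP; rewrite eq_complex /= h1 eqxx /=; apply/eqP; apply: etrans k1.
  apply: eq_Rintegral => w _; rewrite -mulrDl ReM Ri Ii.
  by rewrite mulr0 sub0r mulrN opprK mulr1.
have R2 : disc_integral (fun z => 'i%C * (tz z - tb z)) = 0.
  apply/eqP; rewrite eq_complex /= h2 eqxx /=; apply/eqP; apply: etrans k2.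
  apply: eq_Rintegral => w _; rewrite -mulrBl mulrA [in RHS]ReM Ri Ii.
  by rewrite mulr0 sub0r mulrN opprK mulr1.
rewrite diD // in R1; rewrite diZ ?diB // in R2; last exact: di_integrableB.
have i0 : 'i%C != 0 :> C by rewrite -cabs_gt0 cabsi.
move/eqP: R2; rewrite mulf_eq0 (negbTE i0) /= subr_eq0 => /eqP E.
move: R1; rewrite -E -mulr2n -mulr_natl => /eqP.
by rewrite mulf_eq0 pnatr_eq0 /= => /eqP ->.
Qed.

End test_integrals.

(** * The quadratic B-spline *)

Section spline.
Variable R : realType.
Implicit Types (x u c : R).

(** Truncated square, a C^1 function; the splines below are combinations of its
    translates. *)
Definition tsq x : R := Num.max x 0 ^+ 2.
Definition dtsq x : R := 2 * Num.max x 0.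

Lemma is_derive_quad (f : R -> R) (x d M : R) :
  (forall y, `|f y - f x - d * (y - x)| <= M * (y - x) ^+ 2) -> is_derive x 1 f d.
Proof.
move=> H.
pose q (t : R) := if t == x then d else (f t - f x) / (t - x).
suff : is_derive x 1 f (q x) by rewrite /q eqxx.
apply: is_derive_car => [t|].
  rewrite /q; case: eqVneq => [->|tx]; first by rewrite !subrr mulr0.
  by rewrite divfK // subr_eq0.
have H1 t : `|q t - q x| <= `|M| * `|t - x|.
  rewrite /q eqxx; case: eqVneq => [->|tx]; first by rewrite !subrr normr0 mulr0.
  have t0 : 0 < `|t - x| by rewrite normr_gt0 subr_eq0.
  rewrite -(@ler_pM2r _ `|t - x|) // -normrM mulrBl divfK ?subr_eq0 //.
  apply: (le_trans (H t)); rewrite -mulrA -expr2 real_normK ?num_real //.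
  by rewrite ler_wpM2r ?sqr_ge0 // ler_norm.
apply/cvgrPdist_lt => e e0; apply/nbhs_ballP.
have M1 : 0 < `|M| + 1 by rewrite ltr_wpDl.
exists (e / (`|M| + 1)) => [|t]; first by rewrite /= divr_gt0.
rewrite /ball /= !(distrC x) (distrC (q x)) ltr_pdivlMr // => h.
apply: (le_lt_trans (H1 t)); apply: le_lt_trans h.
by rewrite mulrC ler_wpM2l // lerDl.
Qed.

Lemma is_derive_tsq x : is_derive x 1 tsq (dtsq x).
Proof.
apply: (@is_derive_quad _ _ _ 1) => y; rewrite mul1r /tsq /dtsq.
have [hx|hx] := leP x 0; have [hy|hy] := leP y 0.
- rewrite !(mulr0, mul0r, expr0n) /= !subr0 normr0; exact: sqr_ge0.
- have xy : x * y <= 0 by rewrite mulrC pmulr_rle0.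
  by rewrite !(mulr0, mul0r, expr0n) /= !subr0 ger0_norm ?sqr_ge0 // !expr2; nra.
- have xy : x * y <= 0 by rewrite pmulr_rle0.
  have := sqr_ge0 (y - x); have := sqr_ge0 x; have := sqr_ge0 y.
  by rewrite expr0n /= sub0r ler_norml !expr2 => ? ? ?; apply/andP; split; nra.
- have -> : y ^+ 2 - x ^+ 2 - 2 * x * (y - x) = (y - x) ^+ 2 by ring.
  by rewrite ger0_norm // sqr_ge0.
Qed.

Lemma dtsq_lip x t : `|dtsq x - dtsq t| <= 2 * `|x - t|.
Proof.
rewrite /dtsq -mulrBr normrM ger0_norm // ler_pM2l //.
by have [hx|hx] := leP x 0; have [ht|ht] := leP t 0;
  rewrite ?subrr ?subr0 ?sub0r ?normrN ?normr0 //; rewrite !ler_norml;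
  apply/andP; split; have := ler_norm (x - t); have := ler_norm (t - x);
  rewrite distrC; lra.
Qed.

(** The quadratic B-spline with knots 0, 1, 2, 3: it is C^1, supported in [0,
    3], satisfies a two-scale refinement equation and its integer translates
    form a partition of unity. *)
Definition bsp x : R := (tsq x - 3 * tsq (x - 1) + 3 * tsq (x - 2) - tsq (x - 3)) / 2.
Definition dbsp x : R := (dtsq x - 3 * dtsq (x - 1) + 3 * dtsq (x - 2) - dtsq (x - 3)) / 2.

Lemma is_derive_tsq_shift x c : is_derive x 1 (fun t => tsq (t - c)) (dtsq (x - c)).
Proof.
have [q [cq qx Hq]] := derive_car (is_derive_tsq (x - c)).
rewrite -qx; apply: (@is_derive_car _ _ (fun t => q (t - c))).
  by move=> t; rewrite Hq; congr (_ * _); lra.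
move/cvgrPdist_lt : cq => cq; apply/cvgrPdist_lt => e /cq /nbhs_ballP[d /= d0 Hd].
apply/nbhs_ballP; exists d => // t; rewrite /ball /= => h; apply: Hd.
by rewrite /ball /= (_ : x - c - (t - c) = x - t) //; lra.
Qed.

Lemma is_derive_bsp x : is_derive x 1 bsp (dbsp x).
Proof.
have h0 := is_derive_tsq x.
have h1 := is_derive_tsq_shift x 1.
have h2 := is_derive_tsq_shift x 2.
have h3 := is_derive_tsq_shift x 3.
have -> : bsp = (fun t => 2^-1 *: (tsq t + (- 3) *: tsq (t - 1) + 3 *: tsq (t - 2) - tsq (t - 3))).
  by apply/funext => t; rewrite /bsp /GRing.scale /=; lra.
apply: is_derive_eq.
by rewrite /dbsp /GRing.scale /=; lra.
Qed.

Lemma dbsp_lip x t : `|dbsp x - dbsp t| <= 8 * `|x - t|.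
Proof.
have := dtsq_lip x t; have := dtsq_lip (x - 1) (t - 1).
have := dtsq_lip (x - 2) (t - 2); have := dtsq_lip (x - 3) (t - 3).
have E (a : R) : x - a - (t - a) = x - t by lra.
rewrite !E /dbsp !ler_norml => /andP[? ?] /andP[? ?] /andP[? ?] /andP[? ?].
by apply/andP; split; lra.
Qed.

Lemma tsq_pos x : 0 <= x -> tsq x = x ^+ 2.
Proof. by move=> h; rewrite /tsq max_l. Qed.
Lemma tsq_neg x : x <= 0 -> tsq x = 0.
Proof. by move=> h; rewrite /tsq max_r // expr0n. Qed.
Lemma dtsq_pos x : 0 <= x -> dtsq x = 2 * x.
Proof. by move=> h; rewrite /dtsq max_l. Qed.
Lemma dtsq_neg x : x <= 0 -> dtsq x = 0.
Proof. by move=> h; rewrite /dtsq max_r // mulr0. Qed.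

Lemma tsq2 x : tsq (2 * x) = 4 * tsq x.
Proof. by have [h|h] := leP 0 x; [rewrite !tsq_pos; lra|rewrite !tsq_neg; lra]. Qed.

Lemma dtsq2 x : dtsq (2 * x) = 2 * dtsq x.
Proof. by have [h|h] := leP 0 x; [rewrite !dtsq_pos; lra|rewrite !dtsq_neg; lra]. Qed.

Lemma bsp_out x : (x <= 0) || (3 <= x) -> bsp x = 0 /\ dbsp x = 0.
Proof.
rewrite /bsp /dbsp => /orP[h|h].
  by rewrite !tsq_neg ?dtsq_neg; try lra; split; lra.
by rewrite !tsq_pos ?dtsq_pos; try lra; split; lra.
Qed.

Lemma tsq_bound x : x <= 3 -> 0 <= tsq x <= 9 /\ 0 <= dtsq x <= 6.
Proof.
move=> h; have [h0|h0] := leP 0 x.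
  by rewrite tsq_pos // dtsq_pos //; split; apply/andP; split; nra.
by rewrite (tsq_neg (ltW h0)) (dtsq_neg (ltW h0)); split; apply/andP; split; lra.
Qed.

Lemma bsp_bound x : `|bsp x| <= 50 /\ `|dbsp x| <= 50.
Proof.
have [h|h] := leP x 3; last first.
  have hx : (x <= 0) || (3 <= x) by rewrite (ltW h) orbT.
  by have [-> ->] := bsp_out hx; rewrite normr0.
have [/andP[? ?] /andP[? ?]] := tsq_bound h.
have h1 : x - 1 <= 3 by lra.
have [/andP[? ?] /andP[? ?]] := tsq_bound h1.
have h2 : x - 2 <= 3 by lra.
have [/andP[? ?] /andP[? ?]] := tsq_bound h2.
have h3 : x - 3 <= 3 by lra.
have [/andP[? ?] /andP[? ?]] := tsq_bound h3.
by rewrite !ler_norml /bsp /dbsp; split; apply/andP; split; lra.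
Qed.

(** Refinement coefficients binom(3, k) / 4. *)
Definition bw (k : 'I_4) : R := nth 0 [:: 1/4; 3/4; 3/4; 1/4] k.

Lemma sum_I4 (V : nmodType) (F : 'I_4 -> V) :
  \sum_k F k = F (inord 0) + F (inord 1) + F (inord 2) + F (inord 3).
Proof.
rewrite !big_ord_recr big_ord0 /= add0r.
by congr (_ + _ + _ + _); congr F; apply/val_inj; rewrite /= inordK.
Qed.

(** Both sides are combinations of truncated squares, because tsq (2 x) = 4 tsq
    x. *)
Lemma bsp_refine4 u : bsp u = 1/4 * bsp (2 * u) + 3/4 * bsp (2 * u - 1) +
  3/4 * bsp (2 * u - 2) + 1/4 * bsp (2 * u - 3).
Proof.
have h a : tsq (2 * u - a) = 4 * tsq (u - a / 2).
  by rewrite -tsq2; congr tsq; lra.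
have H a b : tsq (2 * u - a - b) = 4 * tsq (u - (a + b) / 2).
  by rewrite -h; congr tsq; lra.
rewrite /bsp !H !h tsq2.
have e1 : u - (1 + 1) / 2 = u - 1 by lra.
have e2 : u - 2 / 2 = u - 1 by lra.
have e3 : u - (1 + 2) / 2 = u - 3 / 2 by lra.
have e4 : u - (2 + 1) / 2 = u - 3 / 2 by lra.
have e5 : u - (1 + 3) / 2 = u - 2 by lra.
have e6 : u - (2 + 2) / 2 = u - 2 by lra.
have e7 : u - (3 + 1) / 2 = u - 2 by lra.
have e8 : u - (2 + 3) / 2 = u - 5 / 2 by lra.
have e9 : u - (3 + 2) / 2 = u - 5 / 2 by lra.
have e10 : u - (3 + 3) / 2 = u - 3 by lra.
rewrite !(e1, e2, e3, e4, e5, e6, e7, e8, e9, e10); lra.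
Qed.

Lemma dbsp_refine4 u : dbsp u = 1/4 * (2 * dbsp (2 * u)) +
  3/4 * (2 * dbsp (2 * u - 1)) + 3/4 * (2 * dbsp (2 * u - 2)) +
  1/4 * (2 * dbsp (2 * u - 3)).
Proof.
have h a : dtsq (2 * u - a) = 2 * dtsq (u - a / 2).
  by rewrite -dtsq2; congr dtsq; lra.
have H a b : dtsq (2 * u - a - b) = 2 * dtsq (u - (a + b) / 2).
  by rewrite -h; congr dtsq; lra.
rewrite /dbsp !H !h dtsq2.
have e1 : u - (1 + 1) / 2 = u - 1 by lra.
have e2 : u - 2 / 2 = u - 1 by lra.
have e3 : u - (1 + 2) / 2 = u - 3 / 2 by lra.
have e4 : u - (2 + 1) / 2 = u - 3 / 2 by lra.
have e5 : u - (1 + 3) / 2 = u - 2 by lra.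
have e6 : u - (2 + 2) / 2 = u - 2 by lra.
have e7 : u - (3 + 1) / 2 = u - 2 by lra.
have e8 : u - (2 + 3) / 2 = u - 5 / 2 by lra.
have e9 : u - (3 + 2) / 2 = u - 5 / 2 by lra.
have e10 : u - (3 + 3) / 2 = u - 3 by lra.
rewrite !(e1, e2, e3, e4, e5, e6, e7, e8, e9, e10); lra.
Qed.

Lemma bsp_refine u : bsp u = \sum_k bw k * bsp (2 * u - k%:R).
Proof. by rewrite sum_I4 /bw !inordK //= subr0 bsp_refine4. Qed.

Lemma dbsp_refine u : dbsp u = \sum_k bw k * (2 * dbsp (2 * u - k%:R)).
Proof. by rewrite sum_I4 /bw !inordK //= subr0 dbsp_refine4. Qed.

Lemma bsp_partition u : 0 <= u <= 1 ->
  \sum_(k < 3) bsp (u + k%:R) = 1 /\ \sum_(k < 3) dbsp (u + k%:R) = 0.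
Proof.
move=> /andP[u0 u1]; rewrite !big_ord_recr !big_ord0 /= !add0r.
rewrite /bsp /dbsp !addr0.
have P a : - a <= u -> tsq (u + a) = (u + a) ^+ 2 by move=> ?; apply: tsq_pos; lra.
split.
  rewrite (@tsq_pos u) // (@tsq_pos (u + 1)) ?(@tsq_pos (u + 2)) //; try lra.
  rewrite (@tsq_pos (u + 1 - 1)) ?(@tsq_pos (u + 2 - 1)) ?(@tsq_pos (u + 2 - 2)) //; try lra.
  rewrite !tsq_neg; lra.
rewrite (@dtsq_pos u) // (@dtsq_pos (u + 1)) ?(@dtsq_pos (u + 2)) //; try lra.
rewrite (@dtsq_pos (u + 1 - 1)) ?(@dtsq_pos (u + 2 - 1)) ?(@dtsq_pos (u + 2 - 2)) //; try lra.
rewrite !dtsq_neg; lra.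
Qed.

End spline.

(** * Weak holomorphy *)

Section weak_holomorphy.
Variable R : realType.
Local Notation C := R[i].
Local Notation T2 := (measurableTypeR R * measurableTypeR R)%type.
Local Notation sigma := (@sigma_area R).
Local Notation disc := (@disc2 R : set T2).
Local Notation toC := (@to_complex R).
Implicit Types (f g th : C -> C).

Lemma C1D_Re : C1D (fun z : C => (complex.Re z)%:C) (fun=> 2^-1) (fun=> 2^-1).
Proof.
have -> : (fun z : C => (complex.Re z)%:C) = (fun z => (z + z^*) * 2^-1).
  by apply/funext => z; rewrite ReJ_add conjCE.
have := C1DM (C1DD (@C1D_id R) (C1DJ (@C1D_id R))) (C1D_cst (2^-1)).
by apply: C1D_ext => z _; rewrite ?rmorph1 ?rmorph0; ring.
Qed.

Lemma C1D_Im : C1D (fun z : C => (complex.Im z)%:C) (fun=> - 'i%C / 2) (fun=> 'i%C / 2).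
Proof.
have -> : (fun z : C => (complex.Im z)%:C) = (fun z => (z^* - z) * ('i%C / 2)).
  by apply/funext => z; rewrite ImJ_sub conjCE; ring.
have := C1DM (C1DB (C1DJ (@C1D_id R)) (@C1D_id R)) (C1D_cst ('i%C / 2)).
by apply: C1D_ext => z _; rewrite ?rmorph1 ?rmorph0; ring.
Qed.

Definition bs (c r t : R) := bsp ((t - c) / r).
Definition dbs (c r t : R) := dbsp ((t - c) / r) / r.

Lemma is_derive_bs (c r t : R) : r != 0 -> is_derive t 1 (bs c r) (dbs c r t).
Proof.
move=> r0; have [q [cq qx Hq]] := derive_car (is_derive_bsp ((t - c) / r)).
rewrite /dbs -qx.
apply: (@is_derive_car _ _ (fun t => q ((t - c) / r) / r)).
  by move=> u; rewrite /bs Hq; field.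
move/cvgrPdist_lt : cq => cq; apply/cvgrPdist_lt => e e0.
have r0' : 0 < `|r| by rewrite normr_gt0.
have /cq/nbhs_ballP[d /= d0 Hd] : 0 < e * `|r| by rewrite mulr_gt0.
apply/nbhs_ballP; exists (d * `|r|); first by rewrite /= mulr_gt0.
move=> u; rewrite /ball /= => h.
rewrite -mulrBl normrM normfV ltr_pdivrMr //; apply: Hd; rewrite /ball /=.
by rewrite -mulrBl normrM normfV ltr_pdivrMr // (_ : t - c - (u - c) = t - u) //; lra.
Qed.

Lemma cont_dbs (c r : R) : 0 < r -> continuous (dbs c r).
Proof.
move=> r0 t; apply/cvgrPdist_lt => e e0; apply/nbhs_ballP.
exists (e * r ^+ 2 / 8) => [|u]; first by rewrite /= !mulr_gt0 ?exprn_gt0 ?invr_gt0.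
rewrite /ball /= /dbs => h; rewrite -mulrBl normrM.
rewrite (gtr0_norm (x := r^-1)) ?invr_gt0 // ltr_pdivrMr //.
apply: (le_lt_trans (dbsp_lip _ _)).
rewrite -mulrBl normrM (gtr0_norm (x := r^-1)) ?invr_gt0 // mulrA ltr_pdivrMr //.
rewrite (_ : t - c - (u - c) = t - u); last by lra.
rewrite -mulrA -expr2; lra.
Qed.

Lemma bs_out (c r t : R) : 0 < r -> ~~ (c <= t <= c + 3 * r) -> bs c r t = 0 /\ dbs c r t = 0.
Proof.
move=> r0 h; have H : ((t - c) / r <= 0) || (3 <= (t - c) / r).
  move: h; rewrite negb_and -!ltNge => /orP[h|h]; apply/orP; [left|right].
    by rewrite ler_pdivrMr // mul0r; lra.
  by rewrite ler_pdivlMr //; lra.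
by rewrite /bs /dbs; have [-> ->] := bsp_out H; rewrite mul0r.
Qed.

(** Tensor product of splines, supported in the square with corner [(x, y)] and
    side [3 * r]; [bump_z] and [bump_b] are its Wirtinger derivatives. *)
Definition bump (x y r : R) (z : C) : C :=
  (bs x r (complex.Re z))%:C * (bs y r (complex.Im z))%:C.
Definition bump_b (x y r : R) (z : C) : C :=
  (dbs x r (complex.Re z))%:C * 2^-1 * (bs y r (complex.Im z))%:C
  + (bs x r (complex.Re z))%:C * ((dbs y r (complex.Im z))%:C * ('i%C / 2)).
Definition bump_z (x y r : R) (z : C) : C :=
  (dbs x r (complex.Re z))%:C * 2^-1 * (bs y r (complex.Im z))%:C
  + (bs x r (complex.Re z))%:C * ((dbs y r (complex.Im z))%:C * (- 'i%C / 2)).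

Lemma C1D_bump (x y r : R) : 0 < r -> C1D (bump x y r) (bump_z x y r) (bump_b x y r).
Proof.
move=> r0; have rn : r != 0 by rewrite gt_eqF.
apply: C1DM.
  apply: (C1D_real (r := @complex.Re R) C1D_Re) => z _; first exact: is_derive_bs.
  exact: cont_dbs.
apply: (C1D_real (r := @complex.Im R) C1D_Im) => z _; first exact: is_derive_bs.
exact: cont_dbs.
Qed.

Lemma bump_out (x y r : R) (z : C) : 0 < r -> ~ in_sq x y r z ->
  bump x y r z = 0 /\ bump_b x y r z = 0.
Proof.
move=> r0 h; rewrite /bump /bump_b.
have [hx|hx] := boolP (x <= complex.Re z <= x + 3 * r); last first.
  by have [-> ->] := bs_out r0 hx; rewrite !(mul0r, mulr0, addr0).
have [hy|hy] := boolP (y <= complex.Im z <= y + 3 * r); last first.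
  by have [-> ->] := bs_out r0 hy; rewrite !(mul0r, mulr0, addr0).
by case: h.
Qed.

Lemma bump_bound (x y r : R) (z : C) : 0 < r -> cabs (bump x y r z) <= 2500 /\
  cabs (bump_b x y r z) <= 2500 / r.
Proof.
move=> r0; have r0' : 0 < r^-1 by rewrite invr_gt0.
have [h1 h2] := bsp_bound ((complex.Re z - x) / r).
have [h3 h4] := bsp_bound ((complex.Im z - y) / r).
rewrite /bump /bump_b /bs /dbs.
move: (bsp ((complex.Re z - x) / r)) h1 => b1 h1.
move: (dbsp ((complex.Re z - x) / r)) h2 => b2 h2.
move: (bsp ((complex.Im z - y) / r)) h3 => b3 h3.
move: (dbsp ((complex.Im z - y) / r)) h4 => b4 h4; split.
  rewrite cabsM !cabsR (_ : 2500 = 50 * 50); last by lra.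
  by rewrite ler_pM.
have c2 : cabs (2^-1 : C) = 2^-1.
  by rewrite cabsV (_ : 2 = (2%:R)%:C) ?cabsR ?normr_nat // rmorph_nat.
apply: (le_trans (cabsD _ _)); rewrite !cabsM !cabsR !normrM cabsi c2 mul1r.
rewrite (gtr0_norm r0').
have E : forall a b : R, 0 <= a <= 50 -> 0 <= b <= 50 -> a / r * 2^-1 * b <= 1250 / r.
  move=> u v /andP[u0 u1] /andP[v0 v1].
  rewrite (_ : u / r * 2^-1 * v = u * v / 2 / r); last by field; rewrite gt_eqF.
  by rewrite ler_pM2r //; nra.
have := E _ _ (introT andP (conj (normr_ge0 _) h2)) (introT andP (conj (normr_ge0 _) h3)).
have := E _ _ (introT andP (conj (normr_ge0 _) h4)) (introT andP (conj (normr_ge0 _) h1)).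
lra.
Qed.

(** The constant is kept abstract: only the scaling in [r] matters. *)
Lemma bump_bounded : exists2 B : R, 0 < B & forall x y r z, 0 < r ->
  cabs (bump x y r z) <= B /\ cabs (bump_b x y r z) <= B / r.
Proof. by exists 2500 => [|x y r z]; [lra|exact: bump_bound]. Qed.

(** The two-scale relation of the spline in both variables; the weights sum to
    4. *)
Lemma bump_refine (x y r : R) (z : C) : 0 < r ->
  bump x y r z = \sum_k \sum_l (bw R k * bw R l)%:C *
     bump (x + k%:R * (r / 2)) (y + l%:R * (r / 2)) (r / 2) z /\
  bump_b x y r z = \sum_k \sum_l (bw R k * bw R l)%:C *
     bump_b (x + k%:R * (r / 2)) (y + l%:R * (r / 2)) (r / 2) z.
Proof.
move=> r0; have rn : r != 0 by rewrite gt_eqF.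
have H c t : bs c r t = \sum_k bw R k * bs (c + k%:R * (r / 2)) (r / 2) t.
  rewrite /bs bsp_refine; apply: eq_bigr => k _; congr (_ * bsp _).
  by field.
have H' c t : dbs c r t = \sum_k bw R k * dbs (c + k%:R * (r / 2)) (r / 2) t.
  rewrite /dbs dbsp_refine mulr_suml; apply: eq_bigr => k _.
  rewrite -mulrA; congr (_ * _).
  rewrite (_ : 2 * ((t - c) / r) - k%:R = (t - (c + k%:R * (r / 2))) / (r / 2)); first by field.
  by field.
have HC c t : (bs c r t)%:C = \sum_k (bw R k)%:C * (bs (c + k%:R * (r / 2)) (r / 2) t)%:C.
  by rewrite H rmorph_sum; apply: eq_bigr => k _; rewrite rmorphM.
have HC' c t : (dbs c r t)%:C = \sum_k (bw R k)%:C * (dbs (c + k%:R * (r / 2)) (r / 2) t)%:C.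
  by rewrite H' rmorph_sum; apply: eq_bigr => k _; rewrite rmorphM.
split.
  rewrite /bump !HC big_distrlr /=.
  by apply: eq_bigr => k _; apply: eq_bigr => l _; rewrite rmorphM /=; ring.
have E (a1 b1 c1 d1 k1 k2 : C) : a1 * k1 * b1 + c1 * (d1 * k2) = k1 * (a1 * b1) + k2 * (c1 * d1).
  by ring.
rewrite /bump_b E !HC !HC' !big_distrlr /= !mulr_sumr -big_split /=.
apply: eq_bigr => k _; rewrite !mulr_sumr -big_split /=; apply: eq_bigr => l _.
by rewrite rmorphM /=; ring.
Qed.

Lemma bump_partition (z : C) : unit_disc z ->
  \sum_(k < 3) \sum_(l < 3) bump (-1 - 2 * k%:R) (-1 - 2 * l%:R) 2 z = 1 /\
  \sum_(k < 3) \sum_(l < 3) bump_b (-1 - 2 * k%:R) (-1 - 2 * l%:R) 2 z = 0.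
Proof.
move=> /unit_discE zD.
have H (t : R) : `|t| <= cabs z -> \sum_(k < 3) bs (-1 - 2 * k%:R) 2 t = 1 /\
   \sum_(k < 3) dbs (-1 - 2 * k%:R) 2 t = 0.
  rewrite ler_norml => /andP[t1 t2].
  have u01 : 0 <= (t + 1) / 2 <= 1 by apply/andP; split; lra.
  have E (k : 'I_3) : (t - (-1 - 2 * k%:R)) / 2 = (t + 1) / 2 + k%:R by lra.
  have [h1 h2] := bsp_partition u01; split.
    by apply: etrans h1; apply: eq_bigr => k _; rewrite /bs E.
  apply: (@etrans _ _ ((\sum_(k < 3) dbsp ((t + 1) / 2 + k%:R)) * 2^-1)).
    by rewrite mulr_suml; apply: eq_bigr => k _; rewrite /dbs E.
  by rewrite h2 mul0r.
have [h1 h2] := H _ (normRe_cabs z); have [h3 h4] := H _ (normIm_cabs z).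
have h1' := congr1 (real_complex R) h1; rewrite rmorph_sum rmorph1 /= in h1'.
have h2' := congr1 (real_complex R) h2; rewrite rmorph_sum rmorph0 /= in h2'.
have h3' := congr1 (real_complex R) h3; rewrite rmorph_sum rmorph1 /= in h3'.
have h4' := congr1 (real_complex R) h4; rewrite rmorph_sum rmorph0 /= in h4'.
split; first by rewrite -big_distrlr /= h1' h3' mulr1.
rewrite /bump_b.
under eq_bigr do rewrite big_split /=.
rewrite big_split /= -!big_distrlr /=.
by rewrite -mulr_suml h2' -mulr_suml h4' !mul0r mulr0 addr0.
Qed.

(** Complex differentiability at each point of the disc. The derivative is not
    known to be continuous, so Green's formula does not apply to [g] directly.
    *)
Definition holo g := forall z, unit_disc z -> exists p, wirt g z p 0.

Lemma holo_cont g z : holo g -> unit_disc z -> ccont g z.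
Proof. by move=> H /H[p /wirt_cont]. Qed.

Lemma in_sq_setE (x y r : R) : [set w | in_sq x y r (toC w)] =
  `[x, x + 3 * r]%classic `*` `[y, y + 3 * r]%classic :> set T2.
Proof.
by apply/seteqP; split=> w; rewrite /in_sq /= !in_itv.
Qed.

Lemma fine_sigma_sq (x y r : R) : 0 < r ->
  fine (sigma (disc `&` [set w | in_sq x y r (toC w)])) <= 9 * r ^+ 2.
Proof.
move=> r0.
have mS : measurable (`[x, x + 3 * r]%classic `*` `[y, y + 3 * r]%classic : set T2).
  exact: measurableX.
have sE := in_sq_setE x y r.
have l1 (c : R) : lebesgue_measure (`[c, c + 3 * r]%classic : set R) = (3 * r)%:E.
  rewrite lebesgue_measure_itv /= lte_fin ifT; last by lra.
  by rewrite -EFinB; congr EFin; lra.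
have sV : sigma (`[x, x + 3 * r]%classic `*` `[y, y + 3 * r]%classic) = (pi^-1 * (9 * r ^+ 2))%:E.
  by rewrite sigmaE product_measure1E //= !l1 -!EFinM; congr (EFin (_ * _)); lra.
have le1 : (sigma (disc `&` [set w | in_sq x y r (toC w)]) <= (pi^-1 * (9 * r ^+ 2))%:E)%E.
  rewrite -sV; apply: le_measure.
  - by rewrite inE; apply: measurableI; [exact: measurable_disc2|rewrite sE].
  - by rewrite inE.
  - by rewrite sE; exact: subIsetr.
have le2 : pi^-1 * (9 * r ^+ 2) <= 9 * r ^+ 2.
  have pi1 : (pi : R)^-1 <= 1.
    by rewrite invf_le1 ?pi_gt0 //; have := pi_ge2 R; lra.
  by apply: ler_piMl => //; apply: mulr_ge0 => //; exact: sqr_ge0.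
apply: le_trans le2; rewrite -lee_fin fineK //.
by rewrite ge0_fin_numE //; apply: le_lt_trans le1 _; rewrite ltry.
Qed.

Lemma di_sq_bound f (x y r k : R) : 0 < r -> 0 <= k -> disc_integrable f ->
  (forall z, unit_disc z -> cabs (f z) <= k) ->
  (forall z, unit_disc z -> ~ in_sq x y r z -> f z = 0) ->
  cabs (disc_integral f) <= 18 * k * r ^+ 2.
Proof.
move=> r0 k0 hf fk f0.
pose G (z : C) : R := k * (if `[< in_sq x y r z >] then 1 else 0).
have mS : measurable ([set w | in_sq x y r (toC w)] : set T2).
  by rewrite in_sq_setE; exact: measurableX.
have GE : (fun w => G (toC w)) = (fun w => k * \1_[set w | in_sq x y r (toC w)] w).
  by apply/funext => w; rewrite /G indicE; case: asboolP => h;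
     [rewrite mem_set|rewrite memNset].
have iG0 : rint (fun z => if `[< in_sq x y r z >] then 1 else 0 : R).
  apply: (@rint_le _ _ (fun=> 1)); last exact: rint_cst.
    rewrite (_ : (fun w => _) = \1_[set w | in_sq x y r (toC w)]).
      exact: measurable_indic.
    by apply/funext => w; rewrite indicE; case: asboolP => h;
      [rewrite mem_set|rewrite memNset].
  by move=> z _; case: asboolP; rewrite ?normr0 ?normr1.
have iG : rint G by exact: rintZ.
apply: (le_trans (di_bound hf iG _)).
  move=> z zD; rewrite /G; case: asboolP => h; first by rewrite mulr1 fk.
  by rewrite f0 // cabs0 mulr0.
rewrite RintegralZl //; last exact: measurable_disc2.
suff : Rintegral sigma disc (fun w => if `[< in_sq x y r (toC w) >] then 1 else 0) <= 9 * r ^+ 2.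
  by move=> h; have := ler_wpM2l k0 h; lra.
rewrite (_ : (fun w => _) = \1_[set w | in_sq x y r (toC w)]); last first.
  by apply/funext => w; rewrite indicE; case: asboolP => h;
    [rewrite mem_set|rewrite memNset].
rewrite /Rintegral integral_indic //; last exact: measurable_disc2.
by rewrite setIC; exact: fine_sigma_sq.
Qed.

(** Goursat's argument in weak form. Localize [th] by bumps: L(x, y, r) is the
    pairing of [g] with the conjugate derivative of [th * bump]. By refinement,
    L on a square is a sum of L on its children with weights of sum 4, so a
    bound eta r^2 is inherited by the parent. Near a point [z0] the affine part
    of [g] contributes nothing by Green's formula, and the remainder o(r) meets
    a derivative of size 1 / r on an area of order r^2, which gives the bound
    for every small square. Hence L = 0 for all squares, and nine bumps form a
    partition of unity on the disc. *)
Lemma holo_test_b g th tz tb : holo g -> ctest th tz tb ->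
  disc_integral (fun z => g z * tb z) = 0.
Proof.
move=> hg Ht; have [H [rho /andP[rho0 rho1] Hr]] := Ht.
have cth z : unit_disc z -> ccont th z by move=> zD; exact: C1D_cont H zD.
have ctb z : unit_disc z -> ccont tb z by move=> /H[].
have zth z : unit_disc z -> rho < cabs z -> th z = 0 by move=> zD /(Hr z zD)[].
have ztb z : unit_disc z -> rho < cabs z -> tb z = 0 by move=> zD /(Hr z zD)[].
have [M1 M10 HM1] := bounded_test rho1 cth zth.
have [M2 M20 HM2] := bounded_test rho1 ctb ztb.
pose M := M1 + M2; have M0 : 0 < M by rewrite addr_gt0.
pose dT x y r z := tb z * bump x y r z + th z * bump_b x y r z.
have cdT x y r z : 0 < r -> unit_disc z -> ccont (dT x y r) z.
  move=> r0 zD; have cb := C1D_bump x y r0.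
  apply: ccontD; apply: ccontM; [exact: ctb|exact: C1D_cont cb zD|exact: cth|].
  by have [] := cb z zD.
have zdT x y r z : unit_disc z -> rho < cabs z -> dT x y r z = 0.
  by move=> zD rz; rewrite /dT zth // ztb // !mul0r addr0.
have i_dT f x y r : 0 < r -> (forall z, unit_disc z -> ccont f z) ->
    disc_integrable (fun z => f z * dT x y r z).
  move=> r0 cf; apply: (di_test rho1) => z zD.
    by apply: ccontM; [exact: cf|exact: cdT].
  by move=> rz; rewrite zdT // mulr0.
have cg z : unit_disc z -> ccont g z by exact: holo_cont.
pose L x y r := disc_integral (fun z => g z * dT x y r z).
have Lsmall eta : 0 < eta -> forall x y r, 0 < r -> cabs (L x y r) <= eta * r ^+ 2.
  move=> eta0; apply: quad_bisect.
    move=> x y r r0 Hc; have r20 : 0 < r / 2 by lra.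
    have -> : L x y r = \sum_k \sum_l (bw R k * bw R l)%:C *
        L (x + k%:R * (r / 2)) (y + l%:R * (r / 2)) (r / 2).
      rewrite /L -[RHS]/(\sum_k \sum_l _ * disc_integral _).
      under [in RHS]eq_bigr => k _ do under eq_bigr => l _ do
        rewrite -(diZ _ (i_dT g _ _ _ r20 cg)).
      rewrite exchange_big /= exchange_big /=.
      under [in RHS]eq_bigr => k _.
        rewrite -di_sum; last by move=> l _; apply: di_integrableZ; exact: i_dT.
        over.
      rewrite -di_sum; last first.
        move=> k _; apply: di_integrable_sum => l _.
        by apply: di_integrableZ; exact: i_dT.
      apply: eq_di => z zD; have [e1 e2] := bump_refine x y z r0.
      rewrite /dT e1 e2 !mulr_sumr -big_split /= mulr_sumr; apply: eq_bigr => k _.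
      rewrite !mulr_sumr -big_split /= mulr_sumr; apply: eq_bigr => l _; ring.
    apply: (le_trans (cabs_sum _ _ _)).
    apply: (@le_trans _ _ (\sum_k \sum_l (bw R k * bw R l) * (eta * (r / 2) ^+ 2))).
      have bw0 k : 0 <= bw R k.
        by rewrite /bw; case: k => -[|[|[|[|//]]]] /= _; lra.
      apply: ler_sum => k _; apply: (le_trans (cabs_sum _ _ _)).
      apply: ler_sum => l _; rewrite cabsM cabsR ger0_norm ?mulr_ge0 //.
      by rewrite ler_wpM2l ?mulr_ge0.
    have S : \sum_k bw R k = 2 by rewrite sum_I4 /bw !inordK //=; lra.
    under eq_bigr do rewrite -mulr_suml -mulr_sumr S.
    rewrite -!mulr_suml S; lra.
  move=> x0 y0; pose z0 := x0 +i* y0.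
  have [zr|zr] := leP (cabs z0) rho; last first.
    exists ((cabs z0 - rho) / 6) => [|x y r r0 rd hx hy]; first lra.
    rewrite /L (eq_di (g := fun=> 0)) ?di0 ?cabs0 ?mulr_ge0 ?sqr_ge0 ?ltW //.
    move=> z zD; rewrite /dT.
    have [zs|zs] := pselect (in_sq x y r z); last first.
      by have [-> ->] := bump_out r0 zs; rewrite !mulr0 addr0 mulr0.
    have rz : rho < cabs z.
      have := @in_sq_dist _ x y r z0 z (conj hx hy) zs.
      have := cabsD (z0 - z) z; rewrite subrK; lra.
    by rewrite zth // ztb // !mul0r addr0 mulr0.
  have z0D : unit_disc z0 by apply/unit_discE; lra.
  have [p [A [B [cA cB Ap B0 Hg]]]] := hg z0 z0D.
  have [N N0 HN] := bump_bounded.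
  have NM : 0 < N * M by rewrite mulr_gt0.
  have [e e0 eE] : exists2 e, 0 < e & 18 * (24 * (N * M) * e) = eta.
    exists (eta / (18 * 24 * (N * M))); last by field; rewrite !gt_eqF.
    by rewrite divr_gt0 // !mulr_gt0.
  have [d1 d10 Hd1] := cA e e0; have [d2 d20 Hd2] := cB e e0.
  exists (Num.min 1 (Num.min (d1 / 6) (d2 / 6))).
    by rewrite !lt_min ltr01 /=; apply/andP; split; lra.
  move=> x y r r0; rewrite !lt_min => /andP[r1 /andP[rd1 rd2]] hx hy.
  pose lin z := g z0 + p * (z - z0).
  have clin : C1D lin (fun=> p) (fun=> 0).
    have := C1DD (C1D_cst (g z0)) (C1DM (C1D_cst p) (C1DB (@C1D_id R) (C1D_cst z0))).
    by apply: C1D_ext => z _; ring.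
  have Llin : disc_integral (fun z => lin z * dT x y r z) = 0.
    have [_ <-] := ctest_int (ctestM (ctestM Ht (C1D_bump x y r0)) clin).
    by apply: eq_di => z _; rewrite /dT; ring.
  have clin' z : unit_disc z -> ccont lin z by move=> zD; exact: C1D_cont clin zD.
  pose F z := g z * dT x y r z - lin z * dT x y r z.
  have iF : disc_integrable F by apply: di_integrableB; exact: i_dT.
  have -> : L x y r = disc_integral F.
    by rewrite /F diB ?Llin ?subr0 //; exact: i_dT.
  have Fout z : unit_disc z -> ~ in_sq x y r z -> F z = 0.
    move=> zD zs; rewrite /F /dT; have [-> ->] := bump_out r0 zs.
    by rewrite !mulr0 addr0 !mulr0 subr0.
  have k0 : 0 <= 24 * (N * M) * e by rewrite !mulr_ge0 // ltW.
  have Fk z : unit_disc z -> cabs (F z) <= 24 * (N * M) * e.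
    move=> zD; have [zs|zs] := pselect (in_sq x y r z); last first.
      by rewrite Fout // cabs0.
    have dz := @in_sq_dist _ x y r z z0 zs (conj hx hy).
    have hA : cabs (A z - A z0) < e by apply: Hd1; lra.
    have hB : cabs (B z - B z0) < e by apply: Hd2; lra.
    have E : g z - lin z = (A z - A z0) * (z - z0) + (B z - B z0) * (z - z0)^*.
      rewrite /lin B0 Ap opprD addrA Hg; ring.
    have h1 : cabs (g z - lin z) <= 2 * e * (6 * r).
      rewrite E; apply: (le_trans (cabsD _ _)); rewrite !cabsM cabsJ.
      have a1 : cabs (A z - A z0) * cabs (z - z0) <= e * (6 * r).
        by rewrite ler_pM ?cabs_ge0 // ltW.
      have a2 : cabs (B z - B z0) * cabs (z - z0) <= e * (6 * r).
        by rewrite ler_pM ?cabs_ge0 // ltW.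
      lra.
    have h2 : cabs (dT x y r z) <= 2 * (N * M) / r.
      have [b1 b2] := HN x y r z r0.
      have Nr : N <= N / r by rewrite ler_pdivlMr // ler_piMr // ltW.
      apply: (le_trans (cabsD _ _)); rewrite (cabsM (tb z)) (cabsM (th z)).
      have a1 : cabs (tb z) * cabs (bump x y r z) <= M2 * (N / r).
        by rewrite ler_pM ?cabs_ge0 ?HM2 // (le_trans b1).
      have a2 : cabs (th z) * cabs (bump_b x y r z) <= M1 * (N / r).
        by rewrite ler_pM ?cabs_ge0 ?HM1.
      have Nr0 : 0 < N / r by rewrite divr_gt0.
      have m1 : 0 < M1 * (N / r) by rewrite mulr_gt0.
      have m2 : 0 < M2 * (N / r) by rewrite mulr_gt0.
      apply: (le_trans (lerD a1 a2)).
      have -> : 2 * (N * M) / r = 2 * (M1 * (N / r)) + 2 * (M2 * (N / r)).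
        by rewrite /M; field; rewrite gt_eqF.
      by lra.
    rewrite /F -mulrBl cabsM.
    apply: (le_trans (ler_pM (cabs_ge0 _) (cabs_ge0 _) h1 h2)).
    rewrite (_ : 2 * e * (6 * r) * (2 * (N * M) / r) = 24 * (N * M) * e) //.
    by field; rewrite gt_eqF.
  apply: (le_trans (di_sq_bound r0 k0 iF Fk Fout)).
  by rewrite eE.
have L0 x y r : 0 < r -> L x y r = 0.
  move=> r0; apply/eqP; rewrite -cabs_eq0; apply/eqP/le_anti.
  rewrite cabs_ge0 andbT; apply/ler_addgt0Pl => e e0; rewrite addr0.
  have e2 : 0 < e / r ^+ 2 by rewrite divr_gt0 // exprn_gt0.
  by apply: (le_trans (Lsmall _ e2 x y r r0)); rewrite divfK // expf_neq0 // gt_eqF.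
have two0 : 0 < 2 :> R by [].
have -> : disc_integral (fun z => g z * tb z) =
  \sum_(k < 3) \sum_(l < 3) L (-1 - 2 * k%:R) (-1 - 2 * l%:R) 2.
  rewrite /L; under [in RHS]eq_bigr => k _.
    rewrite -di_sum; last by move=> l _; exact: i_dT.
    over.
  rewrite -di_sum; last by move=> k _; apply: di_integrable_sum => l _; exact: i_dT.
  apply: eq_di => z zD; have [e1 e2] := bump_partition zD.
  have -> : g z * tb z = g z * (tb z *
    (\sum_(k < 3) \sum_(l < 3) bump (-1 - 2 * k%:R) (-1 - 2 * l%:R) 2 z) + th z *
    (\sum_(k < 3) \sum_(l < 3) bump_b (-1 - 2 * k%:R) (-1 - 2 * l%:R) 2 z)).
    by rewrite e1 e2 mulr1 mulr0 addr0.
  rewrite !mulr_sumr -big_split /= mulr_sumr; apply: eq_bigr => k _.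
  by rewrite !mulr_sumr -big_split /= mulr_sumr; apply: eq_bigr => l _; rewrite /dT.
by rewrite big1 // => k _; rewrite big1 // => l _; exact: L0.
Qed.

Lemma holo_test_z g th tz tb : holo g -> ctest th tz tb ->
  disc_integral (fun z => (g z)^* * tz z) = 0.
Proof.
move=> hg Ht; have Htj := ctestJ Ht; have := holo_test_b hg Htj.
have [H [rho /andP[rho0 rho1] Hr]] := Htj.
have ii : disc_integrable (fun z => g z * (tz z)^*).
  apply: (di_test rho1) => z zD; last by move=> /(Hr z zD)[_ _ ->]; rewrite mulr0.
  by apply: ccontM; [exact: holo_cont|have [] := H z zD].
move=> /(congr1 (fun z => z^*)); rewrite -diJ // rmorph0 => <-.
by apply: eq_di => z zD; rewrite rmorphM /= conjCK.
Qed.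

End weak_holomorphy.

(** * Area of the disc *)

Section disc_area.
Variable R : realType.
Local Notation C := R[i].
Local Notation T2 := (measurableTypeR R * measurableTypeR R)%type.
Local Notation leb := (@lebesgue_measure R).
Local Notation sigma := (@sigma_area R).
Local Notation disc := (@disc2 R : set T2).

Lemma disc_xsection (x : R) : `|x| <= 1 ->
  leb (xsection disc x) = (2 * Num.sqrt (1 - x ^+ 2))%:E.
Proof.
move=> x1; have x2 : x ^+ 2 <= 1 by rewrite -(real_normK (num_real x)) expr_le1.
set q := Num.sqrt _; have q0 : 0 <= q by exact: sqrtr_ge0.
have q2 : q ^+ 2 = 1 - x ^+ 2 by rewrite sqr_sqrtr // subr_ge0.
have -> : xsection disc x = `]- q, q[%classic.
  apply/seteqP; split=> y; rewrite /xsection /= in_itv /= -ltr_norml ?inE.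
    move=> /unit_discE h; rewrite -(@ltr_pXn2r _ 2) ?nnegrE // q2.
    rewrite (real_normK (num_real y)).
    have : cabs (to_complex (x, y)) ^+ 2 < 1 by rewrite expr_lt1 ?cabs_ge0.
    by rewrite cabs_sqr /=; lra.
  move=> h; apply/unit_discE.
  rewrite -(@expr_lt1 _ 2) ?cabs_ge0 // cabs_sqr /=.
  have : `|y| ^+ 2 < q ^+ 2 by rewrite ltr_pXn2r ?nnegrE.
  by rewrite q2 (real_normK (num_real y)); lra.
rewrite lebesgue_measure_itv /= lte_fin; case: ifPn => h.
  by rewrite -EFinB; congr EFin; lra.
by congr EFin; move: h; rewrite -leNgt; lra.
Qed.

Lemma disc_xsection0 (x : R) : 1 < `|x| -> leb (xsection disc x) = 0%E.
Proof.
move=> x1; rewrite (_ : xsection disc x = set0) ?measure0 //.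
apply/seteqP; split=> // y; rewrite /xsection /= inE => /unit_discE h.
by have := normRe_cabs (to_complex (x, y)); rewrite /=; lra.
Qed.

(** Substitute x = sin t; a primitive of 2 (cos t)^2 is t + sin t cos t. *)
Lemma integral_semicircle :
  (\int[leb]_(x in `[(-1)%R, 1%R]) (2 * Num.sqrt (1 - x ^+ 2))%:E = (pi : R)%:E)%E.
Proof.
have p0 := pi_gt0 R.
have E1 : sin (- (pi / 2)) = -1 :> R by rewrite sinN sin_pihalf.
have E2 : sin (pi / 2) = 1 :> R by exact: sin_pihalf.
rewrite -[X in `[X, _]]E1 -[X in `[_, X]]E2.
rewrite (@integration_by_substitution_increasing _ sin
   (fun x => 2 * Num.sqrt (1 - x ^+ 2)) (- (pi / 2)) (pi / 2)); last 7 first.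
- by lra.
- by move=> x y xi yi xy; rewrite ltr_sin.
- move=> x _; rewrite (_ : derive1 (@sin R) = cos); first exact: continuous_cos.
  by apply/funext => t; rewrite derive1E; apply: derive_val.
- rewrite (_ : derive1 (@sin R) = cos); last by apply/funext => t; rewrite derive1E; apply: derive_val.
  by apply/cvg_ex; exists (cos (- (pi / 2))); apply: cvg_at_right_filter; exact: continuous_cos.
- rewrite (_ : derive1 (@sin R) = cos); last by apply/funext => t; rewrite derive1E; apply: derive_val.
  by apply/cvg_ex; exists (cos (pi / 2)); apply: cvg_at_left_filter; exact: continuous_cos.
- split.
  + by move=> x _; have [] := is_derive_sin x.
  + by apply: cvg_at_right_filter; exact: continuous_sin.
  + by apply: cvg_at_left_filter; exact: continuous_sin.
- apply: continuous_subspaceT => x.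
  apply: (@continuousM R _ (fun=> 2) (fun x : R => Num.sqrt (1 - x ^+ 2))).
    exact: cvg_cst.
  apply: (@continuous_comp _ _ _ (fun x : R => 1 - x ^+ 2)); last exact: sqrt_continuous.
  apply: (@cvgB _ R^o _ _ _ (fun=> 1) (fun x : R => x ^+ 2)); first exact: cvg_cst.
  exact: exprn_continuous.
transitivity (\int[leb]_(x in `[(- (pi / 2))%R, (pi / 2)%R]) (2 * cos x ^+ 2)%:E)%E.
  apply: eq_integral => x; rewrite inE /= in_itv /= => /andP[h1 h2].
  have -> : derive1 (@sin R) = cos.
    by apply/funext => t; rewrite derive1E; apply: derive_val.
  congr EFin; change (2 * Num.sqrt (1 - sin x ^+ 2) * cos x = 2 * cos x ^+ 2).
  rewrite -cos2sin2 sqrtr_sqr ger0_norm.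
    by rewrite expr2 mulrA.
  by apply: cos_ge0_pihalf; apply/andP.
rewrite (@continuous_FTC2 _ _ (fun x => x + sin x * cos x)); last 4 first.
- by lra.
- apply: continuous_subspaceT => x.
  apply: (@continuousM R _ (fun=> 2) (fun x : R => cos x ^+ 2)); first exact: cvg_cst.
  apply: (@continuous_comp _ _ _ (@cos R) (fun x => x ^+ 2)); first exact: continuous_cos.
  exact: exprn_continuous.
- have D (x : R) : is_derive x 1 (fun x : R => x + sin x * cos x) (2 * cos x ^+ 2).
    apply: is_derive_eq; rewrite /GRing.scale /=.
    have := cos2Dsin2 x; lra.
  have cD (x : R) : {for x, continuous (fun x : R => x + sin x * cos x)}.
    by apply/differentiable_continuous/derivable1_diffP; have [] := D x.
  split.
  + by move=> x _; have [] := D x.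
  + exact: cvg_at_right_filter (cD _).
  + exact: cvg_at_left_filter (cD _).
- move=> x _; rewrite derive1E; apply: derive_val.
  apply: is_derive_eq; rewrite /GRing.scale /=.
  have := cos2Dsin2 x; lra.
rewrite sinN cosN cos_pihalf -EFinB; congr EFin; lra.
Qed.

Lemma sigma_disc : sigma disc = 1%E.
Proof.
have -> : sigma disc = ((pi : R)^-1%:E * \int[leb]_x leb (xsection disc x))%E by [].
have -> : (\int[leb]_x leb (xsection disc x) = (pi : R)%:E)%E.
  rewrite -integral_semicircle [RHS]integral_mkcond; apply: eq_integral => x _.
  rewrite patchE; case: ifPn; rewrite ?inE /=.
    by rewrite in_itv /= -ler_norml => h; rewrite disc_xsection.
  rewrite notin_setE /= in_itv /= -ler_norml => /negP.
  by rewrite -ltNge => h; rewrite disc_xsection0.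
by rewrite -EFinM mulVf // gt_eqF // pi_gt0.
Qed.

(** The total mass is what turns the residue of a simple pole into 1 in
    [point_mass_limit]. *)
Lemma disc_integral1 : disc_integral (fun=> 1 : C) = 1.
Proof.
apply/eqP; rewrite eq_complex /= /Rintegral integral_cst; last exact: measurable_disc2.
by rewrite sigma_disc mul1e integral0 /= !eqxx.
Qed.

End disc_area.

(** * Blaschke factors and powers of the distance *)

Section blaschke_basic.
Variable R : realType.
Local Notation C := R[i].
Local Notation T2 := (measurableTypeR R * measurableTypeR R)%type.
Local Notation sigma := (@sigma_area R).
Local Notation disc := (@disc2 R : set T2).
Local Notation toC := (@to_complex R).
Local Notation phi := (@blaschke_factor R).
Implicit Types (a z : C).

Lemma phiE a z : phi a z = (z - a) / (1 - a^* * z).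
Proof. by []. Qed.

Lemma blaschke_den_ge a z : unit_disc z -> 1 - cabs a <= cabs (1 - a^* * z).
Proof.
move=> /unit_discE zD; have := cabsD (1 - a^* * z) (a^* * z).
rewrite subrK cabs1 cabsM cabsJ => h.
have : cabs a * cabs z <= cabs a by rewrite ler_piMr ?cabs_ge0 // ltW.
lra.
Qed.

Lemma blaschke_den_le a z : unit_disc a -> unit_disc z -> cabs (1 - a^* * z) <= 2.
Proof.
move=> /unit_discE aD /unit_discE zD; apply: (le_trans (cabsB _ _)).
rewrite cabs1 cabsM cabsJ; have := cabs_ge0 a; have := cabs_ge0 z; nra.
Qed.

Lemma blaschke_den_neq0 a z : unit_disc a -> unit_disc z -> 1 - a^* * z != 0.
Proof.
move=> /unit_discE aD /(blaschke_den_ge a) h.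
by rewrite -cabs_gt0; lra.
Qed.

(** The invariant identity which makes a Blaschke factor unimodular on the
    circle, to first order in the distance. *)
Lemma one_sub_phi2 a z : unit_disc a -> unit_disc z ->
  1 - cabs (phi a z) ^+ 2 =
  (1 - cabs a ^+ 2) * (1 - cabs z ^+ 2) / cabs (1 - a^* * z) ^+ 2.
Proof.
move=> aD zD; have d0 := blaschke_den_neq0 aD zD.
have d0' : cabs (1 - a^* * z) ^+ 2 != 0 by rewrite expf_neq0 // cabs_eq0.
rewrite phiE cabsM cabsV; apply: (mulIf d0'); rewrite divfK //.
rewrite mulrBl mul1r exprMn exprVn divfK //.
apply: complexI; rewrite rmorphM !rmorphB /= rmorph1 !cabs_sqrC.
by rewrite !rmorphB rmorphM rmorph1 /= conjCK; ring.
Qed.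

Lemma phi_lt1 a z : unit_disc a -> unit_disc z -> cabs (phi a z) < 1.
Proof.
move=> aD zD; have d0 := blaschke_den_neq0 aD zD.
rewrite -(@expr_lt1 _ 2) ?cabs_ge0 // -subr_gt0 one_sub_phi2 //.
move/unit_discE : aD => aD; move/unit_discE: zD => zD.
rewrite divr_gt0 ?exprn_gt0 ?cabs_gt0 // mulr_gt0 // subr_gt0 expr_lt1 ?cabs_ge0 //.
Qed.

Lemma phi_ge a z : unit_disc a -> unit_disc z -> cabs (z - a) / 2 <= cabs (phi a z).
Proof.
move=> aD zD; rewrite phiE cabsM cabsV ler_wpM2l ?cabs_ge0 // lef_pV2 ?posrE //.
  exact: blaschke_den_le.
by rewrite cabs_gt0 blaschke_den_neq0.
Qed.

Lemma phi_neq0 a z : unit_disc a -> unit_disc z -> z != a -> phi a z != 0.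
Proof.
move=> aD zD za; rewrite phiE mulf_neq0 ?subr_eq0 // invr_eq0.
exact: blaschke_den_neq0.
Qed.

Lemma powR_anti (q x y : R) : q <= 0 -> 0 < x -> x <= y -> y `^ q <= x `^ q.
Proof.
move=> q0 x0 xy; rewrite -[q]opprK !(powRN _ (- q)) lef_pV2 ?posrE ?powR_gt0 //; last lra.
by apply: ge0_ler_powR; rewrite ?nnegrE; lra.
Qed.

Lemma powR_ge1 (q x : R) : q <= 0 -> 0 < x -> x <= 1 -> 1 <= x `^ q.
Proof.
move=> q0 x0 x1; have := powR_anti q0 x0 x1.
by rewrite powR1.
Qed.

Lemma measurable_cont_real (u : C -> R) (s : seq C) :
  (forall z, unit_disc z -> z \notin s -> ccont (fun z => (u z)%:C) z) ->
  measurable_fun disc (fun w => u (toC w)).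
Proof.
move=> H; apply: (@measurable_real_off _ s) => z zD zs e e0.
have [d d0 Hd] := H z zD zs e e0; exists d => // y /Hd.
by rewrite -rmorphB /= cabsR.
Qed.

Lemma geom_sum_le (t : R) n : 0 <= t -> t < 1 -> \sum_(0 <= k < n) t ^+ k <= (1 - t)^-1.
Proof.
move=> t0 t1; have d0 : 0 < 1 - t by lra.
rewrite -(@ler_pM2l _ (1 - t)) // mulfV ?gt_eqF // big_mkord.
have -> : (1 - t) * \sum_(i < n) t ^+ i = 1 - t ^+ n.
  by rewrite -[1 - t]opprB mulNr -subrX1 opprB.
by rewrite lerBlDr lerDl exprn_ge0.
Qed.

Lemma derivable_powR_pos (p x : R) : 0 < x ->
  is_derive x 1 (fun y => y `^ p) (p * x `^ (p - 1)).
Proof.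
move=> x0; have xi : x \in `]0, +oo[ by rewrite in_itv /= x0.
apply: DeriveDef; first exact: derivable_powR.
by rewrite -derive1E powR_derive1.
Qed.

Lemma cont_powR_pos (p x : R) : 0 < x -> {for x, continuous (fun y => y `^ p)}.
Proof.
move=> x0; apply/differentiable_continuous/derivable1_diffP.
by have [] := derivable_powR_pos p x0.
Qed.

Lemma ccont_cabs (f : C -> C) z : ccont f z -> ccont (fun z => (cabs (f z))%:C) z.
Proof.
move=> cf e /cf[d d0 H]; exists d => // y /H; apply: le_lt_trans.
by rewrite -rmorphB /= cabsR cabs_dist.
Qed.

(** Dyadic decomposition around [a]: on the shell between radii [rho k.+1] and
    [rho k] the function is at most [rho k.+1 `^ q], and the shell lies in a
    square of area of order [rho k ^+ 2], so the integral is dominated by a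
    geometric series of ratio [2^-1 `^ (q + 2)], less than 1 since -2 < q. *)
Lemma rint_powR_dist a (q : R) : unit_disc a -> -2 < q -> q <= 0 ->
  rint (fun z => cabs (z - a) `^ q).
Proof.
move=> /unit_discE aD q2 q0.
pose rho (k : nat) : R := 2 * (2^-1) ^+ k.
have rho0 k : 0 < rho k by rewrite mulr_gt0 // exprn_gt0.
have rhoS k : rho k = 2 * rho k.+1 by rewrite /rho exprS; field.
pose S k : set C := in_sq (complex.Re a - rho k) (complex.Im a - rho k) (2 * rho k / 3).
have inS k z : cabs (z - a) <= rho k -> S k z.
  move=> h; have := le_trans (normRe_cabs _) h; have := le_trans (normIm_cabs _) h.
  rewrite !ReD !ReN !ImD !ImN !ler_norml => /andP[? ?] /andP[? ?].
  by split; apply/andP; split; lra.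
pose c k := rho k.+1 `^ q.
pose F k (w : T2) : \bar R := (c k * \1_[set w | S k (toC w)] w)%:E.
have mS k : measurable ([set w | S k (toC w)] : set T2).
  by rewrite /S in_sq_setE; exact: measurableX.
have F0 k w : (0 <= F k w)%E by rewrite lee_fin mulr_ge0 ?powR_ge0 // indicE.
have mF k : measurable_fun disc (F k).
  by apply/measurable_EFinP; apply: measurable_funM; [exact: measurable_cst|exact: measurable_indic].
have IF k : (\int[sigma]_(w in disc) F k w <= (16 * (2^-1 `^ (q + 2)) ^+ k)%:E)%E.
  have m1 : measurable_fun disc (fun w => (\1_[set w | S k (toC w)] w : R)%:E).
    by apply/measurable_EFinP; exact: measurable_indic.
  have -> : (\int[sigma]_(w in disc) F k w =
      (c k)%:E * \int[sigma]_(w in disc) (\1_[set w | S k (toC w)] w : R)%:E)%E.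
    have h0 (w : T2) : disc w -> (0 <= (\1_[set w | S k (toC w)] w : R)%:E)%E.
      by move=> _; rewrite lee_fin indicE.
    by rewrite -(ge0_integralZl_EFin sigma measurable_disc2 h0 m1) ?powR_ge0.
  rewrite integral_indic //; last exact: measurable_disc2.
  have r0 : 0 < 2 * rho k / 3 by have := rho0 k; lra.
  have := fine_sigma_sq (complex.Re a - rho k) (complex.Im a - rho k) r0.
  rewrite setIC -lee_fin fineK => [h|]; last first.
    rewrite ge0_fin_numE //; apply: le_lt_trans (sigma_disc_lty R).
    apply: le_measure; rewrite ?inE; [|exact: measurable_disc2|exact: subIsetr].
    by apply: measurableI; [exact: mS|exact: measurable_disc2].
  apply: (@le_trans _ _ ((c k)%:E * (9 * (2 * rho k / 3) ^+ 2)%:E)%E).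
    by apply: lee_wpmul2l => //; rewrite lee_fin powR_ge0.
  rewrite -EFinM lee_fin /c.
  have E1 : (2^-1 : R) `^ (q + 2) ^+ k = rho k.+1 `^ q * rho k.+1 ^+ 2.
    have -> : rho k.+1 = 2^-1 ^+ k by rewrite /rho exprS mulrA divff ?mul1r.
    have h2 : 0 <= 2^-1 :> R by rewrite invr_ge0.
    have x0 : 0 < (2^-1 : R) ^+ k by rewrite exprn_gt0.
    rewrite -(powR_mulrn 2 (ltW x0)) -powRD ?(gt_eqF x0) ?implybT //.
    rewrite -(powR_mulrn k (powR_ge0 _ _)) -(powR_mulrn k h2) -!powRrM.
    by rewrite mulrC.
  rewrite E1 (rhoS k) le_eqVlt; apply/orP; left; apply/eqP; by field.
have Gsum : (\int[sigma]_(w in disc) \sum_(k <oo) F k w < +oo)%E.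
  rewrite integral_nneseries //; last exact: measurable_disc2.
  pose t : R := 2^-1 `^ (q + 2).
  have t0 : 0 < t by rewrite powR_gt0.
  have t1 : t < 1.
    rewrite /t -[2^-1]invrK invrK -powR_inv1 // -powRrM.
    have -> : -1 * (q + 2) = - (q + 2) by ring.
    rewrite powRN invf_lt1 ?powR_gt0 //.
    have := @gt0_ltr_powR R (q + 2) _ 1 2; rewrite powR1; apply; rewrite ?nnegrE; lra.
  apply: (@le_lt_trans _ _ (16 * (1 - t)^-1)%:E); last by rewrite ltry.
  apply: lime_le.
    by apply: is_cvg_nneseries => j _ _; apply: integral_ge0 => w _.
  apply: nearW => n; apply: (@le_trans _ _ (\sum_(0 <= k < n) (16 * t ^+ k)%:E)%E).
    by apply: lee_sum => j _; exact: IF.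
  rewrite sumEFin lee_fin -mulr_sumr ler_pM2l //.
  by apply: geom_sum_le => //; exact: ltW.
have mG : measurable_fun disc (fun w => cabs (toC w - a) `^ q).
  apply: (@measurable_cont_real (fun z => cabs (z - a) `^ q) [:: a]) => z zD.
  rewrite inE => za.
  apply: (@ccont_real _ (fun z => (cabs (z - a))%:C) (fun y => y `^ q)).
    by apply: ccont_cabs; apply: ccontB; [exact: ccont_id|exact: ccont_cst].
  by apply: cont_powR_pos; rewrite /= cabs_gt0 subr_eq0.
apply/integrableP; split; first exact/measurable_EFinP.
apply: le_lt_trans Gsum; apply: ge0_le_integral => //.
- exact: measurable_disc2.
- by apply: measurableT_comp => //; exact/measurable_EFinP.
- by apply: (@ge0_emeasurable_sum _ _ _ disc F xpredT); [move=> k w _ _; exact: F0|move=> k _; exact: mF].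
move=> w dw; rewrite abse_EFin ger0_norm ?powR_ge0 //.
have Fk k : S k (toC w) -> ((c k)%:E <= \sum_(k <oo) F k w)%E.
  move=> h; rewrite (@nneseriesD1 _ _ k xpredT) //.
  have -> : F k w = (c k)%:E by rewrite /F indicE mem_set // mulr1.
  rewrite leeDl //.
  by apply: nneseries_ge0 => j _ _; exact: F0.
have [wa|wa] := eqVneq (toC w) a.
  apply: le_trans (Fk 0%N _); last by apply: inS; rewrite wa subrr cabs0 ltW.
  rewrite lee_fin wa subrr cabs0 /c /rho expr1 divff // powR1.
  have [->|qn] := eqVneq q 0; first by rewrite powRr0.
  by rewrite powR0.
have d0 : 0 < cabs (toC w - a) by rewrite cabs_gt0 subr_eq0.
have d2 : cabs (toC w - a) <= rho 0%N.
  rewrite /rho expr0 mulr1; apply: (le_trans (cabsB _ _)).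
  by move/unit_discE : dw; lra.
have [k hk] : exists k, rho k < cabs (toC w - a).
  have e0 : 0 < cabs (toC w - a) / 2 by lra.
  have [n _ /(_ n (leqnn n)) hn] := near_infty_natSinv_lt (PosNum e0).
  exists n; rewrite /rho -ltr_pdivlMl // mulrC; apply: le_lt_trans hn.
  rewrite exprVn lef_pV2 ?posrE ?exprn_gt0 // -natrX ler_nat.
  exact: ltn_expl.
pose P := fun k => rho k < cabs (toC w - a).
have exP : exists k, P k by exists k.
case: (ex_minnP exP) => -[|m] Pm mmin.
  by move: Pm; rewrite /P ltNge d2.
apply: le_trans (Fk m _); last first.
  by apply: inS; rewrite leNgt; apply/negP => /mmin; rewrite ltnn.
by rewrite lee_fin /c; apply: powR_anti => //; exact: ltW.
Qed.

End blaschke_basic.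

(** * The weight and its regularization *)

Section weight.
Variable R : realType.
Local Notation C := R[i].
Local Notation phi := (@blaschke_factor R).
Variables (s : nat) (a : 'I_s -> C) (p : 'I_s -> R).
Hypothesis a_disc : forall k, unit_disc (a k).
Hypothesis a_inj : injective a.
Hypothesis p_gt : forall k, -2 < p k.

Lemma common_exponent : exists q : R, [/\ -2 < q, q <= 0 & forall k, q <= p k].
Proof.
exists (\big[Num.min/0]_k p k); split.
- by elim/big_ind: _ => [|x y hx hy|k _]; [lra|rewrite lt_min hx|exact: p_gt].
- by exact: bigmin_le_id.
- by move=> k; exact: bigmin_le.
Qed.

(** The points are uniformly separated, so at most one factor of the weight is
    singular near any point. *)
Lemma separation : exists d : R, [/\ 0 < d, d <= 1 &
  forall i j, i != j -> 2 * d <= cabs (a i - a j)].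
Proof.
exists (\big[Num.min/1]_(ij : 'I_s * 'I_s | ij.1 != ij.2) (cabs (a ij.1 - a ij.2) / 2)).
split.
- elim/big_ind: _ => [|x y hx hy|ij ne]; [exact: ltr01|by rewrite lt_min hx|].
  by rewrite divr_gt0 // cabs_gt0 subr_eq0; apply: contra ne => /eqP/a_inj ->.
- exact: bigmin_le_id.
- move=> i j ij; rewrite mulrC -ler_pdivlMr //.
  exact: (@bigmin_le_cond _ _ _ _ (i, j)).
Qed.

Lemma notin_codom z : z \notin codom a -> forall k, z != a k.
Proof. by move=> h k; apply: contra h => /eqP ->; exact: codom_f. Qed.

(** With [q <= 0] and [q] at most every [p k], this dominates the weight itself
    and, up to a constant, all its regularizations. *)
Definition negweight (q : R) (z : C) : R := \prod_k cabs (phi (a k) z) `^ q.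

Lemma phi_gt0 k z : unit_disc z -> z != a k -> 0 < cabs (phi (a k) z).
Proof. by move=> zD zk; rewrite cabs_gt0 phi_neq0. Qed.

Lemma phi_le1 k z : unit_disc z -> cabs (phi (a k) z) <= 1.
Proof. by move=> zD; rewrite ltW // phi_lt1. Qed.

Lemma ccont_phi k z : unit_disc z -> ccont (phi (a k)) z.
Proof.
move=> zD; have c1 : ccont (fun z => 1 - (a k)^* * z) z.
  by apply: ccontB; [exact: ccont_cst|apply: ccontM; [exact: ccont_cst|exact: ccont_id]].
apply: ccontM; first by apply: ccontB; [exact: ccont_id|exact: ccont_cst].
by apply: ccontV => //; exact: blaschke_den_neq0.
Qed.

Lemma ccont_phi_pow k (q : R) z : unit_disc z -> z != a k ->
  ccont (fun z => (cabs (phi (a k) z) `^ q)%:C) z.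
Proof.
move=> zD zk.
apply: (@ccont_real _ (fun z => (cabs (phi (a k) z))%:C) (fun y => y `^ q)).
  by apply: ccont_cabs; exact: ccont_phi.
by apply: cont_powR_pos; rewrite /= phi_gt0.
Qed.

Lemma ccont_weight_gen (u : 'I_s -> R) z : unit_disc z -> z \notin codom a ->
  ccont (fun z => (\prod_k cabs (phi (a k) z) `^ u k)%:C) z.
Proof.
move=> zD /notin_codom za.
have -> : (fun z => (\prod_k cabs (phi (a k) z) `^ u k)%:C) =
    (fun z => \prod_k (cabs (phi (a k) z) `^ u k)%:C).
  by apply/funext => y; rewrite rmorph_prod.
by apply: ccont_prod => k _; exact: ccont_phi_pow.
Qed.

Lemma negweight_ge0 q z : 0 <= negweight q z.
Proof. by apply: prodr_ge0 => k _; exact: powR_ge0. Qed.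

(** Within distance [d] of [a k] only the factor of index [k] is large, all the
    others being bounded by [A]; so the product is bounded by a constant times
    [1 + \sum_k cabs (z - a k) `^ q]. *)
Lemma rint_negweight q : -2 < q -> q <= 0 -> rint (negweight q).
Proof.
move=> q2 q0; have [d [d0 d1 Hd]] := separation.
pose A : R := (d / 2) `^ q.
have d20 : 0 < d / 2 by lra.
have A1 : 1 <= A by apply: powR_ge1 => //; lra.
pose G z := A ^+ s * (1 + \sum_k cabs (z - a k) `^ q).
apply: (@rint_le_off _ (codom a) _ G).
- apply: (@measurable_cont_real _ _ (codom a)) => z zD za.
  exact: (ccont_weight_gen (fun=> q)).
- move=> z zD /notin_codom za; rewrite ger0_norm ?negweight_ge0 // /G /negweight.
  have far k : d <= cabs (z - a k) -> cabs (phi (a k) z) `^ q <= A.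
    move=> h; apply: powR_anti => //; apply: le_trans (phi_ge (a_disc k) zD); lra.
  have near k : cabs (phi (a k) z) `^ q <= A * cabs (z - a k) `^ q.
    have c0 : 0 < cabs (z - a k) by rewrite cabs_gt0 subr_eq0.
    apply: (@le_trans _ _ ((cabs (z - a k) / 2) `^ q)).
      by apply: powR_anti => //; [rewrite divr_gt0|exact: phi_ge].
    rewrite mulrC powRM // ?invr_ge0 //; last exact: ltW.
    by rewrite ler_wpM2r ?powR_ge0 //; apply: powR_anti => //; lra.
  have sum0 (P : pred 'I_s) : 0 <= \sum_(k | P k) cabs (z - a k) `^ q.
    by apply: sumr_ge0 => k _; exact: powR_ge0.
  have As (n : nat) : 0 <= A ^+ n by rewrite exprn_ge0 // (le_trans _ A1).
  have [k hk|hall] := pickP (fun k => cabs (z - a k) < d); last first.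
    apply: (@le_trans _ _ (\prod_(k < s) A)).
      apply: ler_prod => k _; rewrite powR_ge0 /=; apply: far.
      by rewrite leNgt hall.
    by rewrite prodr_const card_ord ler_peMr // lerDl sum0.
  have s0 : (0 < s)%N by case: (s) k {hk} => [[]|].
  rewrite (bigD1 k) //=.
  have P1 : \prod_(i < s | i != k) cabs (phi (a i) z) `^ q <= A ^+ s.-1.
    apply: (@le_trans _ _ (\prod_(i < s | i != k) A)).
      apply: ler_prod => i ik; rewrite powR_ge0 /=; apply: far.
      have h1 := Hd _ _ ik; have h2 := cabsD (a i - z) (z - a k).
      rewrite addrA subrK (cabs_distC (a i)) in h2; lra.
    rewrite prodr_const; have -> : #|[pred i : 'I_s | i != k]| = s.-1.
      have := cardC1 k; rewrite card_ord => <-.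
      by apply: eq_card => i; rewrite !inE.
    by [].
  apply: (le_trans (ler_pM (powR_ge0 _ _) _ (near k) P1)).
    by apply: prodr_ge0 => i _; exact: powR_ge0.
  rewrite mulrAC -exprS prednK // ler_wpM2l //.
  rewrite (bigD1 k) //= addrCA lerDl; have := sum0 (fun i => i != k); lra.
- apply: rintZ; apply: rintD; first exact: rint_cst.
  apply: rint_sum => k _; exact: rint_powR_dist.
Qed.

Local Notation h := (blaschke_weight a p).

Lemma weight_le_neg q z : q <= 0 -> (forall k, q <= p k) -> unit_disc z ->
  z \notin codom a -> 0 <= h z <= negweight q z.
Proof.
move=> q0 qp zD /notin_codom za; apply/andP; split.
  by apply: prodr_ge0 => k _; exact: powR_ge0.
apply: ler_prod => k _; rewrite powR_ge0 /=.
by apply: ger_powR => //; rewrite phi_gt0 // phi_le1.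
Qed.

Lemma cmeas_weight : cmeas (fun z => (h z)%:C).
Proof. by apply: (@cmeas_off _ (codom a)) => z zD za; exact: ccont_weight_gen. Qed.

Lemma rint_weight : rint h.
Proof.
have [q [q2 q0 qp]] := common_exponent.
apply: (@rint_le_off _ (codom a) _ (negweight q)).
- by have [] := cmeas_weight.
- move=> z zD za; have /andP[h0 h1] := weight_le_neg q0 qp zD za.
  by rewrite ger0_norm.
- exact: rint_negweight.
Qed.

(** Adding [e] under the power removes the singularity of the weight, so that
    [reg e] is continuously differentiable on the whole disc. *)
Definition regfac (e : R) k z : R := (cabs (phi (a k) z) ^+ 2 + e) `^ (p k / 2).
Definition reg (e : R) z : R := \prod_k regfac e k z.

Lemma regfac_ge0 e k z : 0 <= regfac e k z.
Proof. exact: powR_ge0. Qed.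

Lemma reg_ge0 e z : 0 <= reg e z.
Proof. by apply: prodr_ge0 => k _; exact: regfac_ge0. Qed.

Definition regbound : R := \prod_k 2 `^ `|p k|.

Lemma reg_bound (e q : R) z : 0 < e -> e <= 1 -> q <= 0 -> (forall k, q <= p k) ->
  unit_disc z -> z \notin codom a -> reg e z <= regbound * negweight q z.
Proof.
move=> e0 e1 q0 qp zD /notin_codom za; rewrite /regbound /negweight -big_split /=.
apply: ler_prod => k _; rewrite regfac_ge0 /= /regfac.
have x0 := phi_gt0 zD (za k); have x1 := phi_le1 k zD.
set x := cabs _ in x0 x1 *.
have c1 : 1 <= 2 `^ `|p k|.
  by have := @ler_powR R 2 (ler1n _ 2) 0 `|p k| (normr_ge0 _); rewrite powRr0.
have c2 : 1 <= x `^ q by exact: powR_ge1.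
have x2 : x ^+ 2 <= 1 by rewrite expr_le1 // ltW.
have x20 : 0 < x ^+ 2 by rewrite exprn_gt0.
have [pk|pk] := leP 0 (p k).
  apply: (@le_trans _ _ (2 `^ `|p k|)); last by rewrite ler_peMr // powR_ge0.
  apply: (@le_trans _ _ (2 `^ (p k / 2))).
    by apply: ge0_ler_powR; rewrite ?nnegrE; lra.
  by apply: ler_powR; [exact: ler1n|rewrite ger0_norm //; lra].
apply: (@le_trans _ _ (x `^ q)); last by rewrite ler_peMl // powR_ge0.
apply: (@le_trans _ _ ((x ^+ 2) `^ (p k / 2))).
  by apply: powR_anti => //; lra.
rewrite -powR_mulrn ?(ltW x0) // -powRrM (_ : 2%:R * (p k / 2) = p k); last by field.
by apply: ger_powR => //; rewrite x0.
Qed.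

Lemma ccvg_real (u : nat -> R) (l : R) : (u @ \oo --> l) ->
  ccvg (fun n => (u n)%:C) (l%:C).
Proof.
move=> /cvgrPdist_lt H e /H[N _ HN]; exists N => n /HN /=.
by rewrite -rmorphB /= cabsR distrC.
Qed.

Definition eps (n : nat) : R := n.+1%:R^-1.

Lemma eps_gt0 n : 0 < eps n.
Proof. by rewrite invr_gt0. Qed.

Lemma eps_le1 n : eps n <= 1.
Proof. by rewrite invf_le1 // ler1n. Qed.

Lemma eps_cvg : eps @ \oo --> (0 : R).
Proof. exact: cvg_harmonic. Qed.

Lemma regfac_cvg k z : unit_disc z -> z != a k ->
  (fun n => regfac (eps n) k z) @ \oo --> (cabs (phi (a k) z) `^ p k : R).
Proof.
move=> zD zk; have x0 := phi_gt0 zD zk.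
have E : cabs (phi (a k) z) `^ p k = (cabs (phi (a k) z) ^+ 2) `^ (p k / 2).
  rewrite -powR_mulrn ?(ltW x0) // -powRrM; congr (_ `^ _).
  by rewrite (_ : 2%:R * (p k / 2) = p k) //; field.
rewrite E.
apply: (@continuous_cvg _ _ _ _ _ _ (fun y : R => y `^ (p k / 2))).
  by apply: cont_powR_pos; rewrite exprn_gt0.
rewrite -[X in _ --> X]addr0; apply: cvgD; [exact: cvg_cst|exact: eps_cvg].
Qed.

Lemma ccvgM (u v : nat -> C) (l k : C) : ccvg u l -> ccvg v k ->
  ccvg (fun n => u n * v n) (l * k).
Proof.
move=> hu hv.
have E n : (u n - l) * (v n - k) + l * v n + k * u n - l * k = u n * v n by ring.
apply: (ccvg_ext E).
have h1 : ccvg (fun n => (u n - l) * (v n - k)) 0.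
  move=> e e0; have [N HN] := hu _ e0; have [M HM] := hv 1 ltr01.
  exists (maxn N M) => n; rewrite geq_max => /andP[/HN k1 /HM k2].
  rewrite subr0 cabsM.
  apply: (@le_lt_trans _ _ (cabs (u n - l) * 1)); last by rewrite mulr1.
  by rewrite ler_wpM2l ?cabs_ge0 // ltW.
have := ccvgB (ccvgD (ccvgD h1 (ccvgZ l hv)) (ccvgZ k hu)) (ccvg_cst (l * k)).
by rewrite add0r [k * l]mulrC addrK.
Qed.

Lemma ccvg_prod (I : Type) (r : seq I) (u : I -> nat -> C) (l : I -> C) :
  (forall i, ccvg (u i) (l i)) ->
  ccvg (fun n => \prod_(i <- r) u i n) (\prod_(i <- r) l i).
Proof.
move=> H; elim: r => [|i r IH].
  rewrite big_nil; apply: (ccvg_ext _ (ccvg_cst 1)) => n; by rewrite big_nil.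
rewrite big_cons; have E : (fun n => u i n * \prod_(j <- r) u j n) =1
    (fun n => \prod_(j <- i :: r) u j n) by move=> n; rewrite big_cons.
by apply: (ccvg_ext E); exact: ccvgM.
Qed.

Lemma reg_cvg z : unit_disc z -> z \notin codom a ->
  ccvg (fun n => (reg (eps n) z)%:C) (h z)%:C.
Proof.
move=> zD /notin_codom za.
have E : (fun n => \prod_k (regfac (eps n) k z)%:C) =1 (fun n => (reg (eps n) z)%:C).
  by move=> n; rewrite rmorph_prod.
apply: (ccvg_ext E); rewrite /blaschke_weight rmorph_prod.
by apply: ccvg_prod => k; apply: ccvg_real; exact: regfac_cvg.
Qed.

(** The complex derivative of the Blaschke factor of index [k]. *)
Definition dphi k (z : C) : C := (1 - `|a k| ^+ 2) / (1 - (a k)^* * z) ^+ 2.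

Lemma C1D_phi k : C1D (phi (a k)) (dphi k) (fun=> 0).
Proof.
have hd : C1D (fun z => 1 - (a k)^* * z) (fun=> - (a k)^*) (fun=> 0).
  have := C1DB (C1D_cst 1) (C1DM (C1D_cst (a k)^*) (@C1D_id R)).
  by apply: C1D_ext => z _; ring.
have hn : C1D (fun z => z - a k) (fun=> 1) (fun=> 0).
  have := C1DB (@C1D_id R) (C1D_cst (a k)).
  by apply: C1D_ext => z _; ring.
have d0 z : unit_disc z -> 1 - (a k)^* * z != 0 by exact: blaschke_den_neq0.
have := C1DM hn (C1DV d0 hd).
apply: C1D_ext => z zD; last by ring.
rewrite /dphi sqr_normc -conjCE; field; exact: d0.
Qed.

Lemma C1D_regfac (e : R) k : 0 < e ->
  C1D (fun z => (regfac e k z)%:C)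
    (fun z => (p k / 2 * (cabs (phi (a k) z) ^+ 2 + e) `^ (p k / 2 - 1))%:C
              * (dphi k z * (phi (a k) z)^*))
    (fun z => (p k / 2 * (cabs (phi (a k) z) ^+ 2 + e) `^ (p k / 2 - 1))%:C
              * (phi (a k) z * (dphi k z)^*)).
Proof.
move=> e0.
have hr : C1D (fun z => (cabs (phi (a k) z) ^+ 2 + e)%:C)
    (fun z => dphi k z * (phi (a k) z)^*) (fun z => phi (a k) z * (dphi k z)^*).
  have -> : (fun z => (cabs (phi (a k) z) ^+ 2 + e)%:C) =
      (fun z => phi (a k) z * (phi (a k) z)^* + e%:C).
    by apply/funext => z; rewrite rmorphD /= cabs_sqrC.
  have := C1DD (C1DM (C1D_phi k) (C1DJ (C1D_phi k))) (C1D_cst e%:C).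
  by apply: C1D_ext => z _; rewrite ?rmorph0; ring.
have pos z : 0 < cabs (phi (a k) z) ^+ 2 + e by rewrite ltr_wpDl // sqr_ge0.
apply: (C1D_real (r := fun z => cabs (phi (a k) z) ^+ 2 + e)
  (psi := fun y => y `^ (p k / 2)) (dpsi := fun y => p k / 2 * y `^ (p k / 2 - 1)) hr).
  by move=> z _; exact: derivable_powR_pos.
move=> z _; apply: (@continuousM R _ (fun=> p k / 2) (fun y => y `^ (p k / 2 - 1))).
  exact: cvg_cst.
exact: cont_powR_pos.
Qed.

End weight.

(** * Radial cutoffs and residues *)

Section cutoff.
Variable R : realType.
Local Notation C := R[i].
Implicit Types (z al : C).

(** A C^1 step built from truncated squares: 0 for x <= 0 and 1 for x >= 1. *)
Definition step (x : R) : R := 2 * tsq x - 4 * tsq (x - 1/2) + 2 * tsq (x - 1).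
Definition dstep (x : R) : R := 2 * dtsq x - 4 * dtsq (x - 1/2) + 2 * dtsq (x - 1).

Lemma step_neg x : x <= 0 -> step x = 0 /\ dstep x = 0.
Proof.
move=> h; rewrite /step /dstep !tsq_neg ?dtsq_neg; lra.
Qed.

Lemma step_ge1 x : 1 <= x -> step x = 1 /\ dstep x = 0.
Proof.
move=> h; rewrite /step /dstep !tsq_pos ?dtsq_pos; lra.
Qed.

Lemma step_bound x : `|step x| <= 3 /\ `|dstep x| <= 4.
Proof.
have [h|h] := leP x 0.
  by have [-> ->] := step_neg h; rewrite normr0; split.
have [h1|h1] := leP 1 x.
  by have [-> ->] := step_ge1 h1; rewrite normr0 normr1; split; lra.
rewrite /step /dstep (tsq_pos (ltW h)) (dtsq_pos (ltW h)).
have h2 : x - 1 <= 0 by lra.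
rewrite (tsq_neg h2) (dtsq_neg h2).
have [h3|h3] := leP 0 (x - 1/2).
  by rewrite (tsq_pos h3) (dtsq_pos h3) !ler_norml; split; apply/andP; split; nra.
rewrite (tsq_neg (ltW h3)) (dtsq_neg (ltW h3)) !ler_norml.
by split; apply/andP; split; nra.
Qed.

Lemma is_derive_step (x : R) : is_derive x 1 step (dstep x).
Proof.
have h0 := is_derive_tsq x.
have h1 := is_derive_tsq_shift x (1/2).
have h2 := is_derive_tsq_shift x 1.
have -> : step = (fun t => 2 *: tsq t + (- 4) *: tsq (t - 1/2) + 2 *: tsq (t - 1)).
  by apply/funext => t; rewrite /step /GRing.scale /=; lra.
apply: is_derive_eq.
by rewrite /dstep /GRing.scale /=; lra.
Qed.

Lemma dstep_lip x t : `|dstep x - dstep t| <= 16 * `|x - t|.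
Proof.
have := dtsq_lip x t; have := dtsq_lip (x - 1) (t - 1).
have := dtsq_lip (x - 1/2) (t - 1/2).
have E (b : R) : x - b - (t - b) = x - t by lra.
rewrite !E /dstep !ler_norml => /andP[? ?] /andP[? ?] /andP[? ?].
by apply/andP; split; lra.
Qed.

Lemma cont_dstep : continuous dstep.
Proof.
move=> x; apply/cvgrPdist_lt => e e0; apply/nbhs_ballP.
exists (e / 16) => [|t]; first by rewrite /=; lra.
by rewrite /ball /= => h; have := dstep_lip x t; lra.
Qed.

(** The cutoff equals 1 for |z|^2 <= 1 - 2 d and 0 for |z|^2 >= 1 - d; [dcut d
    z * z^*] is its derivative with respect to [z]. *)
Definition cutarg (d : R) z : R := (1 - d - cabs z ^+ 2) * d^-1.
Definition cut (d : R) z : R := step (cutarg d z).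
Definition dcut (d : R) z : R := - d^-1 * dstep (cutarg d z).

Lemma cut_bound d z : `|cut d z| <= 3.
Proof. by have [] := step_bound (cutarg d z). Qed.

Lemma cut_in d z : 0 < d -> cabs z ^+ 2 <= 1 - 2 * d -> cut d z = 1 /\ dcut d z = 0.
Proof.
move=> d0 h; have h1 : 1 <= cutarg d z.
  by rewrite /cutarg ler_pdivlMr //; lra.
by rewrite /cut /dcut; have [-> ->] := step_ge1 h1; rewrite mulr0.
Qed.

Lemma cut_out d z : 0 < d -> 1 - d <= cabs z ^+ 2 -> cut d z = 0 /\ dcut d z = 0.
Proof.
move=> d0 h; have h1 : cutarg d z <= 0.
  by rewrite /cutarg ler_pdivrMr // mul0r; lra.
by rewrite /cut /dcut; have [-> ->] := step_neg h1; rewrite mulr0.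
Qed.

(** The derivative of the cutoff is of the order of the inverse distance to the
    circle: this is why errors of order 1 - |z|^2 disappear in the limit. *)
Lemma dcut_bound d z : 0 < d -> unit_disc z -> (1 - cabs z ^+ 2) * `|dcut d z| <= 8.
Proof.
move=> d0 /unit_discE zD; have [h|h] := leP (cabs z ^+ 2) (1 - 2 * d).
  by have [_ ->] := cut_in d0 h; rewrite normr0 mulr0.
have [_ b] := step_bound (cutarg d z).
have d0' : 0 < d^-1 by rewrite invr_gt0.
rewrite /dcut normrM normrN (gtr0_norm d0').
have z1 : cabs z ^+ 2 < 1 by rewrite expr_lt1 ?cabs_ge0.
apply: (@le_trans _ _ (2 * d * (d^-1 * 4))).
  apply: ler_pM; [lra|by rewrite mulr_ge0 // ltW|lra|].
  by rewrite ler_pM2l.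
by rewrite mulrA -(mulrA 2) divff ?gt_eqF // mulr1; lra.
Qed.

Lemma C1D_cut d : 0 < d -> C1D (fun z => (cut d z)%:C)
  (fun z => (dcut d z)%:C * z^*) (fun z => (dcut d z)%:C * z).
Proof.
move=> d0; have hr : C1D (fun z => (cutarg d z)%:C)
    (fun z => (- d^-1)%:C * z^*) (fun z => (- d^-1)%:C * z).
  have -> : (fun z => (cutarg d z)%:C) =
      (fun z => ((1 - d) * d^-1)%:C + z * z^* * (- d^-1)%:C).
    apply/funext => z; rewrite -cabs_sqrC -rmorphM -rmorphD /=.
    by congr (_%:C); rewrite /cutarg; ring.
  have := C1DD (C1D_cst ((1 - d) * d^-1)%:C) (C1DM (C1DM (@C1D_id R) (C1DJ (@C1D_id R)))
    (C1D_cst (- d^-1)%:C)).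
  by apply: C1D_ext => z _; rewrite ?rmorph0 ?rmorph1; ring.
have := C1D_real (r := cutarg d) (psi := step) (dpsi := dstep) hr
  (fun z _ => is_derive_step _) (fun z _ => @cont_dstep _).
by apply: C1D_ext => z _; rewrite /dcut rmorphM /=; ring.
Qed.

Lemma ctest_cut d : 0 < d -> d < 1 -> ctest (fun z => (cut d z)%:C)
  (fun z => (dcut d z)%:C * z^*) (fun z => (dcut d z)%:C * z).
Proof.
move=> d0 d1; split; first exact: C1D_cut.
exists (1 - d / 2); first by apply/andP; split; lra.
move=> z zD h; have h1 : 1 - d <= cabs z ^+ 2.
  by apply: (@le_trans _ _ ((1 - d / 2) ^+ 2)); [nra|rewrite ler_pXn2r ?nnegrE ?cabs_ge0 // ?ltW //; lra].
by have [-> ->] := cut_out d0 h1; rewrite !mul0r.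
Qed.

Lemma ccont_dcut d z : 0 < d -> ccont (fun z => (dcut d z)%:C) z.
Proof.
move=> d0.
have cz : ccont (fun z : C => (cabs z ^+ 2)%:C) z.
  have -> : (fun z : C => (cabs z ^+ 2)%:C) = (fun z => z * z^*).
    by apply/funext => y; rewrite cabs_sqrC.
  by apply: ccontM; [exact: ccont_id|apply: ccontJ; exact: ccont_id].
have c1 : ccont (fun z : C => (cutarg d z)%:C) z.
  have -> : (fun z => (cutarg d z)%:C) = (fun z => ((1 - d)%:C - (cabs z ^+ 2)%:C) * (d^-1)%:C).
    by apply/funext => y; rewrite -rmorphB -rmorphM.
  by apply: ccontM; [apply: ccontB => //; exact: ccont_cst|exact: ccont_cst].
have -> : (fun z => (dcut d z)%:C) = (fun z => (- d^-1)%:C * (dstep (cutarg d z))%:C).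
  by apply/funext => y; rewrite -rmorphM.
apply: ccontM; first exact: ccont_cst.
by apply: (@ccont_real _ (fun z => (cutarg d z)%:C) dstep) => //; exact: cont_dstep.
Qed.

Section limit.
Variable d0 : R.
Hypotheses (d0_gt0 : 0 < d0) (d0_lt : d0 < 1/2).
Let del n := d0 * eps R n.

Lemma del_gt0 n : 0 < del n.
Proof. by rewrite mulr_gt0 // eps_gt0. Qed.

Lemma del_le n : del n <= d0.
Proof. by rewrite ler_piMr ?eps_le1 // ltW. Qed.

Lemma del_small z : unit_disc z -> exists N, forall n, (N <= n)%N ->
  cabs z ^+ 2 <= 1 - 2 * del n.
Proof.
have d0p := d0_gt0; have d0h := d0_lt.
move=> /unit_discE zD; have z1 : cabs z ^+ 2 < 1 by rewrite expr_lt1 ?cabs_ge0.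
have e0 : 0 < (1 - cabs z ^+ 2) / (2 * d0).
  have e1 : 0 < 1 - cabs z ^+ 2 by lra.
  have e2 : 0 < 2 * d0 by lra.
  by rewrite divr_gt0.
have [N _ HN] := near_infty_natSinv_lt (PosNum e0).
exists N => n /HN /=; rewrite ltr_pdivlMr; last by lra.
rewrite /del /eps; move: (n.+1%:R^-1 : R) => t; lra.
Qed.

(** [dcut] is supported where |z|^2 > 1 - 2 d0 and blows up like 1 / (1 -
    |z|^2), which the factor 1 - |z|^2 in the bound on [U] compensates;
    pointwise the integrand is eventually zero. *)
Lemma boundary_limit (s : seq C) (U : C -> C) (G : C -> R) :
  cmeas U -> rint G -> (forall z, 0 <= G z) ->
  (forall z, unit_disc z -> 1 - 2 * d0 < cabs z ^+ 2 -> z \notin s ->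
     cabs (U z) <= (1 - cabs z ^+ 2) * G z) ->
  ccvg (fun n => disc_integral (fun z => (dcut (del n) z)%:C * U z)) 0.
Proof.
have d0p := d0_gt0; have d0h := d0_lt.
move=> mU hG G0 UG; rewrite -(di0 R).
have [] // := @di_dct _ s (fun n z => (dcut (del n) z)%:C * U z) (fun=> 0) (fun z => 8 * G z).
- move=> n; apply: cmeasM => //; apply: cmeas_cont => z _.
  by apply: ccont_dcut; exact: del_gt0.
- exact: rintZ.
- move=> n z zD zs; rewrite cabsM cabsR.
  have [h|h] := leP (cabs z ^+ 2) (1 - 2 * d0).
    have h' : cabs z ^+ 2 <= 1 - 2 * del n by have := del_le n; lra.
    by have [_ ->] := cut_in (del_gt0 n) h'; rewrite normr0 mul0r mulr_ge0.
  have b1 := dcut_bound (del_gt0 n) zD; have b2 := UG z zD h zs.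
  apply: (@le_trans _ _ (`|dcut (del n) z| * ((1 - cabs z ^+ 2) * G z))).
    by rewrite ler_wpM2l.
  by rewrite mulrA ler_wpM2r // mulrC.
- move=> z zD _ e e0; have [N HN] := del_small zD; exists N => n /HN h.
  by have [_ ->] := cut_in (del_gt0 n) h; rewrite mul0r subrr cabs0.
Qed.

Lemma cut_limit (f : C -> C) : disc_integrable f ->
  ccvg (fun n => disc_integral (fun z => (cut (del n) z)%:C * f z)) (disc_integral f).
Proof.
move=> hf; have hG := di_rint hf.
have [] // := @di_dct _ [::] (fun n z => (cut (del n) z)%:C * f z) f
   (fun z => 3 * (`|complex.Re (f z)| + `|complex.Im (f z)|)).
- move=> n; apply: cmeasM; last exact: di_cmeas.
  by apply: cmeas_cont => z zD; exact: C1D_cont (C1D_cut (del_gt0 n)) zD.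
- exact: di_cmeas.
- exact: rintZ.
- move=> n z zD _; rewrite cabsM cabsR.
  by apply: ler_pM => //; [exact: cabs_ge0|exact: cut_bound|exact: cabs_le_ReIm].
- move=> z zD _ e e0; have [N HN] := del_small zD; exists N => n /HN h.
  by have [-> _] := cut_in (del_gt0 n) h; rewrite mul1r subrr cabs0.
Qed.

Lemma rint_inv_dist al : unit_disc al -> rint (fun z => (cabs (z - al))^-1).
Proof.
move=> aD; have := rint_powR_dist aD (_ : -2 < -1) (_ : -1 <= 0).
rewrite (_ : (fun z => _ `^ _) = (fun z => (cabs (z - al))^-1)).
  by apply; lra.
by apply/funext => z; rewrite powR_inv1 // cabs_ge0.
Qed.

Lemma cmeas_inv_dist al : cmeas (fun z => ((z - al)^*)^-1).
Proof.
apply: (@cmeas_off _ [:: al]) => z zD; rewrite inE => za.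
apply: ccontV; first by rewrite conjC_eq0 subr_eq0.
by apply: ccontJ; apply: ccontB; [exact: ccont_id|exact: ccont_cst].
Qed.

Lemma di_inv_dist f al (M : R) : unit_disc al -> cmeas f ->
  (forall z, unit_disc z -> cabs (f z) <= M) ->
  disc_integrable (fun z => f z / (z - al)^*).
Proof.
move=> aD mf fM; apply: (@di_dom _ [::] _ (fun z => M * (cabs (z - al))^-1)).
- by apply: cmeasM => //; exact: cmeas_inv_dist.
- by apply: rintZ; exact: rint_inv_dist.
- move=> z zD _; rewrite cabsM cabsV cabsJ ler_wpM2r ?invr_ge0 ?cabs_ge0 //.
  exact: fM.
Qed.

(** Near the circle z^* / (z - al)^* = z^* z + z al^* / (1 - al^* z) + e z with
    e z = O(1 - |z|^2), and the cutoff derivative is [dcut] times z^* or z. The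
    first term gives minus the integral of the cutoff, by Green's formula for
    the cutoff times [z]; the second pairs a holomorphic function with the
    conjugate derivative of the cutoff and vanishes by [holo_test_b]; the third
    is handled by [boundary_limit]. The total mass of the disc is 1. *)
Lemma point_mass_limit al : unit_disc al -> cabs al ^+ 2 < 1 - 2 * d0 ->
  ccvg (fun n => disc_integral
     (fun z => ((dcut (del n) z)%:C * z^*) / (z - al)^*)) (- 1).
Proof.
have d0p := d0_gt0; have d0h := d0_lt.
move=> aD ha.
have a0 z : unit_disc z -> 1 - al^* * z != 0 by exact: blaschke_den_neq0.
have Hkap : C1D (fun z => al^* / (1 - al^* * z)) (fun z => al^* ^+ 2 / (1 - al^* * z) ^+ 2) (fun=> 0).
  have hd : C1D (fun z => 1 - al^* * z) (fun=> - al^*) (fun=> 0).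
    have := C1DB (C1D_cst 1) (C1DM (C1D_cst al^*) (@C1D_id R)).
    by apply: C1D_ext => z _; ring.
  have := C1DM (C1D_cst al^*) (C1DV a0 hd).
  by apply: C1D_ext => z zD; [|ring]; ring.
have hkap : holo (fun z => al^* / (1 - al^* * z)).
  by move=> z zD; have [w _ _] := Hkap z zD; eexists; exact: w.
pose e z : C := (1 - cabs z ^+ 2)%:C * (1 + al^* / ((z - al)^* * (1 - al^* * z))).
have me : cmeas e.
  apply: (@cmeas_off _ [:: al]) => z zD; rewrite inE => za.
  apply: ccontM.
    have -> : (fun z : C => (1 - cabs z ^+ 2)%:C) = (fun z => 1 - z * z^*).
      by apply/funext => y; rewrite rmorphB /= cabs_sqrC.
    apply: ccontB; first exact: ccont_cst.
    by apply: ccontM; [exact: ccont_id|apply: ccontJ; exact: ccont_id].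
  apply: ccontD; first exact: ccont_cst.
  apply: ccontM; first exact: ccont_cst.
  apply: ccontV; first by apply: mulf_neq0; [rewrite conjC_eq0 subr_eq0|exact: a0].
  apply: ccontM; first by apply: ccontJ; apply: ccontB; [exact: ccont_id|exact: ccont_cst].
  apply: ccontB; first exact: ccont_cst.
  by apply: ccontM; [exact: ccont_cst|exact: ccont_id].
have al1 : cabs al < 1 by apply/unit_discE.
pose q := Num.sqrt (1 - 2 * d0).
have q2 : q ^+ 2 = 1 - 2 * d0 by rewrite sqr_sqrtr //; lra.
have q0 : 0 <= q by exact: sqrtr_ge0.
have aq : cabs al < q by rewrite -(@ltr_pXn2r _ 2) ?nnegrE ?cabs_ge0 // q2.
pose G := 1 + ((q - cabs al) * (1 - cabs al))^-1.
have den0 : 0 < (q - cabs al) * (1 - cabs al) by rewrite mulr_gt0 // subr_gt0.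
have lim_e : ccvg (fun n => disc_integral (fun z => (dcut (del n) z)%:C * e z)) 0.
  apply: (@boundary_limit [::] e (fun=> G)) => //; first exact: rint_cst.
    by move=> z; rewrite addr_ge0 // invr_ge0 ltW.
  move=> z zD hz _; have z1 : cabs z < 1 by apply/unit_discE.
  have zz1 : cabs z ^+ 2 < 1 by rewrite expr_lt1 ?cabs_ge0.
  rewrite /e cabsM cabsR ger0_norm; last by lra.
  rewrite ler_wpM2l //; first by lra.
  apply: (le_trans (cabsD _ _)); rewrite cabs1 lerD2l cabsM cabsJ cabsV cabsM cabsJ.
  apply: (@le_trans _ _ (1 * (cabs (z - al) * cabs (1 - al^* * z))^-1)).
    by rewrite ler_wpM2r ?invr_ge0 ?mulr_ge0 ?cabs_ge0 // ltW.
  rewrite mul1r.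
  have zq : q <= cabs z by rewrite -(@ler_pXn2r _ 2) ?nnegrE ?cabs_ge0 // q2 ltW.
  have b1 : q - cabs al <= cabs (z - al).
    by have := cabsD (z - al) al; rewrite subrK; lra.
  have b2 := blaschke_den_ge al zD.
  have b : (q - cabs al) * (1 - cabs al) <= cabs (z - al) * cabs (1 - al^* * z).
    by apply: ler_pM => //; lra.
  by rewrite lef_pV2 ?posrE //; exact: lt_le_trans den0 b.
have lim_1 : ccvg (fun n => disc_integral (fun z => (cut (del n) z)%:C * 1)) 1.
  rewrite -[X in ccvg _ X](disc_integral1 R); apply: (@cut_limit (fun=> 1)).
  by apply: (@di_bounded _ _ 1) => z _; [exact: ccont_cst|rewrite cabs1].
have key n : disc_integral (fun z => (dcut (del n) z)%:C * e z) -
    disc_integral (fun z => (cut (del n) z)%:C * 1) =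
    disc_integral (fun z => ((dcut (del n) z)%:C * z^*) / (z - al)^*).
  have dn0 := del_gt0 n; have dn1 : del n < 1 by have := del_le n; lra.
  have Ht := ctest_cut dn0 dn1.
  have Htz := ctestM Ht (@C1D_id R).
  have E1 := (ctest_int Htz).1.
  have E2 := holo_test_b hkap Ht.
  have [M M0 HM] : exists2 M, 0 < M & forall z, unit_disc z -> cabs ((dcut (del n) z)%:C) <= M.
    have [H [r /andP[r0 r1] Hr]] := Ht.
    have r1' : 1 - del n / 2 < 1 by lra.
    have cc z : unit_disc z -> ccont (fun z => (dcut (del n) z)%:C) z.
      by move=> _; exact: ccont_dcut.
    apply: (bounded_test r1' cc) => z zD h; have h1 : 1 - del n <= cabs z ^+ 2.
      by apply: (@le_trans _ _ ((1 - del n / 2) ^+ 2)); [nra|rewrite ler_pXn2r ?nnegrE ?cabs_ge0 // ?ltW //; lra].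
    by have [_ ->] := cut_out dn0 h1.
  have i1 : disc_integrable (fun z => (cut (del n) z)%:C * 1).
    apply: (@di_bounded _ _ 3) => z zD.
      by apply: ccontM; [exact: C1D_cont (C1D_cut dn0) zD|exact: ccont_cst].
    by rewrite mulr1 cabsR cut_bound.
  have i2 : disc_integrable (fun z => (dcut (del n) z)%:C * z^* * z).
    apply: (@di_bounded _ _ M) => z zD.
      apply: ccontM; last exact: ccont_id.
      by apply: ccontM; [exact: ccont_dcut|apply: ccontJ; exact: ccont_id].
    rewrite !cabsM cabsJ -mulrA; move/unit_discE: (zD) => z1.
    apply: le_trans (HM z zD); rewrite ler_piMr ?cabs_ge0 //.
    by rewrite mulr_ile1 ?cabs_ge0 // ltW.
  have i3 : disc_integrable (fun z => al^* / (1 - al^* * z) * ((dcut (del n) z)%:C * z)).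
    have [H [r /andP[r0 r1] Hr]] := Ht.
    apply: (di_test r1) => z zD; last by move=> /(Hr z zD)[_ _ ->]; rewrite mulr0.
    by apply: ccontM; [exact: holo_cont|apply: ccontM; [exact: ccont_dcut|exact: ccont_id]].
  have i4 : disc_integrable (fun z => (dcut (del n) z)%:C * z^* / (z - al)^*).
    apply: (@di_inv_dist _ _ M) => //.
      apply: cmeas_cont => z zD.
      by apply: ccontM; [exact: ccont_dcut|apply: ccontJ; exact: ccont_id].
    move=> z zD; rewrite cabsM cabsJ; move/unit_discE: (zD) => z1.
    by apply: le_trans (HM z zD); rewrite ler_piMr ?cabs_ge0 // ltW.
  have E1' : disc_integral (fun z => (dcut (del n) z)%:C * z^* * z) =
      - disc_integral (fun z => (cut (del n) z)%:C * 1).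
    by apply/eqP; rewrite -addr_eq0 -diD // E1.
  have Epw : disc_integral (fun z => (dcut (del n) z)%:C * e z) =
    disc_integral (fun z => ((dcut (del n) z)%:C * z^* / (z - al)^*
       - (dcut (del n) z)%:C * z^* * z)
       - al^* / (1 - al^* * z) * ((dcut (del n) z)%:C * z)).
    apply: eq_di => z zD; have [->|za] := eqVneq z al.
      have h : cabs al ^+ 2 <= 1 - 2 * del n by have := del_le n; lra.
      by have [_ ->] := cut_in dn0 h; rewrite !(mul0r, mulr0, subr0).
    rewrite /e rmorphB /= rmorph1 cabs_sqrC rmorphB /=.
    have d1 := a0 z zD; have d2 : z^* - al^* != 0.
      by rewrite -rmorphB conjC_eq0 subr_eq0.
    by field; rewrite d1 d2.
  rewrite Epw diB //; last exact: di_integrableB.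
  by rewrite diB // E2 subr0 E1' opprK addrK.
have := ccvgB lim_e lim_1; rewrite sub0r; exact: ccvg_ext.
Qed.

End limit.

(** The function [(g z - g al)^* / (z - al)^*] has no pole, so pairing it with
    the derivative of [th] gives zero by [holo_test_z]. To stay within smooth
    multipliers the pole [1 / (z - al)^*] is replaced by [(z - al) / (|z -
    al|^2 + e)] and [e] tends to 0; the Lipschitz bound on [g] at [al] supplies
    the dominating function 1 / |z - al|. *)
Lemma pole_value g th tz tb al : holo g -> ctest th tz tb -> unit_disc al ->
  disc_integral (fun z => (g z)^* * tz z / (z - al)^*) =
  (g al)^* * disc_integral (fun z => tz z / (z - al)^*).
Proof.
move=> hg Ht aD; have [H [rho /andP[rho0 rho1] Hr]] := Ht.
have cth z : unit_disc z -> ccont th z by move=> zD; exact: C1D_cont H zD.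
have ctz z : unit_disc z -> ccont tz z by move=> /H[].
have zth z : unit_disc z -> rho < cabs z -> th z = 0 by move=> zD /(Hr z zD)[].
have ztz z : unit_disc z -> rho < cabs z -> tz z = 0 by move=> zD /(Hr z zD)[].
have [M1 M10 HM1] := bounded_test rho1 cth zth.
have [M2 M20 HM2] := bounded_test rho1 ctz ztz.
have cg z : unit_disc z -> ccont g z by exact: holo_cont.
have [Mg Mg0 HMg] : exists2 M, 0 < M & forall z, cabs z <= rho -> cabs (g z) <= M.
  by apply: bounded_disc => z zr; apply: cg; apply/unit_discE; lra.
have [L L0 HL] : exists2 L, 0 < L & forall z, cabs z <= rho ->
    cabs (g z - g al) <= L * cabs (z - al).
  have [pp [A [B [cA cB Ap B0 Hg]]]] := hg al aD.
  have [k1 k10 Hk1] := ccont_bound cA; have [k2 k20 Hk2] := ccont_bound cB.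
  pose k := Num.min k1 k2; have k0 : 0 < k by rewrite lt_min k10.
  pose L1 := cabs pp + 2; pose L2 := (Mg + cabs (g al)) / k.
  have L10 : 0 < L1 by rewrite /L1; have := cabs_ge0 pp; lra.
  have L20 : 0 < L2 by rewrite divr_gt0 // ltr_wpDr ?cabs_ge0.
  exists (L1 + L2) => [|z zr]; first lra.
  rewrite mulrDl; have [h|h] := ltP (cabs (z - al)) k.
    apply: (@le_trans _ _ (L1 * cabs (z - al))); last first.
      by rewrite lerDl mulr_ge0 ?cabs_ge0 // ltW.
    move: h; rewrite lt_min => /andP[/Hk1 h1 /Hk2 h2].
    rewrite Hg; apply: (le_trans (cabsD _ _)); rewrite !cabsM cabsJ -mulrDl.
    rewrite ler_wpM2r ?cabs_ge0 //; move: h1 h2; rewrite Ap B0 cabs0 /L1; lra.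
  apply: (@le_trans _ _ (L2 * cabs (z - al))); last first.
    by rewrite lerDr mulr_ge0 ?cabs_ge0 // ltW.
  apply: (@le_trans _ _ (Mg + cabs (g al))).
    by apply: (le_trans (cabsB _ _)); rewrite lerD2r HMg.
  by rewrite /L2 mulrAC ler_pdivlMr // ler_wpM2l // addr_ge0 ?cabs_ge0 // ltW.
pose del z : C := (g z - g al)^*.
have hdel : holo (fun z => g z - g al).
  move=> z zD; have [pp w] := hg z zD; exists pp.
  by have := wirtD w (wirtN (wirt_cst (g al) z)); rewrite oppr0 !addr0.
have cdel z : unit_disc z -> ccont del z.
  by move=> zD; apply: ccontJ; apply: ccontB; [exact: cg|exact: ccont_cst].
(* Division by the smoothed squared distance [rd e z] instead of |z - al|^2
   turns the pole into a continuously differentiable function. *)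
pose rd e z : R := cabs (z - al) ^+ 2 + e.
have rd0 e z : 0 < e -> 0 < rd e z by move=> e0; rewrite ltr_wpDl // sqr_ge0.
have Hreg e : 0 < e -> C1D (fun z => (z - al) / (rd e z)%:C)
    (fun z => e%:C / (rd e z)%:C ^+ 2) (fun z => - (z - al) ^+ 2 / (rd e z)%:C ^+ 2).
  move=> e0.
  have hn : C1D (fun z => z - al) (fun=> 1) (fun=> 0).
    have := C1DB (@C1D_id R) (C1D_cst al).
    by apply: C1D_ext => z _; ring.
  have rdE z : (rd e z)%:C = (z - al) * (z - al)^* + e%:C.
    by rewrite rmorphD /= cabs_sqrC.
  have hd : C1D (fun z => (rd e z)%:C) (fun z => (z - al)^*) (fun z => z - al).
    have -> : (fun z => (rd e z)%:C) = (fun z => (z - al) * (z - al)^* + e%:C).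
      by apply/funext => z; exact: rdE.
    have := C1DD (C1DM hn (C1DJ hn)) (C1D_cst e%:C).
    by apply: C1D_ext => z _; rewrite ?rmorph0 ?rmorph1; ring.
  have d0 z : unit_disc z -> (rd e z)%:C != 0.
    by move=> _; rewrite -cabs_gt0 cabsR gtr0_norm rd0.
  have := C1DM hn (C1DV d0 hd).
  apply: C1D_ext => z zD; have dz := d0 z zD; last by field.
  rewrite rdE in dz *; move: ((z - al)^*) (z - al) dz => v u dz; field; exact: dz.
pose T n z := del z * (tz z * ((z - al) / (rd (eps R n) z)%:C)
                 + th z * ((eps R n)%:C / (rd (eps R n) z)%:C ^+ 2)).
have T0 n : disc_integral (T n) = 0.
  have := holo_test_z hdel (ctestM Ht (Hreg _ (eps_gt0 R n))).
  by move=> <-; apply: eq_di.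
have cT n z : unit_disc z -> ccont (T n) z.
  move=> zD; have [w c1 c2] := Hreg _ (eps_gt0 R n) z zD.
  apply: ccontM; first exact: cdel.
  apply: ccontD; apply: ccontM; [exact: ctz|exact: wirt_cont w|exact: cth|exact: c1].
pose Tlim z := del z * tz z / (z - al)^*.
have mTlim : cmeas Tlim.
  apply: cmeasM; last exact: cmeas_inv_dist.
  by apply: cmeas_cont => z zD; apply: ccontM; [exact: cdel|exact: ctz].
have lim : ccvg (fun n => disc_integral (T n)) (disc_integral Tlim).
  have [] // := @di_dct _ [:: al] T Tlim (fun z => L * M2 + L * M1 * (cabs (z - al))^-1).
  - by move=> n; apply: cmeas_cont => z zD; exact: cT.
  - apply: rintD; first exact: rint_cst.
    by apply: rintZ; exact: rint_inv_dist.
  - move=> n z zD; rewrite inE => za.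
    have x0 : 0 < cabs (z - al) by rewrite cabs_gt0 subr_eq0.
    have [rz|rz] := ltP rho (cabs z).
      rewrite /T zth // ztz // !mul0r addr0 mulr0 cabs0.
      by rewrite addr_ge0 // !mulr_ge0 ?invr_ge0 // ltW.
    have e0 := eps_gt0 R n; have r0 := rd0 _ z e0.
    have h1 := HL z rz; have h2 := HM1 z zD; have h3 := HM2 z zD.
    set x := cabs (z - al) in x0 h1 *.
    have x2r : x ^+ 2 <= rd (eps R n) z by rewrite lerDl ltW.
    have er : eps R n <= rd (eps R n) z by rewrite lerDr sqr_ge0.
    rewrite /T cabsM cabsJ.
    apply: (@le_trans _ _ (L * x * (M2 * (x / rd (eps R n) z) +
       M1 * (eps R n / rd (eps R n) z ^+ 2)))).
      apply: ler_pM => //; try exact: cabs_ge0.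
      apply: (le_trans (cabsD _ _)); rewrite !cabsM !cabsV cabsX !cabsR.
      rewrite (gtr0_norm r0) (gtr0_norm e0).
      apply: lerD; rewrite ler_wpM2r // divr_ge0 ?cabs_ge0 ?exprn_ge0 // ltW //.
    rewrite mulrDr; apply: lerD.
      have -> : L * x * (M2 * (x / rd (eps R n) z)) = L * M2 * (x ^+ 2 / rd (eps R n) z) by ring.
      by apply: ler_piMr; [rewrite mulr_ge0 // ltW|rewrite ler_pdivrMr // mul1r].
    have -> : L * x * (M1 * (eps R n / rd (eps R n) z ^+ 2)) =
      L * M1 * (x^-1 * ((x ^+ 2 / rd (eps R n) z) * (eps R n / rd (eps R n) z))).
      by field; rewrite !gt_eqF.
    apply: ler_wpM2l; first by rewrite mulr_ge0 // ltW.
    apply: ler_piMr; first by rewrite invr_ge0 ltW.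
    rewrite mulr_ile1 ?divr_ge0 ?exprn_ge0 ?(ltW x0) ?(ltW e0) ?(ltW r0) //.
      by rewrite ler_pdivrMr // mul1r.
    by rewrite ler_pdivrMr // mul1r.
  - move=> z zD; rewrite inE => za.
    have x0 : 0 < cabs (z - al) ^+ 2 by rewrite exprn_gt0 // cabs_gt0 subr_eq0.
    have crd : ccvg (fun n => (rd (eps R n) z)^-1%:C) ((cabs (z - al) ^+ 2)^-1)%:C.
      apply: ccvg_real; apply: cvgV; first by rewrite gt_eqF.
      rewrite -[X in _ --> X]addr0; apply: cvgD; [exact: cvg_cst|exact: eps_cvg].
    have ce : ccvg (fun n => (eps R n)%:C) 0.
      by rewrite -(rmorph0 (real_complex R)); apply: ccvg_real; exact: eps_cvg.
    have E n : T n z = del z * (tz z * ((z - al) * (rd (eps R n) z)^-1%:C)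
        + th z * ((eps R n)%:C * ((rd (eps R n) z)^-1%:C * (rd (eps R n) z)^-1%:C))).
      rewrite /T expr2 invfM; congr (_ * (_ * (_ * _) + _ * (_ * (_ * _))));
      by rewrite fmorphV.
    have -> : Tlim z = del z * (tz z * ((z - al) * ((cabs (z - al) ^+ 2)^-1)%:C)
        + th z * (0 * (((cabs (z - al) ^+ 2)^-1)%:C * ((cabs (z - al) ^+ 2)^-1)%:C))).
      rewrite mul0r mulr0 addr0 /Tlim fmorphV /= cabs_sqrC.
      have u0 : z - al != 0 by rewrite subr_eq0.
      have v0 : (z - al)^* != 0 by rewrite conjC_eq0.
      move: ((z - al)^*) (z - al) u0 v0 => v u u0 v0.
      by field; rewrite u0 v0.
    apply: (ccvg_ext (fun n => esym (E n))).
    apply: ccvgM; first exact: ccvg_cst.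
    apply: ccvgD; apply: ccvgM; [exact: ccvg_cst| |exact: ccvg_cst|].
      by apply: ccvgM; [exact: ccvg_cst|exact: crd].
    by apply: ccvgM; [exact: ce|apply: ccvgM; exact: crd].
have L0' : disc_integral Tlim = 0.
  apply: (ccvg_unique lim); apply: (ccvg_ext (fun n => esym (T0 n))); exact: ccvg_cst.
have i1 : disc_integrable (fun z => (g z)^* * tz z / (z - al)^*).
  apply: (@di_inv_dist _ _ (Mg * M2)) => //.
    by apply: cmeas_cont => z zD; apply: ccontM; [apply: ccontJ; exact: cg|exact: ctz].
  move=> z zD; have [rz|rz] := ltP rho (cabs z).
    by rewrite ztz // mulr0 cabs0 mulr_ge0 // ltW.
  by rewrite cabsM cabsJ ler_pM ?cabs_ge0 ?HMg ?HM2.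
have i2 : disc_integrable (fun z => tz z / (z - al)^*).
  apply: (@di_inv_dist _ _ M2) => //.
  by apply: cmeas_cont.
apply/eqP; rewrite -subr_eq0 -diZ // -diB //; last exact: di_integrableZ.
rewrite -[X in _ == X]L0'; apply/eqP; apply: eq_di => z zD.
by rewrite /Tlim /del rmorphB /=; ring.
Qed.

End cutoff.

(** * Green pairing with the weight *)

Section green_weighted.
Variable R : realType.
Local Notation C := R[i].
Local Notation phi := (@blaschke_factor R).
Variables (s : nat) (a : 'I_s -> C) (p : 'I_s -> R).
Hypothesis a_disc : forall k, unit_disc (a k).
Hypothesis a_inj : injective a.
Hypothesis p_gt : forall k, -2 < p k.
Local Notation h := (blaschke_weight a p).
Local Notation B := (blaschke a).
Local Notation Bx := (blaschke_except a).
Local Notation dphi := (dphi a).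

Lemma blaschkeE k z : B z = phi (a k) z * Bx k z.
Proof. by rewrite /blaschke (bigD1 k). Qed.

Definition dblaschke z : C := \sum_k dphi k z * Bx k z.

Lemma C1D_blaschke : C1D B dblaschke (fun=> 0).
Proof.
have := @C1D_prod R _ xpredT (fun k => phi (a k)) dphi (fun=> fun=> 0)
  (fun k _ => C1D_phi a_disc k).
by apply: C1D_ext => z _ //; rewrite big1 // => k _; rewrite mul0r.
Qed.

Lemma C1D_blaschke_except k : C1D (Bx k)
  (fun z => \sum_(i | i != k) dphi i z * \prod_(j | (j != k) && (j != i)) phi (a j) z)
  (fun=> 0).
Proof.
have := @C1D_prod R _ (fun j => j != k) (fun k => phi (a k)) dphi (fun=> fun=> 0)
  (fun k _ => C1D_phi a_disc k).
by apply: C1D_ext => z _ //; rewrite big1 // => i _; rewrite mul0r.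
Qed.

Lemma C1D_dphi k : C1D (dphi k)
  (fun z => dphi k z * ((a k)^* *+ 2 / (1 - (a k)^* * z))) (fun=> 0).
Proof.
have hd : C1D (fun z => 1 - (a k)^* * z) (fun=> - (a k)^*) (fun=> 0).
  have := C1DB (C1D_cst 1) (C1DM (C1D_cst (a k)^*) (@C1D_id R)).
  by apply: C1D_ext => z _; ring.
have d0 z : unit_disc z -> 1 - (a k)^* * z != 0 by exact: blaschke_den_neq0.
have d2 z : unit_disc z -> (1 - (a k)^* * z) * (1 - (a k)^* * z) != 0.
  by move=> zD; rewrite mulf_neq0 // d0.
have := C1DM (C1D_cst (1 - `|a k| ^+ 2)) (C1DV d2 (C1DM hd hd)).
apply: C1D_ext => z zD; last by ring.
by rewrite /dphi; field; exact: d0.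
Qed.

Lemma di_weight (U : C -> C) (M : R) : cmeas U ->
  (forall z, unit_disc z -> cabs (U z) <= M) ->
  disc_integrable (fun z => U z * (h z)%:C).
Proof.
move=> mU UM; apply: (@di_dom _ [::] _ (fun z => M * h z)).
- by apply: cmeasM => //; exact: cmeas_weight.
- by apply: rintZ; exact: rint_weight.
- move=> z zD _; have h0 : 0 <= h z by apply: prodr_ge0 => k _; exact: powR_ge0.
  by rewrite cabsM cabsR ger0_norm // ler_wpM2r // UM.
Qed.

Definition regfac_z (e : R) k z : C :=
  (p k / 2 * (cabs (phi (a k) z) ^+ 2 + e) `^ (p k / 2 - 1))%:C * (dphi k z * (phi (a k) z)^*).
Definition regfac_b (e : R) k z : C :=
  (p k / 2 * (cabs (phi (a k) z) ^+ 2 + e) `^ (p k / 2 - 1))%:C * (phi (a k) z * (dphi k z)^*).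

Lemma C1D_reg (e : R) : 0 < e -> C1D (fun z => (reg a p e z)%:C)
  (fun z => \sum_k regfac_z e k z * \prod_(j | j != k) (regfac a p e j z)%:C)
  (fun z => \sum_k regfac_b e k z * \prod_(j | j != k) (regfac a p e j z)%:C).
Proof.
move=> e0.
have -> : (fun z => (reg a p e z)%:C) = (fun z => \prod_k (regfac a p e k z)%:C).
  by apply/funext => z; rewrite rmorph_prod.
exact: (C1D_prod (P := xpredT) (fun k _ => C1D_regfac p a_disc k e0)).
Qed.

Section pairing.
Variables (Q dQ : C -> C).
Hypothesis CQ : C1D Q dQ (fun=> 0).

(** The derivative of [B * Q * h] with respect to [z], divided by [h]: the
    logarithmic derivative of [h] is [\sum_k (p k / 2) * dphi k / phi (a k)],
    and [B] absorbs the poles. *)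
Definition wder z : C :=
  B z * dQ z + Q z * \sum_k (p k / 2 + 1)%:C * (Bx k z * dphi k z).

Lemma C1D_BQ : C1D (fun z => B z * Q z) (fun z => dblaschke z * Q z + B z * dQ z) (fun=> 0).
Proof.
have := C1DM C1D_blaschke CQ.
by apply: C1D_ext => z _ //; ring.
Qed.

Let tfac (e : R) k z : R := cabs (phi (a k) z) ^+ 2 / (cabs (phi (a k) z) ^+ 2 + e).
Let regder (e : R) z : C := dblaschke z * Q z + B z * dQ z +
  Q z * \sum_k (p k / 2)%:C * (Bx k z * dphi k z) * (tfac e k z)%:C.

Let C1D_BQreg (e : R) : 0 < e -> exists fb, C1D (fun z => B z * Q z * (reg a p e z)%:C)
  (fun z => regder e z * (reg a p e z)%:C) fb.
Proof.
move=> e0; have H := C1DM C1D_BQ (C1D_reg e0).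
eexists; apply: C1D_ext H => z _; last by reflexivity.
have pos k : 0 < cabs (phi (a k) z) ^+ 2 + e by rewrite ltr_wpDl // sqr_ge0.
suff E : B z * Q z * (\sum_k regfac_z e k z * \prod_(j | j != k) (regfac a p e j z)%:C) =
    Q z * (\sum_k (p k / 2)%:C * (Bx k z * dphi k z) * (tfac e k z)%:C) * (reg a p e z)%:C.
  by rewrite E /regder [RHS]mulrDl.
rewrite -[RHS]mulrA mulr_suml !mulr_sumr; apply: eq_bigr => k _; rewrite /regfac_z.
have -> : (reg a p e z)%:C = (regfac a p e k z)%:C * \prod_(j | j != k) (regfac a p e j z)%:C.
  by rewrite rmorph_prod (bigD1 k).
have -> : (regfac a p e k z)%:C = (cabs (phi (a k) z) ^+ 2 + e)%:C *
    ((cabs (phi (a k) z) ^+ 2 + e) `^ (p k / 2 - 1))%:C.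
  rewrite -rmorphM /= /regfac; congr (_%:C).
  move: (cabs (phi (a k) z) ^+ 2 + e) (pos k) => x x0.
  transitivity (x `^ 1 * x `^ (p k / 2 - 1)); last by rewrite powRr1 // ltW.
  by rewrite -powRD ?(gt_eqF x0) ?implybT //; congr (_ `^ _); ring.
have -> : (tfac e k z)%:C = phi (a k) z * (phi (a k) z)^* / (cabs (phi (a k) z) ^+ 2 + e)%:C.
  by rewrite -cabs_sqrC /tfac; rewrite [LHS]rmorphM fmorphV.
have -> : (p k / 2 * (cabs (phi (a k) z) ^+ 2 + e) `^ (p k / 2 - 1))%:C =
  (p k / 2)%:C * ((cabs (phi (a k) z) ^+ 2 + e) `^ (p k / 2 - 1))%:C by rewrite [LHS]rmorphM.
rewrite (blaschkeE k).
have u0 : (cabs (phi (a k) z) ^+ 2 + e)%:C != 0 :> C.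
  by rewrite -cabs_gt0 cabsR gtr0_norm.
move: ((cabs (phi (a k) z) ^+ 2 + e)%:C) u0 => u u0.
move: ((_ `^ _)%:C) => v; move: (\prod_(j | j != k) (regfac a p e j z)%:C) => w.
by field.
Qed.

Let tfac_bound e k z : 0 < e -> 0 <= tfac e k z <= 1.
Proof.
move=> e0; have pos : 0 < cabs (phi (a k) z) ^+ 2 + e by rewrite ltr_wpDl // sqr_ge0.
rewrite /tfac; apply/andP; split; first by rewrite divr_ge0 ?sqr_ge0 // ltW.
by rewrite ler_pdivrMr // mul1r lerDl ltW.
Qed.

(** For the regularized weight this is [holo_test_z] applied to the test
    function [th * B * Q * reg e]. Its derivative is [reg e] times the sum of
    the derivative of [th * B * Q] and of terms with factors [tfac], which lie
    between 0 and 1 and tend to 1; dominated convergence with the majorant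
    [negweight] gives the identity for the weight [h] itself. *)
Lemma green_pairing g th tz tb : holo g -> ctest th tz tb ->
  disc_integral (fun z => th z * wder z * (g z)^* * (h z)%:C) =
  - disc_integral (fun z => tz z * (B z * Q z) * (g z)^* * (h z)%:C).
Proof.
move=> hg Ht; have [H [rho /andP[rho0 rho1] Hr]] := Ht.
have cth z : unit_disc z -> ccont th z by move=> zD; exact: C1D_cont H zD.
have ctz z : unit_disc z -> ccont tz z by move=> /H[].
have zth z : unit_disc z -> rho < cabs z -> th z = 0 by move=> zD /(Hr z zD)[].
have ztz z : unit_disc z -> rho < cabs z -> tz z = 0 by move=> zD /(Hr z zD)[].
have cg z : unit_disc z -> ccont (fun z => (g z)^*) z.
  by move=> zD; apply: ccontJ; exact: holo_cont.
have cB z : unit_disc z -> ccont B z by move=> zD; exact: C1D_cont C1D_blaschke zD.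
have cBx k z : unit_disc z -> ccont (Bx k) z.
  by move=> zD; exact: C1D_cont (C1D_blaschke_except k) zD.
have cdp k z : unit_disc z -> ccont (dphi k) z.
  by move=> zD; exact: C1D_cont (C1D_dphi k) zD.
have cQ z : unit_disc z -> ccont Q z by move=> zD; exact: C1D_cont CQ zD.
have cF z : unit_disc z -> ccont (fun z => B z * Q z) z.
  by move=> zD; apply: ccontM; [exact: cB|exact: cQ].
have cF' z : unit_disc z -> ccont (fun z => dblaschke z * Q z + B z * dQ z) z.
  by move=> /C1D_BQ[].
have [q [q2 q0 qp]] := common_exponent p_gt.
have bd U : (forall z, unit_disc z -> ccont U z) ->
   exists2 M, 0 < M & forall z, unit_disc z -> cabs (th z * U z * (g z)^*) <= M.
  move=> cU; apply: (bounded_test rho1) => z zD.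
    by apply: ccontM; [apply: ccontM; [exact: cth|exact: cU]|exact: cg].
  by move=> rz; rewrite zth // !mul0r.
have [M1 M10 HM1] : exists2 M, 0 < M & forall z, unit_disc z ->
    cabs (tz z * (B z * Q z) * (g z)^*) <= M.
  apply: (bounded_test rho1) => z zD.
    by apply: ccontM; [apply: ccontM; [exact: ctz|exact: cF]|exact: cg].
  by move=> rz; rewrite ztz // !mul0r.
have [M2 M20 HM2] := bd _ cF'.
pose S k z : C := (p k / 2)%:C * (Bx k z * dphi k z).
have cS k z : unit_disc z -> ccont (fun z => Q z * S k z) z.
  move=> zD; apply: ccontM; first exact: cQ.
  by apply: ccontM; [exact: ccont_cst|apply: ccontM; [exact: cBx|exact: cdp]].
have /choice[m Hm] : forall k, exists M, 0 < M /\ forall z, unit_disc z ->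
    cabs (th z * (Q z * S k z) * (g z)^*) <= M.
  by move=> k; have [M M0 HM] := bd _ (cS k); exists M.
pose M := M1 + M2 + \sum_k m k.
pose T e z := (tz z * (B z * Q z) + th z * regder e z) * (g z)^*.
pose Tl z := (tz z * (B z * Q z) + th z * wder z) * (g z)^*.
have TE e z : T e z = tz z * (B z * Q z) * (g z)^* +
    th z * (dblaschke z * Q z + B z * dQ z) * (g z)^* +
    \sum_k th z * (Q z * S k z) * (g z)^* * (tfac e k z)%:C.
  have -> : \sum_k th z * (Q z * S k z) * (g z)^* * (tfac e k z)%:C =
      th z * (Q z * \sum_k (p k / 2)%:C * (Bx k z * dphi k z) * (tfac e k z)%:C) * (g z)^*.
    by rewrite !mulr_sumr mulr_suml; apply: eq_bigr => k _; rewrite /S; ring.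
  by rewrite /T /regder; ring.
have TM e z : 0 < e -> unit_disc z -> cabs (T e z) <= M.
  move=> e0 zD; rewrite TE /M; apply: (le_trans (cabsD _ _)); apply: lerD.
    by apply: (le_trans (cabsD _ _)); apply: lerD; [exact: HM1|exact: HM2].
  apply: (le_trans (cabs_sum _ _ _)); apply: ler_sum => k _.
  have /andP[t0 t1] := tfac_bound k z e0.
  rewrite cabsM cabsR ger0_norm //.
  apply: le_trans ((Hm k).2 z zD); by rewrite ler_piMr // cabs_ge0.
have mreg e : 0 < e -> cmeas (fun z => T e z * (reg a p e z)%:C).
  move=> e0; apply: cmeas_cont => z zD.
  have [fb HF] := C1D_BQreg e0; have [_ c1 _] := HF z zD.
  have cr := C1D_cont (C1D_reg e0) zD.
  have -> : (fun z => T e z * (reg a p e z)%:C) =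
     (fun z => tz z * (B z * Q z) * (g z)^* * (reg a p e z)%:C
        + th z * (regder e z * (reg a p e z)%:C) * (g z)^*).
    by apply/funext => y; rewrite /T; ring.
  apply: ccontD.
    by apply: ccontM => //; apply: ccontM; [apply: ccontM; [exact: ctz|exact: cF]|exact: cg].
  by apply: ccontM; [apply: ccontM; [exact: cth|exact: c1]|exact: cg].
have T0 n : disc_integral (fun z => T (eps R n) z * (reg a p (eps R n) z)%:C) = 0.
  have [fb HF] := C1D_BQreg (eps_gt0 R n).
  have := holo_test_z hg (ctestM Ht HF) => <-.
  by apply: eq_di => z _; rewrite /T; ring.
have cw z : unit_disc z -> ccont wder z.
  move=> zD.
  apply: ccontD; first by apply: ccontM; [exact: cB|have [] := CQ zD].
  apply: ccontM; first exact: cQ.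
  apply: ccont_sum => k _; apply: ccontM; first exact: ccont_cst.
  by apply: ccontM; [exact: cBx|exact: cdp].
have mTl : cmeas (fun z => Tl z * (h z)%:C).
  apply: cmeasM; last exact: cmeas_weight.
  apply: cmeas_cont => z zD; apply: ccontM; last exact: cg.
  by apply: ccontD; apply: ccontM; [exact: ctz|exact: cF|exact: cth|exact: cw].
have [_ lim] : disc_integrable (fun z => Tl z * (h z)%:C) /\
   ccvg (fun n => disc_integral (fun z => T (eps R n) z * (reg a p (eps R n) z)%:C))
     (disc_integral (fun z => Tl z * (h z)%:C)).
  apply: (@di_dct _ (codom a) _ _ (fun z => M * regbound p * negweight a q z)) => //.
  - by move=> n; apply: mreg; exact: eps_gt0.
  - by apply: rintZ; exact: rint_negweight.
  - move=> n z zD za; rewrite cabsM cabsR ger0_norm ?reg_ge0 // -mulrA.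
    apply: ler_pM; [exact: cabs_ge0|exact: reg_ge0|by apply: TM => //; exact: eps_gt0|].
    by apply: reg_bound => //; [exact: eps_gt0|exact: eps_le1].
  - move=> z zD za; apply: ccvgM; last exact: reg_cvg.
    have tc k : ccvg (fun n => (tfac (eps R n) k z)%:C) 1.
      have x0 : 0 < cabs (phi (a k) z) ^+ 2.
        by rewrite exprn_gt0 // phi_gt0 // notin_codom.
      rewrite -(rmorph1 (real_complex R)); apply: ccvg_real.
      have xn : cabs (phi (a k) z) ^+ 2 != 0 by rewrite gt_eqF.
      rewrite /tfac -(divff xn).
      apply: cvgM; first exact: cvg_cst.
      apply: cvgV; first exact: xn.
      rewrite -[X in _ --> X]addr0; apply: cvgD; [exact: cvg_cst|exact: eps_cvg].
    apply: (ccvg_ext (fun n => esym (TE (eps R n) z))).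
    have -> : Tl z = tz z * (B z * Q z) * (g z)^* +
        th z * (dblaschke z * Q z + B z * dQ z) * (g z)^* +
        \sum_k th z * (Q z * S k z) * (g z)^* * 1.
      rewrite /Tl /wder.
      have -> : \sum_k (p k / 2 + 1)%:C * (Bx k z * dphi k z) =
          \sum_k S k z + dblaschke z.
        rewrite /dblaschke -big_split /=; apply: eq_bigr => k _.
        by rewrite /S rmorphD rmorph1; ring.
      have -> : \sum_k th z * (Q z * S k z) * (g z)^* * 1 =
          th z * (Q z * \sum_k S k z) * (g z)^*.
        by rewrite !mulr_sumr mulr_suml; apply: eq_bigr => k _; rewrite mulr1.
      ring.
    apply: ccvgD; first by exact: ccvg_cst.
    by apply: ccvg_sum => k _; apply: ccvgM; [exact: ccvg_cst|exact: tc].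
have E0 : disc_integral (fun z => Tl z * (h z)%:C) = 0.
  by apply: (ccvg_unique lim); apply: (ccvg_ext (fun n => esym (T0 n))); exact: ccvg_cst.
have [Mw Mw0 HMw] := bd _ cw.
have i1 : disc_integrable (fun z => th z * wder z * (g z)^* * (h z)%:C).
  apply: (@di_weight _ Mw) => //; apply: cmeas_cont => z zD.
  by apply: ccontM; [apply: ccontM; [exact: cth|exact: cw]|exact: cg].
have i2 : disc_integrable (fun z => tz z * (B z * Q z) * (g z)^* * (h z)%:C).
  apply: (@di_weight _ M1) => //; apply: cmeas_cont => z zD.
  by apply: ccontM; [apply: ccontM; [exact: ctz|exact: cF]|exact: cg].
apply/eqP; rewrite -addr_eq0 -diD // -[X in _ == X]E0; apply/eqP.
by apply: eq_di => z _; rewrite /Tl; ring.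
Qed.

End pairing.
End green_weighted.

(** * Partial fractions and behaviour at the unit circle *)

Section boundary.
Variable R : realType.
Local Notation C := R[i].
Local Notation phi := (@blaschke_factor R).
Variables (s : nat) (a : 'I_s -> C) (p : 'I_s -> R).
Hypothesis a_disc : forall k, unit_disc (a k).
Hypothesis a_inj : injective a.
Hypothesis p_gt : forall k, -2 < p k.
Local Notation h := (blaschke_weight a p).
Local Notation B := (blaschke a).
Local Notation Bx := (blaschke_except a).

Lemma normC_sqr (z : C) : `|z| ^+ 2 = z * z^*.
Proof. by rewrite normc_cabs -cabs_sqrC rmorphXn. Qed.

Lemma size_prod_linear (I : finType) (P : pred I) (F : I -> {poly C}) :
  (forall i, size (F i) <= 2)%N -> (size (\prod_(i | P i) F i)%R <= #|P|.+1)%N.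
Proof.
move=> F2; apply: (leq_trans (size_poly_prod_leq _ _)).
rewrite leq_subLR addnS ltnS -sum1_card -big_split /=.
by apply: leq_sum => i _; exact: F2.
Qed.

Lemma size_one_subZX (c : C) : (size (1 - c *: 'X : {poly C})%R <= 2)%N.
Proof.
apply: (leq_trans (size_polyD _ _)); rewrite geq_max size_poly1 /= size_polyN.
by apply: (leq_trans (size_scale_leq _ _)); rewrite size_polyX.
Qed.

Lemma blaschke_frac (P : pred 'I_s) z :
  \prod_(k | P k) phi (a k) z =
  (\prod_(k | P k) (z - a k)) / \prod_(k | P k) (1 - (a k)^* * z).
Proof. by rewrite /blaschke_factor big_split /= prodfV. Qed.

Lemma den_prod_neq0 (P : pred 'I_s) z : unit_disc z -> \prod_(k | P k) (1 - (a k)^* * z) != 0.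
Proof. by move=> zD; apply/prodf_neq0 => k _; exact: blaschke_den_neq0. Qed.

Lemma num_prod_neq0 (P : pred 'I_s) z : (forall k, P k -> z != a k) -> \prod_(k | P k) (z - a k) != 0.
Proof. by move=> zD; apply/prodf_neq0 => k /zD; rewrite subr_eq0. Qed.

Lemma blaschke_neq0 z : unit_disc z -> z \notin codom a -> B z != 0.
Proof. by move=> zD /notin_codom za; apply/prodf_neq0 => k _; exact: phi_neq0. Qed.

Lemma blaschke_except_neq0 k : Bx k (a k) != 0.
Proof.
apply/prodf_neq0 => j jk; apply: phi_neq0 => //.
by apply: contra jk => /eqP/a_inj ->.
Qed.

(** Clearing denominators, the two sides are polynomials of degree at most [s]
    which agree at the [s + 1] points [zeta] and [a k]. *)
Lemma partial_fractions zeta z : unit_disc zeta -> unit_disc z ->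
  zeta \notin codom a -> z \notin codom a -> z != zeta ->
  (B z * (z - zeta))^-1 = (B zeta)^-1 / (z - zeta)
   + \sum_k (1 - `|a k| ^+ 2) / ((a k - zeta) * Bx k (a k)) / (z - a k).
Proof.
move=> eD zD ea za ze; have ea' := notin_codom ea; have za' := notin_codom za.
pose n y := \prod_k (1 - (a k)^* * y).
pose m y := \prod_k (y - a k).
pose mx k y := \prod_(j | j != k) (y - a j).
have n0 y : unit_disc y -> n y != 0 by move=> yD; exact: den_prod_neq0.
have m0 y : (forall k, y != a k) -> m y != 0 by move=> ya; exact: num_prod_neq0.
have mx0 k : mx k (a k) != 0.
  by apply: num_prod_neq0 => j jk; apply: contra jk => /eqP/a_inj ->.
have mE k y : m y = (y - a k) * mx k y by rewrite /m (bigD1 k).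
pose c0 := n zeta / m zeta.
pose c k := n (a k) / ((a k - zeta) * mx k (a k)).
have az k : a k - zeta != 0 by rewrite subr_eq0 eq_sym.
pose P : {poly C} := \prod_k (1 - (a k)^* *: 'X)
  - (c0 *: \prod_k ('X - (a k)%:P)
     + \sum_k c k *: (('X - zeta%:P) * \prod_(j | j != k) ('X - (a j)%:P))).
have PE y : P.[y] = n y - (c0 * m y + \sum_k c k * ((y - zeta) * mx k y)).
  rewrite /P hornerD hornerN hornerD hornerZ !horner_prod horner_sum /n /m.
  congr (_ - (_ * _ + _)).
  - by apply: eq_bigr => k _; rewrite hornerD hornerN hornerZ hornerX hornerC.
  - by apply: eq_bigr => k _; rewrite hornerXsubC.
  apply: eq_bigr => k _; rewrite hornerZ hornerM hornerXsubC horner_prod.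
  congr (_ * (_ * _)).
  by apply: eq_bigr => j _; rewrite hornerXsubC.
have P0 : P = 0.
  apply: (@roots_geq_poly_eq0 _ P (zeta :: codom a)).
  - rewrite /= {1}/root PE big1 ?addr0 => [|k _]; last by rewrite subrr mul0r mulr0.
    rewrite /c0 divfK ?m0 // subrr eqxx /=.
    apply/allP => y /codomP[k ->]; rewrite /root PE (mE k) subrr mul0r mulr0 add0r.
    rewrite (bigD1 k) //= big1 ?addr0 => [|j jk]; last first.
      by rewrite /mx (bigD1 k) 1?eq_sym //= subrr mul0r !mulr0.
    by rewrite /c divfK ?mulf_neq0 ?az // subrr.
  - by rewrite /= ea map_inj_uniq ?enum_uniq.
  - rewrite /= size_codom card_ord.
    apply: (leq_trans (size_polyD _ _)); rewrite geq_max size_polyN; apply/andP; split.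
      apply: (leq_trans (size_prod_linear _ _)) => [k|]; first exact: size_one_subZX.
      by rewrite card_ord.
    apply: (leq_trans (size_polyD _ _)); rewrite geq_max; apply/andP; split.
      apply: (leq_trans (size_scale_leq _ _)); apply: (leq_trans (size_prod_linear _ _)) => [k|].
        by rewrite size_XsubC.
      by rewrite card_ord.
    apply: (leq_trans (size_sum _ _ _)); apply/bigmax_leqP => k _.
    apply: (leq_trans (size_scale_leq _ _)); apply: (leq_trans (size_polyMleq _ _)).
    rewrite size_XsubC addSn /= add1n ltnS.
    apply: (leq_trans (size_prod_linear _ _)) => [j|]; first by rewrite size_XsubC.
    have := cardC1 k; rewrite card_ord => h1.
    by rewrite (eq_card (B := predC1 k)) // h1 prednK //; case: s k {h1} => [[]|].
have /eqP := PE z; rewrite P0 horner0 eq_sym subr_eq0 => /eqP nE.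
have ze0 : z - zeta != 0 by rewrite subr_eq0.
have -> : (B z * (z - zeta))^-1 = n z / (m z * (z - zeta)).
  rewrite /blaschke blaschke_frac -/(n z) -/(m z); field.
  by rewrite ze0 n0 // m0.
rewrite nE mulrDl; congr (_ + _).
  rewrite /c0 /blaschke blaschke_frac -/(n zeta) -/(m zeta); field.
  by rewrite ze0 n0 // !m0.
rewrite mulr_suml; apply: eq_bigr => k _.
have -> : (1 - `|a k| ^+ 2) / ((a k - zeta) * Bx k (a k)) = c k.
  rewrite /c /blaschke_except blaschke_frac -/(mx k (a k)).
  have -> : n (a k) = (1 - (a k)^* * a k) * \prod_(j | j != k) (1 - (a j)^* * a k).
    by rewrite /n (bigD1 k).
  rewrite normC_sqr [a k * _]mulrC; field.
  by rewrite az mx0 den_prod_neq0.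
have mz0 : mx k z != 0 by apply: num_prod_neq0 => j _; exact: za'.
rewrite (mE k); field.
by rewrite mz0 !subr_eq0 ze za'.
Qed.

(** Since 1 - |al| is at least m / 2, the denominator in [one_sub_phi2] stays
    away from zero. *)
Lemma near_boundary (m : R) al z : 0 < m -> m <= 1 - cabs al ^+ 2 ->
  unit_disc al -> unit_disc z ->
  1 - cabs (phi al z) ^+ 2 <= 4 / m ^+ 2 * (1 - cabs z ^+ 2) /\
  m / 2 <= cabs (1 - al^* * z).
Proof.
move=> m0 hm aD zD; have D1 := blaschke_den_ge al zD; have a0 := cabs_ge0 al.
have a1 : cabs al < 1 by apply/unit_discE.
have z1 : cabs z < 1 by apply/unit_discE.
have z0 := cabs_ge0 z.
have D2 : m / 2 <= cabs (1 - al^* * z) by nra.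
split=> //; rewrite one_sub_phi2 //.
have t0 : 0 <= 1 - cabs z ^+ 2 by nra.
set D := cabs _ in D2 *.
have D3 : (D ^+ 2)^-1 <= 4 / m ^+ 2.
  rewrite -[4 / _]invf_div lef_pV2 ?posrE ?exprn_gt0 ?divr_gt0 ?exprn_gt0 //; last lra.
  by nra.
rewrite mulrC mulrA ler_wpM2r // -[leRHS]mulr1; apply: ler_pM => //.
- by rewrite invr_ge0 sqr_ge0.
- by nra.
- by nra.
Qed.

Lemma one_subX_le (t : R) n : 0 <= t -> t <= 1 -> 1 - t ^+ n <= n%:R * (1 - t).
Proof.
move=> t0 t1; elim: n => [|n IH]; first by rewrite expr0 subrr mul0r.
have tn : 0 <= t ^+ n by rewrite exprn_ge0.
have tn1 : t ^+ n <= 1 by rewrite exprn_ile1.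
by rewrite exprS -natr1; nra.
Qed.

Lemma one_sub_prod_le (y : 'I_s -> R) : (forall k, 0 <= y k <= 1) ->
  1 - \prod_k y k <= \sum_k (1 - y k).
Proof.
move=> hy; suff [] : 0 <= \prod_k y k <= 1 /\ 1 - \prod_k y k <= \sum_k (1 - y k) by [].
elim/big_ind2: _ => [|u v u' v' [/andP[? ?] ?] [/andP[? ?] ?]|k _].
- by rewrite ler01 lexx subrr.
- by split; [apply/andP; split|]; nra.
- by [].
Qed.

Lemma powR_lower (x r : R) n : 0 < x -> x <= 1 -> r <= (2 * n)%:R ->
  (x ^+ 2) ^+ n <= x `^ r.
Proof.
move=> x0 x1 rn; rewrite -exprM -powR_mulrn ?(ltW x0) //.
by apply: ger_powR => //; rewrite x0.
Qed.

Lemma exponent_bound : exists n : nat, forall k, p k + 2 <= (2 * n)%:R.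
Proof.
have p0 : 0 <= \sum_k `|p k| by apply: sumr_ge0.
exists (Num.bound (2 + \sum_k `|p k|)) => k.
have := archi_boundP (addr_ge0 (ler0n R 2) p0).
have := ler_norm (p k).
have : `|p k| <= \sum_k `|p k| by rewrite (bigD1 k) //= lerDl sumr_ge0.
rewrite natrM; set N := _%:R; lra.
Qed.

Lemma boundary_margin zeta : unit_disc zeta -> exists m : R,
  [/\ 0 < m, m <= 1, m <= 1 - cabs zeta ^+ 2 & forall k, m <= 1 - cabs (a k) ^+ 2].
Proof.
move=> eD; exists (\big[Num.min/1 - cabs zeta ^+ 2]_k (1 - cabs (a k) ^+ 2)).
have pos z : unit_disc z -> 0 < 1 - cabs z ^+ 2.
  by move=> /unit_discE zD; rewrite subr_gt0 expr_lt1 ?cabs_ge0.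
have le0 : \big[Num.min/1 - cabs zeta ^+ 2]_k (1 - cabs (a k) ^+ 2) <= 1 - cabs zeta ^+ 2.
  exact: bigmin_le_id.
split=> //.
- by elim/big_ind: _ => [|x y hx hy|k _]; [exact: pos|rewrite lt_min hx|exact: pos].
- by apply: (le_trans le0); rewrite gerBl sqr_ge0.
- by move=> k; exact: bigmin_le.
Qed.

(** Multiplying the difference by [(B z * (z - zeta))^*] leaves [(W - 1) * u -
    (1 - |z|^2) / (1 - zeta^* * z)], where |u| <= 1 and [W = |B|^2 h] is the
    product of the [|phi_k| `^ (p k + 2)]. These exponents are positive, so 1 -
    W is at most a constant times the sum of the defects 1 - |phi_k|^2, which
    are O(1 - |z|^2). On the annulus [B], [z - zeta] and [h] are bounded below,
    the last because W <= h; the factor [h z] on the right is what makes the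
    bound integrable against [K w]. *)
Lemma boundary_estimate zeta : unit_disc zeta -> exists d C0 : R,
  [/\ 0 < d < 1/2, cabs zeta ^+ 2 < 1 - 2 * d,
      forall k, cabs (a k) ^+ 2 < 1 - 2 * d, 0 <= C0 &
      forall z, unit_disc z -> 1 - 2 * d < cabs z ^+ 2 ->
        cabs (B z * (z / (1 - zeta^* * z)) * (h z)%:C - ((B z * (z - zeta))^*)^-1)
          <= C0 * (1 - cabs z ^+ 2) * h z].
Proof.
move=> eD; have [m [m0 m1 me ma]] := boundary_margin eD.
have [n hn] := exponent_bound.
pose A : R := 4 / m ^+ 2.
have m2 : 0 < m ^+ 2 by rewrite exprn_gt0.
have A0 : 0 < A by rewrite divr_gt0.
have Am : A * m ^+ 2 = 4 by rewrite /A divfK // gt_eqF.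
pose K1 : R := \sum_(k < s) n%:R * A.
have K10 : 0 <= K1 by apply: sumr_ge0 => k _; rewrite mulr_ge0 // ltW.
pose b : R := \prod_(k < s) 2^-1 * (m / 4).
pose c : R := \prod_(k < s) 2^-1 ^+ n.
have b0 : 0 < b by rewrite mulr_gt0 ?divr_gt0 // prodr_gt0.
have c0 : 0 < c by rewrite prodr_gt0 // => k _; rewrite exprn_gt0.
(* With t = 1 - |z|^2 < m^2 / 8 one has A t <= 1/2, so that |phi|^2 is at
   least 1/2 on the annulus for each Blaschke factor involved. *)
exists (m ^+ 2 / 16), ((K1 + 2 / m) / (b * c)); split.
- by apply/andP; split; [rewrite divr_gt0|nra].
- by nra.
- by move=> k; have := ma k; nra.
- apply: divr_ge0; last exact/ltW/mulr_gt0.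
  by apply: addr_ge0 => //; apply: divr_ge0 => //; exact: ltW.
move=> z zD hz; set t := 1 - cabs z ^+ 2.
have t0 : 0 <= t.
  by rewrite /t subr_ge0 exprn_ile1 ?cabs_ge0 // ltW //; apply/unit_discE.
have At : A * t <= 1/2 by rewrite /t; nra.
have half al : unit_disc al -> m <= 1 - cabs al ^+ 2 ->
    [/\ 1 - cabs (phi al z) ^+ 2 <= A * t, m / 2 <= cabs (1 - al^* * z),
        cabs (phi al z) < 1 & 1/2 <= cabs (phi al z) ^+ 2].
  move=> aD ha; have [h1 h2] := near_boundary m0 ha aD zD.
  by split=> //; [exact: phi_lt1|move: h1; rewrite -/A -/t; lra].
have half1 al : unit_disc al -> m <= 1 - cabs al ^+ 2 -> 1/2 <= cabs (phi al z).
  move=> aD ha; have [_ _ h1 h2] := half al aD ha; have := cabs_ge0 (phi al z); nra.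
have x0 k : 0 < cabs (phi (a k) z) by have := half1 _ (a_disc k) (ma k); lra.
pose y k := cabs (phi (a k) z) `^ (p k + 2).
pose W : R := \prod_k y k.
have yb k : 0 <= y k <= 1 /\ 1 - y k <= n%:R * A * t.
  have [h1 _ h2 h3] := half _ (a_disc k) (ma k).
  have l := powR_lower (x0 k) (ltW h2) (hn k); rewrite -/(y k) in l.
  have l2 := @one_subX_le (cabs (phi (a k) z) ^+ 2) n (sqr_ge0 _)
    (exprn_ile1 _ (cabs_ge0 _) (ltW h2)).
  have : n%:R * (1 - cabs (phi (a k) z) ^+ 2) <= n%:R * (A * t) by rewrite ler_wpM2l.
  split; last lra.
  rewrite powR_ge0 /= -[leRHS](powRr0 (cabs (phi (a k) z))).
  by apply: ger_powR; [rewrite x0 ltW|have := p_gt k; lra].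
have W1 : 1 - W <= K1 * t.
  apply: (le_trans (one_sub_prod_le (fun k => (yb k).1))).
  by rewrite /K1 mulr_suml; apply: ler_sum => k _; have [] := yb k.
have W0 : W <= 1 by apply: prodr_ile1 => k _; exact: (yb k).1.
have cW : c <= W.
  apply: ler_prod => k _; rewrite exprn_ge0 ?invr_ge0 //=.
  have [_ _ h2 h3] := half _ (a_disc k) (ma k).
  apply: le_trans (powR_lower (x0 k) (ltW h2) (hn k)).
  by apply: lerXn2r; rewrite ?nnegrE ?sqr_ge0 // ?invr_ge0 //; lra.
have Wh : W <= h z.
  apply: ler_prod => k _; rewrite powR_ge0 /=.
  have [_ _ h2 _] := half _ (a_disc k) (ma k).
  by apply: ger_powR; [rewrite x0 ltW|lra].
have WE : B z * (B z)^* * (h z)%:C = W%:C.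
  rewrite -cabs_sqrC -rmorphM; congr (_%:C).
  rewrite /blaschke cabs_prod -prodrXl -big_split /=; apply: eq_bigr => k _.
  rewrite /y addrC powRD ?(gt_eqF (x0 k)) ?implybT //; congr (_ * _).
  by rewrite powR_mulrn // ltW.
have Bb : \prod_(k < s) 2^-1 <= cabs (B z).
  rewrite /blaschke cabs_prod; apply: ler_prod => k _; rewrite invr_ge0 ler0n /=.
  by have := half1 _ (a_disc k) (ma k); lra.
have [_ e2 e3 _] := half _ eD me; have e4 := half1 _ eD me.
have de := blaschke_den_neq0 eD zD.
have zeE : z - zeta = phi zeta z * (1 - zeta^* * z) by rewrite phiE divfK.
have zeb : m / 4 <= cabs (z - zeta) by rewrite zeE cabsM; nra.
have db : b <= cabs (B z * (z - zeta)).
  rewrite cabsM; apply: ler_pM => //; last by rewrite divr_ge0 // ltW.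
  by apply: prodr_ge0 => k _; rewrite invr_ge0.
have d0 : B z * (z - zeta) != 0 by rewrite -cabs_gt0 (lt_le_trans b0).
have dJ : (B z * (z - zeta))^* != 0 by rewrite conjC_eq0.
set X := _ - _.
have XE : X * (B z * (z - zeta))^* =
   (W%:C - 1) * (z * (z - zeta)^* / (1 - zeta^* * z)) - t%:C / (1 - zeta^* * z).
  rewrite /X -WE mulrBl mulVf // rmorphM rmorphB /=.
  have -> : t%:C = 1 - z * z^* by rewrite /t rmorphB rmorph1 /= cabs_sqrC.
  by move: ((B z)^*) => v; move: ((h z)%:C) => u; field.
have XB : cabs X * cabs (B z * (z - zeta)) <= (K1 + 2 / m) * t.
  rewrite -[cabs (B z * _)]cabsJ -cabsM XE [leRHS]mulrDl.
  apply: (le_trans (cabsB _ _)); apply: lerD.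
    rewrite cabsM -[leRHS]mulr1; apply: ler_pM; rewrite ?cabs_ge0 //.
      rewrite -(rmorph1 (real_complex R)) -rmorphB /= cabsR distrC ger0_norm //.
      by rewrite subr_ge0.
    have -> : cabs (z * (z - zeta)^* / (1 - zeta^* * z)) = cabs z * cabs (phi zeta z).
      by rewrite phiE !cabsM cabsJ mulrA.
    have z1 : cabs z < 1 by apply/unit_discE.
    by have := cabs_ge0 z; have := cabs_ge0 (phi zeta z); nra.
  rewrite cabsM cabsV cabsR ger0_norm // mulrC ler_wpM2r //.
  by rewrite -[2 / m]invf_div lef_pV2 ?posrE ?divr_gt0 // (lt_le_trans _ e2) // divr_gt0.
have X1 : cabs X * b <= (K1 + 2 / m) * t.
  by apply: le_trans XB; rewrite ler_wpM2l // cabs_ge0.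
have X2 : cabs X * b * c <= (K1 + 2 / m) * t * h z.
  by apply: ler_pM => //; [rewrite mulr_ge0 ?cabs_ge0 // ltW|exact: ltW|exact: le_trans cW Wh].
rewrite [leRHS](_ : _ = (K1 + 2 / m) * t * h z / (b * c)); last by ring.
have bc : 0 < b * c by exact: mulr_gt0.
by rewrite (ler_pdivlMr _ _ bc) [leLHS]mulrA.
Qed.

End boundary.

(** * The reproducing kernel *)

Section kernel.
Variable R : realType.
Local Notation C := R[i].
Local Notation T2 := (measurableTypeR R * measurableTypeR R)%type.
Local Notation disc := (@disc2 R : set T2).
Local Notation toC := (@to_complex R).
Local Notation phi := (@blaschke_factor R).

(** Closed under the algebraic operations, this class contains all explicit
    functions of the formula and lies in the weighted Bergman space. *)
Definition bounded_holo (f : C -> C) := holo f /\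
  exists M, forall z, unit_disc z -> cabs (f z) <= M.

Lemma bounded_holo_cst (c : C) : bounded_holo (fun=> c).
Proof. by split; [move=> z _; exists 0; exact: wirt_cst|exists (cabs c)]. Qed.

Lemma bounded_holo_id : bounded_holo id.
Proof.
split; first by move=> z _; exists 1; exact: wirt_id.
by exists 1 => z /unit_discE/ltW.
Qed.

Lemma bounded_holoD f g : bounded_holo f -> bounded_holo g -> bounded_holo (fun z => f z + g z).
Proof.
move=> [hf [M HM]] [hg [N HN]]; split.
  move=> z zD; have [p hp] := hf z zD; have [q hq] := hg z zD.
  by exists (p + q); have := wirtD hp hq; rewrite addr0.
exists (M + N) => z zD; apply: (le_trans (cabsD _ _)).
by apply: lerD; [exact: HM|exact: HN].
Qed.

Lemma bounded_holoM f g : bounded_holo f -> bounded_holo g -> bounded_holo (fun z => f z * g z).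
Proof.
move=> [hf [M HM]] [hg [N HN]]; split.
  move=> z zD; have [p hp] := hf z zD; have [q hq] := hg z zD.
  by eexists; have := wirtM hp hq; rewrite mul0r mulr0 addr0; apply.
exists (M * N) => z zD; rewrite cabsM.
by apply: ler_pM; rewrite ?cabs_ge0 //; [exact: HM|exact: HN].
Qed.

Lemma bounded_holo_sum (I : Type) (r : seq I) (P : pred I) (F : I -> C -> C) :
  (forall i, bounded_holo (F i)) -> bounded_holo (fun z => \sum_(i <- r | P i) F i z).
Proof.
move=> H; elim: r => [|i r IH]; first by rewrite sumfun_nil; exact: bounded_holo_cst.
by rewrite sumfun_cons; case: ifPn => // _; exact: bounded_holoD.
Qed.

Lemma bounded_holo_prod (I : Type) (r : seq I) (P : pred I) (F : I -> C -> C) :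
  (forall i, bounded_holo (F i)) -> bounded_holo (fun z => \prod_(i <- r | P i) F i z).
Proof.
move=> H; elim: r => [|i r IH].
  by rewrite (_ : (fun z => _) = fun=> 1); [exact: bounded_holo_cst|apply/funext => z; rewrite big_nil].
have -> : (fun z => \prod_(j <- i :: r | P j) F j z) =
  (if P i then fun z => F i z * \prod_(j <- r | P j) F j z
   else fun z => \prod_(j <- r | P j) F j z).
  by apply/funext => z; rewrite big_cons; case: ifP.
by case: ifPn => // _; exact: bounded_holoM.
Qed.

Lemma bounded_holo_den al : unit_disc al -> bounded_holo (fun z => (1 - al^* * z)^-1).
Proof.
move=> aD; split.
  move=> z zD; have d0 := blaschke_den_neq0 aD zD.
  have w1 : wirt (fun z => 1 - al^* * z) z (- al^*) 0.
    have := wirtD (wirt_cst 1 z) (wirtN (wirtM (wirt_cst al^* z) (wirt_id z))).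
    by rewrite !(mul0r, mulr0, addr0, add0r, mulr1, oppr0).
  by eexists; have := @wirtV R (fun z => 1 - al^* * z) z _ _ d0 w1; rewrite oppr0 mul0r; apply.
have a1 : 0 < 1 - cabs al by rewrite subr_gt0; apply/unit_discE.
exists (1 - cabs al)^-1 => z zD; have le := blaschke_den_ge al zD.
by rewrite cabsV lef_pV2 // posrE (lt_le_trans a1).
Qed.

Lemma bounded_holo_phi al : unit_disc al -> bounded_holo (phi al).
Proof.
move=> aD; apply: (bounded_holoM (f := fun z => z - al)); last exact: bounded_holo_den.
by apply: bounded_holoD; [exact: bounded_holo_id|exact: bounded_holo_cst].
Qed.

Lemma holo_analytic (f : C -> C) : holo f -> analytic_in_disc f.
Proof. by move=> hf z /hf[p]; exact: wirt_derivable. Qed.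

Lemma analytic_holo (f : C -> C) : analytic_in_disc f -> holo f.
Proof. by move=> hf z /hf/derivable_wirt. Qed.

Variables (s : nat) (a : 'I_s -> C) (p : 'I_s -> R) (K : C -> C -> C).
Hypothesis a_disc : forall k, unit_disc (a k).
Hypothesis a_inj : injective a.
Hypothesis p_gt : forall k, -2 < p k.
Local Notation h := (blaschke_weight a p).
Local Notation B := (blaschke a).
Local Notation Bx := (blaschke_except a).
Local Notation dphi := (dphi a).
Hypothesis K_kernel : reproducing_kernel h K.

Lemma bounded_holo_blaschke : bounded_holo B.
Proof. by apply: bounded_holo_prod => k; exact: bounded_holo_phi. Qed.

Lemma bounded_holo_blaschke_except k : bounded_holo (Bx k).
Proof. by apply: bounded_holo_prod => j; exact: bounded_holo_phi. Qed.

Lemma bounded_holo_dphi k : bounded_holo (dphi k).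
Proof.
rewrite /dphi; have -> : (fun z => (1 - `|a k| ^+ 2) / (1 - (a k)^* * z) ^+ 2) =
   (fun z => (1 - `|a k| ^+ 2) * ((1 - (a k)^* * z)^-1 * (1 - (a k)^* * z)^-1)).
  by apply/funext => z; rewrite expr2 invfM.
by apply: bounded_holoM; [exact: bounded_holo_cst|apply: bounded_holoM; exact: bounded_holo_den].
Qed.

Lemma weight_ge0 z : 0 <= h z.
Proof. by apply: prodr_ge0 => k _; exact: powR_ge0. Qed.

Lemma bounded_bergman (f : C -> C) : analytic_in_disc f ->
  (exists M, forall z, unit_disc z -> cabs (f z) <= M) -> bergman2 h f.
Proof.
move=> af [M HM]; split=> //; have hf := analytic_holo af.
have mf : measurable_fun disc (fun w => cabs (f (toC w)) ^+ 2 * h (toC w)).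
  apply: measurable_funM; last by have [] := cmeas_weight p a_disc.
  apply: measurable_funX; apply: (@measurable_cont_real _ (fun z => cabs (f z)) [::]) => z zD _.
  by apply: ccont_cabs; exact: holo_cont.
have ri : rint (fun z => cabs (f z) ^+ 2 * h z).
  apply: (@rint_le _ _ (fun z => M ^+ 2 * h z)) => //.
    move=> z zD; rewrite ger0_norm; last by apply: mulr_ge0; [exact: sqr_ge0|exact: weight_ge0].
    rewrite ler_wpM2r ?weight_ge0 //; have := HM z zD; have := cabs_ge0 (f z); nra.
  exact: (rintZ (M ^+ 2) (rint_weight a_disc a_inj p_gt)).
have /integrableP[_] := ri; apply: le_lt_trans; apply: ge0_le_integral => //=.
- exact: measurable_disc2.
- by move=> w _; rewrite lee_fin; apply: mulr_ge0; [exact: sqr_ge0|exact: weight_ge0].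
- exact/measurable_EFinP.
- by apply/measurable_EFinP; exact: (measurableT_comp (@normr_measurable R setT) mf).
- by move=> w _; rewrite lee_fin ler_norm.
Qed.

Lemma holo_conj_kernel w : unit_disc w -> holo (fun z => (K w z)^*).
Proof. by move=> wD; apply: analytic_holo; have [_ /(_ w wD)] := K_kernel. Qed.

(** The reproducing property applied to the constant function 1. *)
Lemma kernel_integrable w : unit_disc w -> disc_integrable (fun z => K w z * (h z)%:C).
Proof.
move=> wD; have [_ _ /(_ (fun=> 1) w)[]//] := K_kernel.
  apply: bounded_bergman; first by apply: holo_analytic; have [] := bounded_holo_cst 1.
  by have [] := bounded_holo_cst 1.
by move=> + _; under eq_fun do rewrite mul1r.
Qed.

(** Apply the reproducing property to [f = wder q dq], insert the cutoffs and
    let them tend to 1. [uE] rewrites the truncated integral: [green_pairing]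
    moves the derivative to the cutoff, [e] replaces [B * q * h] at the cost of
    the integral of [U], which tends to 0, and partial fractions with
    [pole_value] evaluate the rest. *)
Lemma kernel_expansion_off w zeta : unit_disc w -> unit_disc zeta -> zeta \notin codom a ->
  wder a p (fun z => z / (1 - zeta^* * z)) (fun z => (1 - zeta^* * z) ^- 2) w =
  ((B zeta)^-1)^* * K w zeta +
  \sum_k ((1 - `|a k| ^+ 2) / ((a k - zeta) * Bx k (a k)))^* * K w (a k).
Proof.
move=> wD eD ea; pose q z := z / (1 - zeta^* * z); pose dq z := (1 - zeta^* * z) ^- 2.
rewrite -/q -/dq; set f := wder a p q dq.
pose c k : C := (1 - `|a k| ^+ 2) / ((a k - zeta) * Bx k (a k)).
rewrite [RHS](_ : _ = ((B zeta)^-1)^* * K w zeta + \sum_k (c k)^* * K w (a k)) //.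
pose g z := (K w z)^*; have hg : holo g := holo_conj_kernel wD.
have gE z : (g z)^* = K w z by rewrite /g conjCK.
have Cq : C1D q dq (fun=> 0).
  have hd : C1D (fun z => 1 - zeta^* * z) (fun=> - zeta^*) (fun=> 0).
    have := C1DB (C1D_cst 1) (C1DM (C1D_cst zeta^*) (@C1D_id R)).
    by apply: C1D_ext => z _; ring.
  have hz z : unit_disc z -> 1 - zeta^* * z != 0 by exact: blaschke_den_neq0.
  have := C1DM (@C1D_id R) (C1DV hz hd).
  apply: C1D_ext => z zD; last by ring.
  by rewrite /dq; field; exact: hz.
have hbq : bounded_holo q by apply: bounded_holoM; [exact: bounded_holo_id|exact: bounded_holo_den].
have hbdq : bounded_holo dq.
  rewrite /dq (_ : (fun z => _) = fun z => (1 - zeta^* * z)^-1 * (1 - zeta^* * z)^-1).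
    by apply: bounded_holoM; exact: bounded_holo_den.
  by apply/funext => z; rewrite expr2 invfM.
have [hf [M HM]] : bounded_holo f.
  apply: bounded_holoD; first by apply: bounded_holoM; [exact: bounded_holo_blaschke|].
  apply: bounded_holoM => //; apply: bounded_holo_sum => k; apply: bounded_holoM; first exact: bounded_holo_cst.
  by apply: bounded_holoM; [exact: bounded_holo_blaschke_except|exact: bounded_holo_dphi].
have [_ _ /(_ f w)[]//] := K_kernel.
  by apply: bounded_bergman; [exact: holo_analytic|exists M].
set F := fun z => _; move=> iF ->.
have [d [C0 [/andP[d0 d1] de da C00 est]]] := boundary_estimate a_disc p_gt eD.
pose dl n := d * eps R n.
have dl0 n : 0 < dl n by exact: (del_gt0 d0).
have dl1 n : dl n < 1 by have := del_le d0 n; rewrite -/(dl n); lra.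
pose tz n z := (dcut (dl n) z)%:C * z^*.
have Ht n := ctest_cut (dl0 n) (dl1 n).
have lim1 := cut_limit d0 d1 iF.
pose e z := ((B z * (z - zeta))^*)^-1.
pose U z := z^* * (B z * q z * (h z)%:C - e z) * (g z)^*.
pose ss := zeta :: codom a.
have cq z : unit_disc z -> ccont q z by exact: C1D_cont Cq.
have cB z : unit_disc z -> ccont B z by move=> zD; exact: holo_cont bounded_holo_blaschke.1 zD.
have cg z : unit_disc z -> ccont (fun z => (g z)^*) z.
  by move=> zD; apply: ccontJ; exact: holo_cont.
have mg : cmeas (fun z => (g z)^*) by apply: cmeas_cont.
have mw : cmeas (fun z => (h z)%:C) by exact: cmeas_weight.
have me : cmeas e.
  apply: (@cmeas_off _ ss) => z zD; rewrite inE negb_or => /andP[ze za].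
  apply: ccontV.
    by rewrite conjC_eq0 mulf_neq0 ?subr_eq0 // blaschke_neq0.
  apply: ccontJ; apply: ccontM; first exact: cB.
  by apply: ccontB; [exact: ccont_id|exact: ccont_cst].
have mJ : cmeas (fun z : C => z^*).
  by apply: cmeas_cont => z _; apply: ccontJ; exact: ccont_id.
have mBq : cmeas (fun z => B z * q z).
  by apply: cmeas_cont => z zD; apply: ccontM; [exact: cB|exact: cq].
have mU : cmeas U.
  apply: cmeasM => //; apply: cmeasM => //.
  apply: cmeasD; first exact: cmeasM.
  have -> : (fun z => - e z) = (fun z => (-1) * e z) by apply/funext => z; rewrite mulN1r.
  by apply: cmeasM => //; apply: cmeas_cont => z _; exact: ccont_cst.
have iK := kernel_integrable wD.
pose G z := C0 * (`|complex.Re (K w z * (h z)%:C)| + `|complex.Im (K w z * (h z)%:C)|).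
have rG : rint G by apply: rintZ; exact: di_rint iK.
have lim2 := boundary_limit d0 d1 mU rG.
have {}lim2 : ccvg (fun n => disc_integral (fun z => (dcut (dl n) z)%:C * U z)) 0.
  apply: (lim2 [::]) => [z|z zD zd _]; first by rewrite mulr_ge0 // addr_ge0.
  have E := est z zD zd; rewrite -/(q z) -/(e z) in E.
  rewrite /U !cabsM cabsJ gE /G.
  have z1 : cabs z <= 1 by apply/ltW/unit_discE.
  have k1 := cabs_le_ReIm (K w z * (h z)%:C).
  rewrite cabsM cabsR ger0_norm ?weight_ge0 // in k1.
  have t0 : 0 <= 1 - cabs z ^+ 2 by rewrite subr_ge0 exprn_ile1 ?cabs_ge0.
  have x0 := cabs_ge0 (B z * q z * (h z)%:C - e z).
  have k0 := cabs_ge0 (K w z).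
  apply: (@le_trans _ _ (C0 * (1 - cabs z ^+ 2) * h z * cabs (K w z))).
    apply: ler_wpM2r => //; apply: le_trans E.
    by rewrite ler_piMl.
  rewrite (_ : _ * h z * cabs (K w z) = C0 * (1 - cabs z ^+ 2) * (cabs (K w z) * h z)); last by ring.
  rewrite (mulrCA (1 - cabs z ^+ 2)) -mulrA; apply: ler_wpM2l => //.
  exact: ler_wpM2l.
pose i n al := disc_integral (fun z => tz n z / (z - al)^*).
have lim3 al : unit_disc al -> cabs al ^+ 2 < 1 - 2 * d -> ccvg (fun n => i n al) (-1).
  by move=> alD ald; exact: (point_mass_limit d0 d1 alD ald).
pose rho0 : C := (B zeta)^-1.
(* Outside [ss] the function [e] is the conjugate of the sum of partial
   fractions. *)
have uE n : disc_integral (fun z => (cut (dl n) z)%:C * F z) =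
   - disc_integral (fun z => (dcut (dl n) z)%:C * U z)
   - (rho0^* * ((g zeta)^* * i n zeta) + \sum_k (c k)^* * ((g (a k))^* * i n (a k))).
  have -> : disc_integral (fun z => (cut (dl n) z)%:C * F z) =
      disc_integral (fun z => (cut (dl n) z)%:C * f z * (g z)^* * (h z)%:C).
    by apply: eq_di => z _; rewrite /F gE; ring.
  rewrite (green_pairing a_disc a_inj p_gt Cq hg (Ht n)) -/(tz n).
  have [_ [r /andP[_ r1] Hr]] := Ht n.
  have ctz z : unit_disc z -> ccont (tz n) z by have [H _] := Ht n; move=> /H[].
  have [M1 _ HM1] : exists2 M, 0 < M & forall z, unit_disc z ->
      cabs (tz n z * (B z * q z) * (g z)^*) <= M.
    apply: (bounded_test r1) => z zD.
      apply: ccontM; last exact: cg.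
      by apply: ccontM; [exact: ctz|apply: ccontM; [exact: cB|exact: cq]].
    by move=> rz; have [_ t0 _] := Hr z zD rz; rewrite /tz t0 !mul0r.
  have [M2 _ HM2] : exists2 M, 0 < M & forall z, unit_disc z ->
      cabs ((g z)^* * tz n z) <= M.
    apply: (bounded_test r1) => z zD.
      by apply: ccontM; [exact: cg|exact: ctz].
    by move=> rz; have [_ t0 _] := Hr z zD rz; rewrite /tz t0 mulr0.
  have mt : cmeas (tz n) by exact: cmeas_cont.
  have i1 : disc_integrable (fun z => tz n z * (B z * q z) * (g z)^* * (h z)%:C).
    by apply: (di_weight a_disc a_inj p_gt _ HM1); apply: cmeasM => //; exact: cmeasM.
  have i2 al : unit_disc al -> disc_integrable (fun z => (g z)^* * tz n z / (z - al)^*).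
    by move=> alD; apply: (di_inv_dist alD _ HM2); exact: cmeasM.
  have i3 al (x : C) : unit_disc al ->
     disc_integrable (fun z => x * ((g z)^* * tz n z / (z - al)^*)).
    by move=> alD; apply: di_integrableZ; exact: i2.
  pose T z := rho0^* * ((g z)^* * tz n z / (z - zeta)^*) +
     \sum_k (c k)^* * ((g z)^* * tz n z / (z - a k)^*).
  have iS : disc_integrable (fun z => \sum_k (c k)^* * ((g z)^* * tz n z / (z - a k)^*)).
    by apply: di_integrable_sum => k _; exact: i3.
  have iT : disc_integrable T by apply: di_integrableD => //; exact: i3.
  have TI : disc_integral T =
      rho0^* * ((g zeta)^* * i n zeta) + \sum_k (c k)^* * ((g (a k))^* * i n (a k)).
    rewrite diD //; last exact: i3.
    rewrite diZ; last exact: i2.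
    rewrite (pole_value hg (Ht n) eD) di_sum; last by move=> k _; exact: i3.
    congr (_ + _); apply: eq_bigr => k _.
    by rewrite diZ; [rewrite (pole_value hg (Ht n) (a_disc k))|exact: i2].
  have mdU : cmeas (fun z => (dcut (dl n) z)%:C * U z).
    by apply: cmeasM => //; apply: cmeas_cont => z _; exact: ccont_dcut.
  have [] := @di_off _ ss _ _ (di_integrableB i1 iT) mdU.
    move=> z zD; rewrite inE negb_or => /andP[ze za].
    have eE : e z = rho0^* / (z - zeta)^* + \sum_k (c k)^* / (z - a k)^*.
      rewrite /e -fmorphV (partial_fractions a_disc a_inj eD zD ea za ze).
      have JE (x y : C) : (x / y)^* = x^* / y^* by rewrite rmorphM fmorphV.
      by rewrite rmorphD rmorph_sum; congr (_ + _); [exact: JE|apply: eq_bigr => k _; exact: JE].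
    have -> : T z = (g z)^* * tz n z * e z.
      rewrite eE mulrDr /T; congr (_ + _); first by ring.
      by rewrite mulr_sumr; apply: eq_bigr => k _; ring.
    by rewrite /U /tz; ring.
  move=> _; rewrite diB // TI => <-; ring.
have := ccvg_unique lim1.
have lim4 : ccvg (fun n => - disc_integral (fun z => (dcut (dl n) z)%:C * U z)
   - (rho0^* * ((g zeta)^* * i n zeta) + \sum_k (c k)^* * ((g (a k))^* * i n (a k))))
   (- 0 - (rho0^* * ((g zeta)^* * - 1) + \sum_k (c k)^* * ((g (a k))^* * - 1))).
  apply: ccvgB; first exact: ccvgN.
  apply: ccvgD; first by do 2 apply: ccvgZ; exact: lim3.
  by apply: ccvg_sum => k _; do 2 apply: ccvgZ; apply: lim3.
move=> /(_ _ (ccvg_ext (fun n => esym (uE n)) lim4)) ->.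
rewrite oppr0 sub0r opprD -sumrN gE; congr (_ + _); first by rewrite /rho0; ring.
by apply: eq_bigr => k _; rewrite gE; ring.
Qed.

(** The explicit part of the expansion of [K w zeta]; [kernel_coef k] is the
    coefficient of [K w (a k)]. *)
Definition kernel_head w zeta : C := (B zeta)^* *
  wder a p (fun z => z / (1 - zeta^* * z)) (fun z => (1 - zeta^* * z) ^- 2) w.

Definition kernel_coef k zeta : C :=
  (1 - `|a k| ^+ 2) * (Bx k zeta)^* / ((1 - a k * zeta^*) * (Bx k (a k))^*).

Lemma conj_den (x y : C) : (1 - x^* * y)^* = 1 - y^* * x.
Proof. by rewrite rmorphB rmorphM rmorph1 /= conjCK mulrC. Qed.

Lemma conj_norm2 (x : C) : (1 - `|x| ^+ 2)^* = 1 - `|x| ^+ 2.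
Proof. by rewrite normC_sqr rmorphB rmorphM rmorph1 /= conjCK mulrC. Qed.

Lemma blaschke_root k : B (a k) = 0.
Proof. by rewrite (blaschkeE a k) phiE subrr mul0r mul0r. Qed.

Lemma blaschke_except_root k j : j != k -> Bx k (a j) = 0.
Proof.
by move=> jk; rewrite /blaschke_except (bigD1 j) //= phiE subrr !mul0r.
Qed.

(** At [zeta = a i] both sides are [K w (a i)], since [B] vanishes there and
    [kernel_coef k (a i)] is 1 for k = i and 0 otherwise; elsewhere this is
    [kernel_expansion_off] solved for [K w zeta]. *)
Lemma kernel_expansion w zeta : unit_disc w -> unit_disc zeta ->
  K w zeta = kernel_head w zeta + \sum_k kernel_coef k zeta * K w (a k).
Proof.
move=> wD eD; have dn := blaschke_den_neq0.
have [/codomP[i ->]|ea] := boolP (zeta \in codom a).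
  rewrite /kernel_head blaschke_root rmorph0 mul0r add0r (bigD1 i) //= big1 ?addr0 => [|k ki].
    rewrite /kernel_coef normC_sqr mulrC divff ?mulr1 // mulf_neq0 //.
      by rewrite mulrC dn.
    by rewrite conjC_eq0 blaschke_except_neq0.
  by rewrite /kernel_coef blaschke_except_root 1?eq_sym // rmorph0 mulr0 !mul0r.
have Bn : (B zeta)^* != 0 by rewrite conjC_eq0 blaschke_neq0.
rewrite /kernel_head (kernel_expansion_off wD eD ea) fmorphV mulrDr mulrA divff // mul1r.
rewrite -addrA -[LHS]addr0; congr (_ + _); apply/esym/eqP.
rewrite mulr_sumr -big_split /= big1 // => k _.
rewrite mulrA -mulrDl; apply/eqP; rewrite mulf_eq0; apply/orP; left; apply/eqP.
have za : zeta != a k by apply: contra ea => /eqP ->; exact: codom_f.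
have az : (a k)^* - zeta^* != 0.
  by rewrite -rmorphB conjC_eq0 subr_eq0 eq_sym.
have b0 : (Bx k (a k))^* != 0 by rewrite conjC_eq0 blaschke_except_neq0.
have d0 : 1 - a k * zeta^* != 0 by rewrite mulrC dn.
have d1 : 1 - (a k)^* * zeta != 0 by rewrite dn.
have -> : ((1 - `|a k| ^+ 2) / ((a k - zeta) * Bx k (a k)))^* =
   (1 - `|a k| ^+ 2) / (((a k)^* - zeta^*) * (Bx k (a k))^*).
  by rewrite rmorphM fmorphV /= conj_norm2 rmorphM rmorphB.
have -> : (B zeta)^* = (zeta^* - (a k)^*) / (1 - a k * zeta^*) * (Bx k zeta)^*.
  rewrite (blaschkeE a k) phiE !rmorphM fmorphV /= conj_den rmorphB.
  by rewrite [zeta^* * _]mulrC.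
rewrite /kernel_coef.
move: az b0 d0 {d1}; move: (zeta^*) ((a k)^*) ((Bx k (a k))^*) ((Bx k zeta)^*) => x y u v az b0 d0.
by field; rewrite az b0 d0.
Qed.

(** By the expansion, the conjugate of [K w] is an explicit bounded function on
    the disc. This is what allows the kernel itself to be inserted in the
    reproducing property. *)
Lemma kernel_bounded w : unit_disc w ->
  exists M, forall z, unit_disc z -> cabs (K w z)^* <= M.
Proof.
move=> wD.
pose S := \sum_k (p k / 2 + 1)%:C * (Bx k w * dphi k w).
pose F z := B z * ((B w)^* * ((1 - w^* * z)^-1 * (1 - w^* * z)^-1) + w^* * (1 - w^* * z)^-1 * S^*)
   + \sum_k (1 - `|a k| ^+ 2) * ((Bx k (a k))^-1 * (K w (a k))^*) *
            (Bx k z * (1 - (a k)^* * z)^-1).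
have [_ [M HM]] : bounded_holo F.
  apply: bounded_holoD; last first.
    apply: bounded_holo_sum => k; apply: bounded_holoM; first exact: bounded_holo_cst.
    by apply: bounded_holoM; [exact: bounded_holo_blaschke_except|exact: bounded_holo_den].
  apply: bounded_holoM; first exact: bounded_holo_blaschke.
  apply: bounded_holoD; apply: bounded_holoM.
  - exact: bounded_holo_cst.
  - by apply: bounded_holoM; exact: bounded_holo_den.
  - by apply: bounded_holoM; [exact: bounded_holo_cst|exact: bounded_holo_den].
  - exact: bounded_holo_cst.
exists M => z zD; rewrite (_ : (K w z)^* = F z) ?HM //.
rewrite (kernel_expansion wD zD) rmorphD rmorph_sum /F; congr (_ + _).
  rewrite /kernel_head /wder rmorphM /= conjCK; congr (_ * _).
  rewrite -/S rmorphD !rmorphM !fmorphV expr2 rmorphM /= conj_den.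
  by rewrite invfM.
apply: eq_bigr => k _; rewrite /kernel_coef !rmorphM fmorphV rmorphM /= !conjCK conj_norm2.
have -> : (1 - a k * z^*)^* = 1 - (a k)^* * z by rewrite mulrC conj_den.
by rewrite invfM; ring.
Qed.

(** Reproducing the conjugate of [K w] at [zeta] and the conjugate of [K zeta]
    at [w] yields two mutually conjugate integrals. *)
Lemma kernel_hermitian w zeta : unit_disc w -> unit_disc zeta ->
  K w zeta = (K zeta w)^*.
Proof.
have swap u v : unit_disc u -> unit_disc v ->
    disc_integrable (fun z => (K u z)^* * K v z * (h z)%:C) /\
    (K u v)^* = disc_integral (fun z => (K u z)^* * K v z * (h z)%:C).
  move=> uD vD; have [_ /(_ u uD) au H] := K_kernel.
  by apply: (H (fun z => (K u z)^*) v) => //; apply: bounded_bergman => //; exact: kernel_bounded.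
move=> wD eD; have [i1 ->] := swap _ _ eD wD; rewrite -[LHS]conjCK.
have [i2 ->] := swap _ _ wD eD; rewrite -diJ //; apply: eq_di => z _.
by rewrite !rmorphM /= conjCK conjR; ring.
Qed.

(** Insert [K w (a j) = (K (a j) w)^*] and expand it again. The head at [a j]
    reduces to the term of index [j] because [B] vanishes at [a j]; the terms
    linear in [p k / 2 + 1] combine through (v - b) w (1 - a b) + (w - a) b (1
    - v w) = (v w - a b) (1 - b w), with v and b the conjugates of zeta and a =
    a k. *)
Lemma kernel_formula w zeta : unit_disc w -> unit_disc zeta ->
  K w zeta =
    B w * (B zeta)^* / (1 - zeta^* * w) ^+ 2
    + \sum_k (p k / 2 + 1)%:C * Bx k w * (Bx k zeta)^* * (zeta^* * w - `|a k| ^+ 2)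
        / ((1 - zeta^* * w) * (1 - (a k)^* * w) * (1 - a k * zeta^*))
    + \sum_k \sum_j
        (1 - `|a k| ^+ 2) * (1 - `|a j| ^+ 2) * Bx k w * (Bx j zeta)^*
        / ((1 - (a k)^* * w) * (1 - a j * zeta^*) * Bx k (a k) * (Bx j (a j))^*)
        * K (a k) (a j).
Proof.
move=> wD eD; have dn := blaschke_den_neq0.
have headJ j : (kernel_head (a j) w)^* = B w *
    ((a j)^* / (1 - (a j)^* * w) * ((p j / 2 + 1)%:C * ((Bx j (a j))^* / (1 - `|a j| ^+ 2)))).
  rewrite /kernel_head /wder blaschke_root mul0r add0r (bigD1 j) //= big1 ?addr0 => [|k kj]; last first.
    by rewrite blaschke_except_root 1?eq_sym // mul0r mulr0.
  rewrite !rmorphM !fmorphV /= conjCK conj_den conjR; congr (_ * (_ * (_ * (_ * _)))).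
  rewrite normC_sqr [a j * _]mulrC rmorphXn /= conj_den.
  by field; rewrite dn.
have Kj j : K w (a j) = (kernel_head (a j) w)^* + \sum_k (kernel_coef k w)^* * K (a k) (a j).
  rewrite kernel_hermitian // (kernel_expansion _ wD) // rmorphD rmorph_sum.
  congr (_ + _); apply: eq_bigr => k _; rewrite rmorphM; congr (_ * _).
  by apply/esym/kernel_hermitian.
rewrite (kernel_expansion wD eD).
under eq_bigr => j _ do rewrite Kj mulrDr.
rewrite big_split /= addrA; congr (_ + _); last first.
  under eq_bigr do rewrite mulr_sumr.
  rewrite exchange_big; apply: eq_bigr => k _; apply: eq_bigr => j _ /=.
  rewrite mulrA; congr (_ * _).
  have -> : (kernel_coef k w)^* =
     (1 - `|a k| ^+ 2) * Bx k w / ((1 - (a k)^* * w) * Bx k (a k)).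
    rewrite /kernel_coef !rmorphM fmorphV rmorphM /= !conjCK conj_norm2.
    by rewrite [a k * _]mulrC conj_den.
  by rewrite /kernel_coef !invfM; ring.
rewrite /kernel_head /wder mulrDr -addrA; congr (_ + _); first by ring.
rewrite mulrA mulr_sumr -big_split /=; apply: eq_bigr => k _.
rewrite headJ /kernel_coef /dphi.
have -> : (B zeta)^* = (zeta^* - (a k)^*) / (1 - a k * zeta^*) * (Bx k zeta)^*.
  rewrite (blaschkeE a k) phiE !rmorphM fmorphV /= conj_den rmorphB.
  by rewrite [zeta^* * _]mulrC.
rewrite (blaschkeE a k w) phiE normC_sqr.
have b0 : (Bx k (a k))^* != 0 by rewrite conjC_eq0 blaschke_except_neq0.
have d0 : 1 - a k * zeta^* != 0 by rewrite mulrC dn.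
have d1 : 1 - (a k)^* * w != 0 by rewrite dn.
have d2 : 1 - zeta^* * w != 0 by rewrite dn.
have d3 : 1 - a k * (a k)^* != 0 by rewrite mulrC dn.
move: b0 d0 d1 d2 d3; move: (zeta^*) ((a k)^*) ((Bx k (a k))^*) ((Bx k zeta)^*) ((p k / 2 + 1)%:C) (Bx k w).
move=> x y u v t b b0 d0 d1 d2 d3.
by field; rewrite b0 d0 d1 d2 d3.
Qed.

End kernel.

Local Open Scope complex_scope.
Theorem mainTheorem3 (R : realType) (s : nat) (a : 'I_s -> R[i])
    (p : 'I_s -> R) (K : R[i] -> R[i] -> R[i])
    (s_ge1 : (1 <= s)%N)
    (a_disc : forall k, unit_disc (a k))
    (a_distinct : injective a)
    (p_gt : forall k, -2 < p k)
    (K_kernel : reproducing_kernel (blaschke_weight a p) K)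
    (z zeta : R[i]) (z_disc : unit_disc z) (zeta_disc : unit_disc zeta) :
  K z zeta =
    blaschke a z * (blaschke a zeta)^* / (1 - zeta^* * z) ^+ 2
    + \sum_(k < s)
        (p k / 2 + 1)%:C * blaschke_except a k z * (blaschke_except a k zeta)^*
          * (zeta^* * z - `|a k| ^+ 2)
        / ((1 - zeta^* * z) * (1 - (a k)^* * z) * (1 - a k * zeta^*))
    + \sum_(k < s) \sum_(j < s)
        (1 - `|a k| ^+ 2) * (1 - `|a j| ^+ 2)
          * blaschke_except a k z * (blaschke_except a j zeta)^*
        / ((1 - (a k)^* * z) * (1 - a j * zeta^*)
           * blaschke_except a k (a k) * (blaschke_except a j (a j))^*)
        * K (a k) (a j).
Proof. exact: (kernel_formula a_disc a_distinct p_gt K_kernel z_disc zeta_disc). Qed.
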